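(* Let $n\ge2$, let $K\subset(0,\infty)$ be compact, let $\mathsf A$ be a compact metric space, and let $L:K\times\mathsf A\to[0,\infty)$ be bounded and continuous. For an action-valued POVM $D$ on $\mathcal H^{\otimes n}$ with outcomes in $\mathsf A$ put $R_{z,N}(D):=\int_{\mathsf A}L(N,a)\operatorname{Tr}[\rho_{z,N}^{\otimes n}D(da)]$, and for a Markov kernel (randomized decision rule) $\delta$ from $\mathbb N_0$ to $\mathsf A$ put $$\mathbb E_NL(N,\delta(S)):=\sum_{s=0}^\infty p_N^{(n-1)}(s)\int_{\mathsf A}L(N,a)\,\delta(s,da),\qquad p_N^{(m)}(s)=\binom{s+m-1}{m-1}\frac1{(N+1)^m}\Bigl(\frac N{N+1}\Bigr)^s .$$ Then $$\inf_D\sup_{z\in\mathbb C,\,N\in K}R_{z,N}(D)=\inf_\delta\sup_{N\in K}\mathbb E_NL(N,\delta(S)).$$ Likewise, for every probability measure $\Pi$ supported on $K$, $$\inf_D\sup_{z\in\mathbb C}\int_KR_{z,N}(D)\,\Pi(dN)=\inf_\delta\int_K\mathbb E_NL(N,\delta(S))\,\Pi(dN).$$ Here $\inf_D$ is over all action-valued POVMs on $\mathcal H^{\otimes n}$ with outcomes in $\mathsf A$ and $\inf_\delta$ is over all randomized decision rules based on $S\sim p_N^{(n-1)}$.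
   Context: $\mathcal H=L^2(\mathbb R)$ with number (Hermite) basis $\{|k\rangle\}_{k\ge0}$, annihilation operator $a$ ($a|k\rangle=\sqrt k|k-1\rangle$), displacement operators $D(z)=\exp(za^\dagger-\bar za)$, $z\in\mathbb C$. The thermal state with mean photon number $N>0$ is $\phi_N=\frac1{N+1}\sum_{k\ge0}\bigl(\frac N{N+1}\bigr)^k|k\rangle\langle k|$, and $\rho_{z,N}=D(z)\phi_ND(z)^\dagger$. An action-valued POVM is a map from the Borel sets of $\mathsf A$ to positive bounded operators on $\mathcal H^{\otimes n}$, countably additive in the weak operator topology, with total mass $I$. *)

(* Defs.v *)
From HB Require Import structures.
From mathcomp Require Import all_boot all_order all_algebra.
From mathcomp Require Import complex.
From mathcomp Require Import all_classical all_reals all_analysis.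

Set Implicit Arguments.
Unset Strict Implicit.
Unset Printing Implicit Defensive.

Import Order.TTheory GRing.Theory Num.Theory.
Import numFieldNormedType.Exports.

Local Open Scope classical_set_scope.
Local Open Scope ring_scope.
Local Open Scope complex_scope.

(* A complex Hilbert space is a complete normed space whose norm comes from an
   inner product.  The forms of sesquilinear.v are linear in the first
   argument, hence the swap in [braket], which is linear in the second. *)
HB.mixin Record CompleteNormedModule_isHilbert (R : realType) T
    & CompleteNormedModule R[i] T := {
  hdot : {dot T for (@Num.conj R[i])} ;
  hdot_norm : forall v : T, `|v| ^+ 2 = hdot v v
}.

#[short(type="hilbertType")]
HB.structure Definition Hilbert (R : realType) :=
  {T of CompleteNormedModule R[i] T & CompleteNormedModule_isHilbert R T}.

Definition braket (R : realType) (H : hilbertType R) (u v : H) : R[i] :=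
  hdot v u.

Notation "⟨ u , v ⟩" := (braket u v)
  (at level 0, u at level 99, v at level 99, format "⟨ u ,  v ⟩") : ring_scope.

Section hilbert_space.
Context {R : realType} {H : hilbertType R}.

Definition finite_span (S : set H) : set H :=
  [set v | exists (m : nat) (c : 'I_m -> R[i]) (x : 'I_m -> H),
     (forall i, S (x i)) /\ v = \sum_(i < m) c i *: x i].

Definition orthonormal_basis (f : nat -> H) : Prop :=
  (forall j k, ⟨f j, f k⟩ = (j == k)%:R) /\
  closure (finite_span (range f)) = [set: H].

Definition bounded_operator (T : H -> H) : Prop := linear T /\ continuous T.

Definition adjoint (T : H -> H) (v : H) : H :=
  xget 0 [set w | forall u, ⟨w, u⟩ = ⟨v, T u⟩].

(* The value shared by all orthonormal bases, as for trace class operators on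
   a separable infinite-dimensional space; 0 if there is none. *)
Definition trace (T : H -> H) : R[i] :=
  xget 0 [set t | forall f, orthonormal_basis f ->
    series (fun k => ⟨f k, T (f k)⟩ : R[i]^o) @ \oo --> (t : R[i]^o)].

End hilbert_space.

Section single_mode.
Context {R : realType} {H : hilbertType R}.
(* The number basis of the mode: any Hilbert space with an orthonormal basis,
   such as L^2 of the line with the Hermite functions. *)
Variable ket : nat -> H.

(* The closed operators a|k+1> = sqrt(k+1) |k> and a^†|k> = sqrt(k+1) |k+1>
   in coordinates; the values outside their domain, where the series diverges,
   are never used. *)
Definition annihilation (v : H) : H :=
  limn (series (fun k =>
    ((Num.sqrt (k.+1%:R : R))%:C * ⟨ket k.+1, v⟩) *: ket k)).

Definition creation (v : H) : H :=
  limn (series (fun k =>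
    ((Num.sqrt (k.+1%:R : R))%:C * ⟨ket k, v⟩) *: ket k.+1)).

Definition displacement_generator (z : R[i]) (v : H) : H :=
  z *: creation v - z^* *: annihilation v.

(* The number vectors are entire analytic vectors of the unbounded generator:
   on each of them the exponential series converges, and the unitary
   D(z) = exp(z a^† - \bar z a) is its continuous linear extension. *)
Definition displacement_ket (z : R[i]) (k : nat) : H :=
  limn (series (fun m =>
    (m`!%:R)^-1 *: iter m (displacement_generator z) (ket k))).

Definition displacement (z : R[i]) (v : H) : H :=
  limn (series (fun k => ⟨ket k, v⟩ *: displacement_ket z k)).

Definition thermal (N : R) (v : H) : H :=
  limn (series (fun k =>
    (((N + 1)^-1 * (N / (N + 1)) ^+ k)%:C * ⟨ket k, v⟩) *: ket k)).

Definition displaced_thermal (z : R[i]) (N : R) : H -> H :=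
  displacement z \o thermal N \o adjoint (displacement z).

End single_mode.

Section tensor_power.
Context {R : realType} {H Hn : hilbertType R} {n : nat}.

Definition subst_at (u : 'I_n -> H) (i : 'I_n) (x : H) : 'I_n -> H :=
  fun j => if j == i then x else u j.

(* [tens] exhibits [Hn] as the n-fold Hilbert space tensor power of [H]; this
   determines [Hn] and [tens] up to a unique unitary. *)
Definition is_tensor_power (tens : ('I_n -> H) -> Hn) : Prop :=
  [/\ forall u i, linear (fun x => tens (subst_at u i x)),
      forall u v, ⟨tens u, tens v⟩ = \prod_(i < n) ⟨u i, v i⟩ &
      closure (finite_span (range tens)) = [set: Hn]].

Definition operator_power (tens : ('I_n -> H) -> Hn) (T : H -> H) : Hn -> Hn :=
  xget (\0 : Hn -> Hn) [set S : Hn -> Hn | bounded_operator S /\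
    forall u, S (tens u) = tens (fun i => T (u i))].

End tensor_power.

#[short(type="pmetricType")]
HB.structure Definition PointedMetric (K : numDomainType) :=
  {T of Metric K T & isPointed T}.

Notation borelType A := (g_sigma_algebraType (@open A)).

Section decision_problem.
Context {R : realType} {A : pmetricType R}.

Section quantum.
Context {H Hn : hilbertType R} {n : nat}.

Definition is_povm (D : set (borelType A) -> Hn -> Hn) : Prop :=
  [/\ forall B : set (borelType A), measurable B ->
        bounded_operator (D B) /\ forall v, 0 <= ⟨v, D B v⟩,
      forall F : (set (borelType A))^nat, (forall i, measurable (F i)) ->
        trivIset [set: nat] F ->
        forall u v, series (fun i => ⟨u, D (F i) v⟩ : R[i]^o) @ \oo -->
                    (⟨u, D (\bigcup_i F i) v⟩ : R[i]^o) &
      D [set: borelType A] = idfun].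

(* Tr[ρ^{⊗n} D(B)], which is real and nonnegative since both factors are
   positive operators. *)
Definition outcome_prob (ket : nat -> H) (tens : ('I_n -> H) -> Hn)
    (z : R[i]) (N : R) (D : set (borelType A) -> Hn -> Hn)
    (B : set (borelType A)) : \bar R :=
  (complex.Re (trace
    (operator_power tens (displaced_thermal ket z N) \o D B)))%:E.

Definition quantum_risk (ket : nat -> H) (tens : ('I_n -> H) -> Hn)
    (L : R -> A -> R) (z : R[i]) (N : R)
    (D : set (borelType A) -> Hn -> Hn) : \bar R :=
  (\int[outcome_prob ket tens z N D]_(a in [set: borelType A]) (L N a)%:E)%E.

End quantum.

Definition negbin (m : nat) (N : R) (s : nat) : R :=
  'C((s + m).-1, m.-1)%:R * ((N + 1) ^+ m)^-1 * (N / (N + 1)) ^+ s.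

Definition classical_risk (m : nat) (L : R -> A -> R) (N : R)
    (delta : R.-pker nat ~> borelType A) : \bar R :=
  (\sum_(0 <= s <oo)
     (negbin m N s)%:E * \int[delta s]_(a in [set: borelType A]) (L N a)%:E)%E.

End decision_problem.

(* Main.v *)
(** A real orthogonal reflection of the [n] modes turns the [n]-fold displacement
    by [z] into a displacement by [sqrt n * z] of a single signal mode and fixes
    the [n]-fold thermal state.  The other [n - 1] noise modes then carry no
    information on [z]: their total photon number [S] has the negative binomial
    law, and given [S] the occupation pattern is uniform.  Counting noise photons
    and applying a rule to [S] is therefore a POVM with the risk of that rule, for
    every [z].  Conversely, averaging over displacements in a large fine grid makes
    the number states of the signal mode indistinguishable, uniformly over all
    measurements.  So replacing the thermal signal by the vacuum turns a POVM into
    a rule based on [S] whose risk exceeds an average over [z] of the risks of the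
    POVM by at most [eps], uniformly in [N] in [K].  The averaging estimate
    telescopes along the grid: the number-state differences are commutators of
    bounded forms with the displacement generators, that is, derivatives along
    the grid lines up to second-order terms. *)

(* The plane carries no translation-invariant probability, and a limit of averaged POVMs would call
   for a compactness argument; finite grids avoid both at the price of [eps]. On a grid of mesh 1/q
   with q^2 points per side, each line telescopes to end terms of size O(1), and its q^2
   second-order remainders of size q^-2 also add up to O(1). The q^2 lines thus bound the sum of the
   increments by O(q^2), hence the sum of the derivatives by O(q^3), and dividing by the q^4 points
   leaves O(1/q). The constant depends on the photon number, so it is used only below a cutoff [k0];
   compactness of K keeps N/(N+1) below some x1 < 1, which makes the mass beyond the cutoff
   uniformly small. Displacements are given only by a series on number states. Rather than
   manipulating exponentials of unbounded operators, the proof characterises the matrix elements of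
   D(z) by ladder recursions whose solutions are proportional; adjoints, unitarity, the composition
   law up to a phase and the factorisation over the rotated modes are all instances of this
   uniqueness. *)
Require Import Defs.
From HB Require Import structures.
From mathcomp Require Import all_boot all_order all_algebra.
From mathcomp Require Import complex.
From mathcomp Require Import all_classical all_reals all_analysis.
From mathcomp Require mpoly.
Import -(notations) mpoly.
From mathcomp Require Import measurable_realfun ring lra zify.

Set Implicit Arguments.
Unset Strict Implicit.
Unset Printing Implicit Defensive.

Import Order.TTheory GRing.Theory Num.Theory.
Import numFieldNormedType.Exports.

Local Open Scope classical_set_scope.
Local Open Scope ring_scope.

Local Notation "x %:C" := (real_complex _ x)
  (format "x %:C") : ring_scope.

(** * Hilbert space preliminaries *)

Section real_norm.
Context {R : realType}.
Local Notation C := R[i].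

(** Norms over [R[i]] take values in [R[i]]; the real-valued version gives access to the order, the
    limits and the linear arithmetic of [R]. *)
Definition rnorm (T : normedZmodType C) (x : T) : R := complex.Re `|x|.

Section zmod.
Context {T : normedZmodType C}.
Implicit Types x y : T.

Lemma rnormE x : (rnorm x)%:C = `|x|.
Proof. by rewrite /rnorm RRe_real// ger0_real. Qed.

Lemma rnorm_le x (r : R) : (rnorm x <= r) = (`|x| <= r%:C).
Proof. by rewrite -rnormE lecR. Qed.

Lemma rnorm_lt x (r : R) : (rnorm x < r) = (`|x| < r%:C).
Proof. by rewrite -rnormE ltcR. Qed.

Lemma rnorm_ge0 x : 0 <= rnorm x.
Proof. by rewrite -lecR rnormE; exact: normr_ge0. Qed.

Lemma rnorm0 : rnorm (0 : T) = 0.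
Proof. by rewrite /rnorm normr0. Qed.

Lemma rnormN x : rnorm (- x) = rnorm x.
Proof. by rewrite /rnorm normrN. Qed.

Lemma rnorm_sub x y : rnorm (x - y) = rnorm (y - x).
Proof. by rewrite /rnorm distrC. Qed.

Lemma rnormD x y : rnorm (x + y) <= rnorm x + rnorm y.
Proof. by rewrite rnorm_le rmorphD /= !rnormE; exact: ler_normD. Qed.

Lemma rnorm_dist x y z : rnorm (x - z) <= rnorm (x - y) + rnorm (y - z).
Proof. by have -> : x - z = (x - y) + (y - z); [rewrite addrA subrK | exact: rnormD]. Qed.

Lemma rnorm_eq0 x : (rnorm x == 0) = (x == 0).
Proof. by rewrite -(inj_eq (@complexI _)) rnormE normr_eq0. Qed.

Lemma rnorm_sum (I : Type) (s : seq I) (P : pred I) (F : I -> T) :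
  rnorm (\sum_(i <- s | P i) F i) <= \sum_(i <- s | P i) rnorm (F i).
Proof.
elim/big_rec2: _ => [|i r x _ le_xr]; first by rewrite rnorm0.
by rewrite (le_trans (rnormD _ _))// lerD2l.
Qed.

End zmod.

Lemma rnormZ (T : normedModType C) (a : C) (x : T) :
  rnorm (a *: x) = rnorm a * rnorm x.
Proof. by apply: complexI; rewrite rmorphM /= !rnormE normrZ. Qed.

Lemma rnormM (a b : C) : rnorm (a * b) = rnorm a * rnorm b.
Proof. by apply: complexI; rewrite rmorphM /= !rnormE normrM. Qed.

Lemma rnormX (a : C) n : rnorm (a ^+ n) = rnorm a ^+ n.
Proof. by apply: complexI; rewrite rmorphXn /= !rnormE normrX. Qed.

Lemma rnormV (a : C) : rnorm a^-1 = (rnorm a)^-1.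
Proof. by apply: complexI; rewrite fmorphV /= !rnormE normfV. Qed.

Lemma rnorm1 : rnorm (1 : C) = 1.
Proof. by rewrite /rnorm normr1. Qed.

Lemma rnormR (r : R) : rnorm r%:C = `|r|.
Proof. by rewrite /rnorm normc_def /= expr0n addr0 sqrtr_sqr. Qed.

Lemma rnorm_nat n : rnorm (n%:R : C) = n%:R.
Proof. by rewrite -[n%:R](rmorph_nat (real_complex R)) rnormR normr_nat. Qed.

Lemma rnorm_conj (a : C) : rnorm a^* = rnorm a.
Proof. by rewrite /rnorm norm_conjC. Qed.

Lemma mulC_conj (a : C) : a * a^* = (rnorm a ^+ 2)%:C.
Proof. by rewrite rmorphXn /= rnormE normCK. Qed.

Lemma Re_le_rnorm (a : C) : `|complex.Re a| <= rnorm a.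
Proof. by rewrite -lecR rnormE normc_ge_Re. Qed.

Lemma cvg_rnorm (T : normedModType C) (u : nat -> T) (l : T) :
  u @ \oo --> l <-> (fun n => rnorm (u n - l)) @ \oo --> (0 : R).
Proof.
split=> [/cvgrPdist_lt ul|/cvgrPdist_lt ul]; apply/cvgrPdist_lt => e e0.
- have /ul : 0 < e%:C by rewrite ltcR.
  apply: filterS => n; rewrite sub0r normrN ger0_norm ?rnorm_ge0//.
  by rewrite rnorm_lt distrC.
- have e_real : e \is Num.real by apply: gtr0_real.
  have [e' e'0 ->] : exists2 e' : R, 0 < e' & e = e'%:C.
    by exists (complex.Re e); [rewrite -ltcR|]; rewrite RRe_real.
  have := ul _ e'0.
  apply: filterS => n; rewrite sub0r normrN ger0_norm ?rnorm_ge0//.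
  by rewrite rnorm_lt distrC.
Qed.

Lemma cvg_rnorm_le (T : normedModType C) (u : nat -> T) (l : T) (s : nat -> R) :
  (\forall n \near \oo, rnorm (u n - l) <= s n) -> s @ \oo --> (0 : R) ->
  u @ \oo --> l.
Proof.
move=> us s0; apply/cvg_rnorm; apply: squeeze_cvgr (@cvg_cst _ _ _ _ _) s0.
by apply: filterS us => n ->; rewrite rnorm_ge0.
Qed.

Lemma cvg_norm_rnorm (T : normedModType C) (u : nat -> T) (l : T) :
  u @ \oo --> l -> (fun n => rnorm (u n)) @ \oo --> rnorm l.
Proof.
move=> /cvg_rnorm/cvgrPdist_lt ul; apply/cvgrPdist_lt => e /ul.
apply: filterS => n; rewrite sub0r normrN ger0_norm ?rnorm_ge0//.
apply: le_lt_trans; rewrite ler_norml.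
have := rnormD (u n - l) l; have := rnormD (l - u n) (u n).
by rewrite !subrK (rnorm_sub l); lra.
Qed.

Lemma cvg_of_dist (T : completeNormedModType C) (u : nat -> T) :
  (forall e : R, 0 < e -> exists N, forall n, (N <= n)%N ->
     rnorm (u n - u N) <= e) -> cvgn u.
Proof.
move=> hu; apply/cauchy_cvgP/cauchy_exP => e e0.
have [e' e'0 ->] : exists2 e' : R, 0 < e' & e = e'%:C.
  by exists (complex.Re e); [rewrite -ltcR|]; rewrite RRe_real// gtr0_real.
have [N hN] := hu _ (divr_gt0 e'0 (ltr0Sn _ 1)).
exists (u N); exists N => // n /= /hN hn.
rewrite -ball_normE /ball_ /= distrC -rnorm_lt.
by apply: le_lt_trans hn _; lra.
Qed.

(** Cauchy criterion with increments majorised by those of a bounded monotone sequence. The case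
    [k = 0] serves absolutely convergent series, [k = 1] orthogonal series, where squared norms
    add. *)
Lemma cvg_of_mono (T : completeNormedModType C) (u : nat -> T) (s : nat -> R) (M : R) k :
  {homo s : m n / (m <= n)%N >-> m <= n} -> (forall n, s n <= M) ->
  (forall m n, (m <= n)%N -> rnorm (u n - u m) ^+ k.+1 <= s n - s m) -> cvgn u.
Proof.
move=> s_mono sM us; apply: cvg_of_dist => e e0.
have /cvgrPdist_lt : s @ \oo --> limn s.
  by apply: nondecreasing_is_cvgn => //; exists M => _ [n _ <-].
move=> /(_ _ (exprn_gt0 k.+1 e0)) [N _ hN]; exists N => n Nn.
rewrite -(@ler_pXn2r _ k.+1) ?nnegrE ?rnorm_ge0 ?(ltW e0)//.
apply: (le_trans (us _ _ Nn)).
have s_lim : s n <= limn s.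
  by apply: nondecreasing_cvgn_le => //; apply: nondecreasing_is_cvgn => //;
    exists M => _ [m _ <-].
have := hN N (leqnn N); rewrite /= ltr_norml => /andP[_ h].
by apply: ltW; apply: le_lt_trans h; rewrite lerB.
Qed.

Lemma cvg_ext (T : topologicalType) (u v : nat -> T) (l : T) :
  (forall n, u n = v n) -> u @ \oo --> l -> v @ \oo --> l.
Proof. by move=> /funext ->. Qed.

Lemma cvg_comp_continuous (T T' : topologicalType) (f : T -> T') (u : nat -> T) (l : T) :
  continuous f -> u @ \oo --> l -> (fun n => f (u n)) @ \oo --> f l.
Proof. by move=> f_cont ul; apply: continuous_cvg => //; exact: f_cont. Qed.

Lemma limR_le (u : nat -> R) (l M : R) :
  u @ \oo --> l -> (\forall n \near \oo, u n <= M) -> l <= M.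
Proof.
move=> ul uM; rewrite -(cvg_lim (@Rhausdorff R) ul).
by apply: limr_le => //; apply/cvg_ex; exists l.
Qed.

Lemma limR_sqr (u : nat -> R) (l : R) :
  u @ \oo --> l -> (fun n => u n ^+ 2) @ \oo --> l ^+ 2.
Proof. by move=> ul; exact: (cvgM ul ul). Qed.

Lemma limn_eq (T : normedModType C) (u : nat -> T) (l : T) :
  u @ \oo --> l -> limn u = l.
Proof. by move=> /cvg_lim; apply; exact: norm_hausdorff. Qed.

Lemma cvg_uniq (T : normedModType C) (u : nat -> T) (l l' : T) :
  u @ \oo --> l -> u @ \oo --> l' -> l = l'.
Proof. by move=> /limn_eq <- /limn_eq <-. Qed.

End real_norm.

Lemma realC_real {R : realType} (r : R) : r%:C \is Num.real.
Proof. by rewrite realE -[0]/(0%:C) !lecR le_total. Qed.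

Section linear_maps.
Context {K : pzRingType} {U V : lmodType K} (f : U -> V) (f_lin : linear f).

Definition linear_of : {linear U -> V} :=
  HB.pack f (GRing.isLinear.Build _ _ _ _ f f_lin).

Lemma lin0 : f 0 = 0. Proof. exact: (linear0 linear_of). Qed.
Lemma linD x y : f (x + y) = f x + f y. Proof. exact: (linearD linear_of). Qed.
Lemma linB x y : f (x - y) = f x - f y. Proof. exact: (linearB linear_of). Qed.

Lemma linZ a x : f (a *: x) = a *: f x. Proof. exact: (linearZZ linear_of). Qed.
Lemma lin_sum (I : Type) (s : seq I) (P : pred I) (F : I -> U) :
  f (\sum_(i <- s | P i) F i) = \sum_(i <- s | P i) f (F i).
Proof. exact: (linear_sum linear_of). Qed.

End linear_maps.

Lemma bounded_op_bound {R : realType} {U V : normedModType R[i]} (f : U -> V) :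
  linear f -> continuous f ->
  exists2 M : R, 0 < M & forall v, rnorm (f v) <= M * rnorm v.
Proof.
move=> f_lin f_cont; pose F := linear_of f_lin.
have /linear_boundedP[r [r_real hr]] : bounded_near F (nbhs 0).
  by apply/linear_bounded_continuous.
have [M rM] : exists M : R, (r < M%:C) /\ 0 < M.
  exists (Num.max (complex.Re r) 0 + 1); split.
    rewrite -(RRe_real r_real) ltcR.
    by rewrite (le_lt_trans (y := Num.max (complex.Re r) 0)) ?le_max ?lexx// ltrDl.
  by rewrite ltr_wpDl// le_max lexx orbT.
case: rM => rM M0; exists M => // v.
by rewrite rnorm_le rmorphM /= rnormE; exact: hr.
Qed.

Lemma linear_rnorm_continuous {R : realType} {U V : normedModType R[i]}
    (f : U -> V) (M : R) :
  linear f -> (forall v, rnorm (f v) <= M * rnorm v) -> continuous f.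
Proof.
move=> f_lin fM; apply: (bounded_linear_continuous (f := linear_of f_lin)).
apply/linear_boundedP; exists M%:C; split=> [|r Mr v]; first exact: realC_real.
rewrite (le_trans (y := M%:C * `|v|))//; last by rewrite ler_wpM2r// ltW.
by rewrite -!rnormE -rmorphM lecR.
Qed.

Section braket.
Context {R : realType} {H : hilbertType R}.
Local Notation C := R[i].
Implicit Types u v w : H.

Lemma braket_conj u v : ⟨u, v⟩^* = ⟨v, u⟩.
Proof. by rewrite /braket [in RHS]hermC /= expr0 mul1r. Qed.

Lemma braket_scalar u : scalar (braket u).
Proof. by move=> a v w; rewrite /braket linearPl. Qed.

Lemma braketDr u v w : ⟨u, v + w⟩ = ⟨u, v⟩ + ⟨u, w⟩.
Proof. by rewrite /braket linearDl. Qed.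

Lemma braketZr a u v : ⟨u, a *: v⟩ = a * ⟨u, v⟩.
Proof. by rewrite /braket linearZl_LR. Qed.

Lemma braketNr u v : ⟨u, - v⟩ = - ⟨u, v⟩.
Proof. by rewrite /braket linearNl. Qed.

Lemma braketBr u v w : ⟨u, v - w⟩ = ⟨u, v⟩ - ⟨u, w⟩.
Proof. by rewrite braketDr braketNr. Qed.

Lemma braket0r u : ⟨u, 0⟩ = 0.
Proof. by rewrite /braket linear0l. Qed.

Lemma braket_sumr (I : Type) (s : seq I) (P : pred I) (F : I -> H) u :
  ⟨u, \sum_(i <- s | P i) F i⟩ = \sum_(i <- s | P i) ⟨u, F i⟩.
Proof. exact: (big_morph _ (braketDr u) (braket0r u)). Qed.

Lemma braketDl u v w : ⟨u + v, w⟩ = ⟨u, w⟩ + ⟨v, w⟩.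
Proof. by rewrite -![⟨_, w⟩]braket_conj braketDr rmorphD. Qed.

Lemma braketZl a u v : ⟨a *: u, v⟩ = a^* * ⟨u, v⟩.
Proof. by rewrite -![⟨_, v⟩]braket_conj braketZr rmorphM. Qed.

Lemma braketNl u v : ⟨- u, v⟩ = - ⟨u, v⟩.
Proof. by rewrite -![⟨_, v⟩]braket_conj braketNr rmorphN. Qed.

Lemma braketBl u v w : ⟨u - v, w⟩ = ⟨u, w⟩ - ⟨v, w⟩.
Proof. by rewrite braketDl braketNl. Qed.

Lemma braket0l u : ⟨0, u⟩ = 0.
Proof. by rewrite -braket_conj braket0r conjC0. Qed.

Lemma braket_suml (I : Type) (s : seq I) (P : pred I) (F : I -> H) u :
  ⟨\sum_(i <- s | P i) F i, u⟩ = \sum_(i <- s | P i) ⟨F i, u⟩.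
Proof.
rewrite -braket_conj braket_sumr rmorph_sum /=.
by apply: eq_bigr => i _; rewrite braket_conj.
Qed.

Lemma braket_norm v : ⟨v, v⟩ = (rnorm v ^+ 2)%:C.
Proof. by rewrite /braket -hdot_norm -rnormE rmorphXn. Qed.

Lemma braket_ge0 v : 0 <= ⟨v, v⟩.
Proof. by rewrite braket_norm lecR exprn_ge0 ?rnorm_ge0. Qed.

End braket.

Section positive_forms.
Context {R : realType} {V : lmodType R[i]} (b : V -> V -> R[i]).
Hypothesis b_scalar : forall u, scalar (b u).
Hypothesis b_conj : forall u v, (b u v)^* = b v u.
Hypothesis b_ge0 : forall v, 0 <= b v v.

Lemma psd_form_Re v : b v v = (complex.Re (b v v))%:C.
Proof. by rewrite RRe_real// ger0_real. Qed.

(** Stated for semi-definite forms because it is applied to POVM elements as well as to the inner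
    product; the case b(v,v) = 0 then needs its own argument. *)
Lemma psd_form_CS u v :
  rnorm (b u v) ^+ 2 <= complex.Re (b u u) * complex.Re (b v v).
Proof.
(* The form evaluated at u - s b(v,u) v, with s real. *)
have b_quad (s : R) : 0 <= complex.Re (b u u) - 2 * s * rnorm (b u v) ^+ 2
    + s ^+ 2 * rnorm (b u v) ^+ 2 * complex.Re (b v v).
  have := mulC_conj (b u v); have := psd_form_Re u; have := psd_form_Re v.
  move: (complex.Re (b u u)) (complex.Re (b v v)) (rnorm _ ^+ 2) => A B X hB hA hX.
  rewrite -lecR !(rmorphD, rmorphB, rmorphM, rmorphN, rmorphXn) /= -hX -hA -hB b_conj.
  have bDr x y z : b x (y + z) = b x y + b x z.
    by rewrite -[y]scale1r b_scalar scale1r mul1r.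
  have bZr x a y : b x (a *: y) = a * b x y.
    have b0 : b x 0 = 0.
      by apply: (addrI (b x 0)); rewrite -bDr !addr0.
    by rewrite -[a *: y]addr0 b_scalar b0 addr0.
  have bDl x y z : b (y + z) x = b y x + b z x.
    by rewrite -![b _ x]b_conj bDr rmorphD.
  have bZl x a y : b (a *: y) x = a^* * b y x.
    by rewrite -![b _ x]b_conj bZr rmorphM.
  have := b_ge0 (u + (- s%:C * b v u) *: v).
  rewrite !(bDl, bDr, bZl, bZr) rmorphM rmorphN /= !b_conj.
  rewrite (_ : (s%:C)^* = s%:C); last by rewrite conj_Creal// realC_real.
  by congr (is_true (0 <= _)); ring.
set A := complex.Re (b u u); set B := complex.Re (b v v); set X := rnorm _ ^+ 2.
have X0 : 0 <= X by rewrite exprn_ge0 ?rnorm_ge0.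
have B0 : 0 <= B by rewrite -lecR -psd_form_Re.
have A0 : 0 <= A by rewrite -lecR -psd_form_Re.
move: b_quad; rewrite -/A -/B -/X => b_quad.
have [B_eq0|B_neq0] := eqVneq B 0.
  rewrite B_eq0 mulr0; rewrite leNgt; apply/negP => X_gt0.
  (* This s turns the quadratic into A - 2(A + 1), which is negative. *)
  have := b_quad ((A + 1) / X); rewrite B_eq0 mulr0 addr0.
  have -> : 2 * ((A + 1) / X) * X = 2 * (A + 1) by field; rewrite gt_eqF.
  by lra.
have B_gt0 : 0 < B by rewrite lt_neqAle eq_sym B_neq0.
(* A minimiser of the quadratic. *)
have := b_quad B^-1.
have -> : A - 2 / B * X + B^-1 ^+ 2 * X * B = (A * B - X) / B by field.
by rewrite pmulr_lge0 ?invr_gt0// subr_ge0.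
Qed.

End positive_forms.

Section cauchy_schwarz.
Context {R : realType} {H : hilbertType R}.
Implicit Types u v w : H.

Lemma rnorm_braket u v : rnorm ⟨u, v⟩ <= rnorm u * rnorm v.
Proof.
rewrite -(@ler_pXn2r _ 2) ?nnegrE ?mulr_ge0 ?rnorm_ge0// exprMn.
have := psd_form_CS (@braket_scalar _ H) braket_conj braket_ge0 u v.
by rewrite !braket_norm.
Qed.

Lemma cvg_braketr u (v : nat -> H) l :
  v @ \oo --> l -> (fun n => ⟨u, v n⟩ : R[i]^o) @ \oo --> (⟨u, l⟩ : R[i]^o).
Proof.
move=> /cvg_rnorm vl; apply: (@cvg_rnorm_le _ _ _ _ (fun n => rnorm u * rnorm (v n - l))).
  by apply: nearW => n; rewrite -braketBr; exact: rnorm_braket.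
by rewrite -(mulr0 (rnorm u)); apply: cvgM => //; exact: cvg_cst.
Qed.

End cauchy_schwarz.
Arguments cvg_braketr {R H} u {v l}.

(** * Orthonormal families and operators built from them *)

Section orthonormal_families.
Context {R : realType} {H : hilbertType R}.
Local Notation C := R[i].
Implicit Types (f : nat -> H) (c : nat -> C) (u v w : H).

Definition orthonormal_seq f := forall j k, ⟨f j, f k⟩ = (j == k)%:R.

(** For orthonormal families this amounts to density of the span ([orthonormal_basisP]), and it is
    the form in which completeness is both checked and used. *)
Definition total_seq f := forall v, (forall k, ⟨f k, v⟩ = 0) -> v = 0.

Definition l2_bound c (M : R) :=
  forall n, \sum_(0 <= k < n) rnorm (c k) ^+ 2 <= M.

Definition osum f c : H := limn (series (fun k => c k *: f k)).

Lemma rnorm_sum_orthonormal f c m n : orthonormal_seq f ->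
  rnorm (\sum_(m <= k < n) c k *: f k) ^+ 2 = \sum_(m <= k < n) rnorm (c k) ^+ 2.
Proof.
move=> f_on; apply: complexI; rewrite -braket_norm braket_suml raddf_sum /=.
apply: eq_big_nat => k kn; rewrite braket_sumr (bigD1_seq k) ?mem_index_iota ?iota_uniq//=.
rewrite big1 ?addr0 => [|j jk].
  by rewrite braketZl braketZr f_on eqxx mulr1 mulrC mulC_conj.
by rewrite braketZl braketZr f_on eq_sym (negPf jk) !mulr0.
Qed.

Lemma braket_osum_partial f c n k : orthonormal_seq f ->
  ⟨f k, \sum_(0 <= j < n) c j *: f j⟩ = if (k < n)%N then c k else 0.
Proof.
move=> f_on; rewrite braket_sumr.
under eq_bigr do rewrite braketZr f_on.
case: ifPn => kn.
  rewrite (bigD1_seq k) ?mem_index_iota ?iota_uniq//= eqxx mulr1 big1 ?addr0// => j jk.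
  by rewrite eq_sym (negPf jk) mulr0.
rewrite big_nat_cond big1// => j /andP[/andP[_ jn] _].
by rewrite gtn_eqF ?mulr0// (leq_trans jn)// leqNgt.
Qed.

Lemma osum_cvg f c M : orthonormal_seq f -> l2_bound c M ->
  series (fun k => c k *: f k) @ \oo --> osum f c.
Proof.
move=> f_on cM; suff : cvgn (series (fun k => c k *: f k)) by [].
apply: (@cvg_of_mono _ _ _ (fun n => \sum_(0 <= k < n) rnorm (c k) ^+ 2) M 1) => //.
  move=> m n mn; rewrite (big_cat_nat (n := m) (p := n))//=.
  by rewrite lerDl sumr_ge0// => i _; rewrite exprn_ge0 ?rnorm_ge0.
move=> m n mn; have := sub_series_geq (fun k => rnorm (c k) ^+ 2) mn.
by rewrite {1}/series /= => ->; rewrite sub_series_geq// rnorm_sum_orthonormal.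
Qed.

Lemma braket_osum f c M k : orthonormal_seq f -> l2_bound c M -> ⟨f k, osum f c⟩ = c k.
Proof.
move=> f_on cM; have := cvg_braketr (f k) (osum_cvg f_on cM).
move=> h; apply: (@cvg_uniq _ C^o _ _ _ h); apply: cvg_near_cst; exists k.+1 => // n /= kn.
by rewrite braket_osum_partial// kn.
Qed.

Lemma rnorm_osum f c M : orthonormal_seq f -> l2_bound c M -> rnorm (osum f c) ^+ 2 <= M.
Proof.
move=> f_on cM; have /cvg_norm_rnorm h := osum_cvg f_on cM.
apply: (limR_le (limR_sqr h)); apply: nearW => n.
by rewrite rnorm_sum_orthonormal.
Qed.

Lemma bessel f v n : orthonormal_seq f ->
  \sum_(0 <= k < n) rnorm ⟨f k, v⟩ ^+ 2 <= rnorm v ^+ 2.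
Proof.
move=> f_on; pose p := \sum_(0 <= k < n) ⟨f k, v⟩ *: f k.
have pv : ⟨p, v⟩ = (rnorm p ^+ 2)%:C.
  rewrite rnorm_sum_orthonormal// raddf_sum braket_suml; apply: eq_bigr => k _ /=.
  by rewrite braketZl mulrC mulC_conj.
rewrite -(@rnorm_sum_orthonormal f (fun k => ⟨f k, v⟩))// -/p.
have : 0 <= rnorm (v - p) ^+ 2 by rewrite exprn_ge0 ?rnorm_ge0.
rewrite -lecR -braket_norm braketBl !braketBr -[⟨v, p⟩]braket_conj pv.
rewrite (conj_Creal (realC_real _)) !braket_norm subrr subr0.
by rewrite -rmorphB lecR subr_ge0.
Qed.

Lemma bessel_l2 f v : orthonormal_seq f -> l2_bound (fun k => ⟨f k, v⟩) (rnorm v ^+ 2).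
Proof. by move=> f_on n; exact: bessel. Qed.

Lemma total_osum f v : orthonormal_seq f -> total_seq f -> osum f (fun k => ⟨f k, v⟩) = v.
Proof.
move=> f_on f_tot; apply/eqP; rewrite -subr_eq0; apply/eqP/f_tot => k.
by rewrite braketBr (braket_osum _ f_on (bessel_l2 v f_on)) subrr.
Qed.

Lemma total_expand f v : orthonormal_seq f -> total_seq f ->
  series (fun k => ⟨f k, v⟩ *: f k) @ \oo --> v.
Proof.
move=> f_on f_tot; have := osum_cvg f_on (bessel_l2 v f_on).
by rewrite total_osum.
Qed.

Arguments total_expand {f} v _ _.

Lemma total_ext f u v : total_seq f -> (forall k, ⟨f k, u⟩ = ⟨f k, v⟩) -> u = v.
Proof.
move=> f_tot uv; apply/eqP; rewrite -subr_eq0; apply/eqP/f_tot => k.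
by rewrite braketBr uv subrr.
Qed.

Lemma parseval f v : orthonormal_seq f -> total_seq f ->
  series (fun k => rnorm ⟨f k, v⟩ ^+ 2) @ \oo --> rnorm v ^+ 2.
Proof.
move=> f_on f_tot; have /cvg_norm_rnorm h := total_expand v f_on f_tot.
apply: cvg_ext (limR_sqr h) => n.
by rewrite rnorm_sum_orthonormal.
Qed.

Lemma parseval_braket f u v : orthonormal_seq f -> total_seq f ->
  series (fun k => ⟨u, f k⟩ * ⟨f k, v⟩ : C^o) @ \oo --> (⟨u, v⟩ : C^o).
Proof.
move=> f_on f_tot; have h := cvg_braketr u (total_expand v f_on f_tot).
apply: cvg_ext h => n.
rewrite /series /= braket_sumr; apply: eq_bigr => k _.
by rewrite braketZr mulrC.
Qed.

(** If v is orthogonal to S, every finite combination q satisfies <v, v - q> = |v|^2, so by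
    Cauchy-Schwarz it stays at distance at least |v| from v. *)
Lemma dense_span_orthogonal (S : set H) v : closure (finite_span S) = [set: H] ->
  (forall x, S x -> ⟨x, v⟩ = 0) -> v = 0.
Proof.
move=> S_dense Sv0; apply/eqP; rewrite -rnorm_eq0; apply/eqP/le_anti.
rewrite rnorm_ge0 andbT leNgt; apply/negP => v_gt0.
have : closure (finite_span S) v by rewrite S_dense.
have v_gt0C : 0 < (rnorm v)%:C by rewrite ltcR.
move=> /(_ _ (nbhsx_ballx v _ v_gt0C)) [p [[m [c [x [xS ->]]]]]].
set q := \sum_(i < m) _; rewrite -ball_normE /ball_ /= -rnorm_lt.
have vq : ⟨v, q⟩ = 0.
  rewrite braket_sumr big1// => i _; rewrite braketZr.
  by rewrite -braket_conj Sv0 ?conjC0 ?mulr0.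
have := rnorm_braket v (v - q); rewrite braketBr vq subr0 braket_norm rnormR.
rewrite ger0_norm ?exprn_ge0 ?rnorm_ge0// expr2 ler_pM2l//.
by move=> /le_lt_trans h /h; rewrite ltxx.
Qed.

Lemma orthonormal_basisP f : orthonormal_basis f <-> orthonormal_seq f /\ total_seq f.
Proof.
split=> [[f_on f_dense]|[f_on f_tot]]; split => //.
- by move=> v fv0; apply: (dense_span_orthogonal f_dense) => _ [k _ <-].
- apply/seteqP; split=> // v _ B Bv.
  have [n _ /(_ n (leqnn n)) Bn] := total_expand v f_on f_tot _ Bv.
  exists (series (fun k => ⟨f k, v⟩ *: f k) n); split=> //.
  exists n, (fun i => ⟨f i, v⟩), (fun i => f i); split; first by move=> i; exists i.
  by rewrite /series /= big_mkord.
Qed.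

Arguments parseval {f} v _ _.
Arguments parseval_braket {f} u v _ _.

End orthonormal_families.
Arguments total_expand {R H f} v _ _.
Arguments parseval {R H f} v _ _.
Arguments parseval_braket {R H f} u v _ _.

Section multipliers.
Context {R : realType} {H H' : hilbertType R}.
Local Notation C := R[i].

(** The operator $\sum_k w_k |f_k\rangle\langle g_k|$. Thermal states, displacements, the embeddings
    of the signal mode and the POVMs diagonal in a basis are all of this form. *)
Definition multiplier (g : nat -> H') (f : nat -> H) (w : nat -> C) (v : H') : H :=
  osum f (fun k => w k * ⟨g k, v⟩).

Context (g : nat -> H') (f : nat -> H) (w : nat -> C) (W : R).
Hypotheses (g_on : orthonormal_seq g) (f_on : orthonormal_seq f).
Hypothesis w_le : forall k, rnorm (w k) <= W.

Let W_ge0 : 0 <= W. Proof. exact: le_trans (rnorm_ge0 _) (w_le 0). Qed.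

Lemma multiplier_l2 v :
  l2_bound (fun k => w k * ⟨g k, v⟩) ((W * rnorm v) ^+ 2).
Proof.
move=> n; rewrite exprMn; apply: le_trans (ler_wpM2l _ (bessel v n g_on)).
  rewrite mulr_sumr; apply: ler_sum => k _.
  rewrite rnormM exprMn ler_wpM2r ?exprn_ge0 ?rnorm_ge0//.
  by rewrite lerXn2r ?nnegrE ?rnorm_ge0.
by rewrite exprn_ge0.
Qed.

Lemma multiplier_cvg v :
  series (fun k => (w k * ⟨g k, v⟩) *: f k) @ \oo --> multiplier g f w v.
Proof. exact: osum_cvg f_on (multiplier_l2 v). Qed.

Arguments multiplier_cvg v : clear implicits.

Lemma braket_multiplier k v : ⟨f k, multiplier g f w v⟩ = w k * ⟨g k, v⟩.
Proof. exact: braket_osum f_on (multiplier_l2 v). Qed.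

Lemma multiplier_linear : linear (multiplier g f w).
Proof.
move=> a u v; have h := multiplier_cvg (a *: u + v).
apply: (cvg_uniq h).
apply: cvg_ext (cvgD (cvgZl_tmp (k := a) (multiplier_cvg u)) (multiplier_cvg v)) => n.
pose s x := \sum_(0 <= k < n) (w k * ⟨g k, x⟩) *: f k.
suff : a *: s u + s v = s (a *: u + v) by [].
rewrite /s scaler_sumr -big_split /=; apply: eq_bigr => k _.
by rewrite braketDr braketZr scalerA -scalerDl; congr (_ *: _); ring.
Qed.

Lemma rnorm_multiplier v : rnorm (multiplier g f w v) <= W * rnorm v.
Proof.
rewrite -(@ler_pXn2r _ 2) ?nnegrE ?mulr_ge0 ?rnorm_ge0//.
exact: rnorm_osum f_on (multiplier_l2 v).
Qed.

Lemma multiplier_basis k : multiplier g f w (g k) = w k *: f k.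
Proof.
apply: (cvg_uniq (multiplier_cvg (g k))).
apply: cvg_near_cst; exists k.+1 => // n /= kn.
rewrite /series /= (bigD1_seq k) ?mem_index_iota ?iota_uniq//= g_on eqxx mulr1.
rewrite big1 ?addr0// => j jk; by rewrite g_on (negPf jk) mulr0 scale0r.
Qed.

Lemma cvg_braket_multiplier u v :
  series (fun k => w k * (⟨u, f k⟩ * ⟨g k, v⟩) : C^o) @ \oo -->
  (⟨u, multiplier g f w v⟩ : C^o).
Proof.
apply: cvg_ext (cvg_braketr u (multiplier_cvg v)) => n; rewrite /series /= braket_sumr.
by apply: eq_bigr => k _; rewrite braketZr; ring.
Qed.

End multipliers.

Arguments multiplier_cvg {R H H' g f w W} _ _ _ v.
Arguments cvg_braket_multiplier {R H H' g f w W} _ _ _ u v.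

Section bounded_operators.
Context {R : realType}.
Local Notation C := R[i].

Lemma multiplier_bounded {H : hilbertType R} (g f : nat -> H) w (W : R) :
  orthonormal_seq g -> orthonormal_seq f -> (forall k, rnorm (w k) <= W) ->
  bounded_operator (multiplier g f w).
Proof.
move=> g_on f_on w_le; split; first exact: multiplier_linear w_le.
by apply: (@linear_rnorm_continuous _ _ _ _ W);
  [exact: multiplier_linear w_le | exact: rnorm_multiplier].
Qed.

Lemma continuous_ext_basis {H : hilbertType R} {V : normedModType C} (g : nat -> H)
    (S T : H -> V) :
  orthonormal_seq g -> total_seq g -> linear S -> continuous S -> linear T -> continuous T ->
  (forall k, S (g k) = T (g k)) -> S = T.
Proof.
move=> g_on g_tot S_lin S_cont T_lin T_cont ST; apply/funext => v.
have h := total_expand v g_on g_tot.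
have hS := cvg_comp_continuous S_cont h; have hT := cvg_comp_continuous T_cont h.
apply: (cvg_uniq hS); apply: cvg_ext hT => n.
rewrite /series /= (lin_sum T_lin) (lin_sum S_lin); apply: eq_bigr => k _.
by rewrite (linZ S_lin) (linZ T_lin) ST.
Qed.

Lemma series_tail_le (T : normedModType C) (b : nat -> R) (y : nat -> T) m n :
  (forall i, rnorm (y i) <= b i) -> (m <= n)%N ->
  rnorm (series y n - series y m) <= series b n - series b m.
Proof.
move=> yb mn; rewrite (sub_series_geq y mn) (sub_series_geq b mn).
by apply: (le_trans (rnorm_sum _ _ _)); exact: ler_sum.
Qed.

Lemma cvg_bigsum (T : normedModType C) (I : Type) (r : seq I) (F : I -> nat -> T) (l : I -> T) :
  (forall i, F i @ \oo --> l i) ->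
  (fun n => \sum_(i <- r) F i n) @ \oo --> \sum_(i <- r) l i.
Proof. by move=> Fl; apply: cvg_big => //; exact: add_continuous. Qed.

(** Dominated convergence for series: a finite head converges termwise, and the tails are controlled
    by the tail of [b] uniformly in m. It yields the basis independence of the trace and the
    countable additivity of diagonal POVMs. *)
Lemma tannery (T : normedModType C) (b : nat -> R) (M : R) (y : nat -> nat -> T)
    (y0 : nat -> T) (A : nat -> T) (t : T) :
  (forall n, series b n <= M) -> (forall i m, rnorm (y i m) <= b i) ->
  (forall i, y i @ \oo --> y0 i) -> (forall m, series (y^~ m) @ \oo --> A m) ->
  series y0 @ \oo --> t -> A @ \oo --> t.
Proof.
move=> bM yb yy0 yA y0t; apply/cvg_rnorm/cvgrPdist_lt => e e0.
have b0 i : 0 <= b i by apply: le_trans (yb i 0); exact: rnorm_ge0.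
have y0b i : rnorm (y0 i) <= b i.
  by apply: (limR_le (cvg_norm_rnorm (yy0 i))); apply: nearW => m; exact: yb.
have b_mono : {homo series b : m n / (m <= n)%N >-> m <= n}.
  move=> m n mn; rewrite /series /= (big_cat_nat (n := m) (p := n))//= lerDl.
  by rewrite sumr_ge0.
have b_cvg : cvgn (series b).
  by apply: nondecreasing_is_cvgn => //; exists M => _ [n _ <-].
have e4 : 0 < e / 4 by rewrite divr_gt0.
have /cvgrPdist_lt/(_ _ e4)[N _ /(_ N (leqnn N))] := b_cvg.
rewrite ltr_norml => /andP[_ hN].
have tailN (x : nat -> T) (l : T) : (forall i, rnorm (x i) <= b i) ->
    series x @ \oo --> l -> rnorm (l - series x N) <= e / 4.
  move=> xb xl.
  have h : (fun n => series x n - series x N) @ \oo --> l - series x N.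
    by apply: cvgB xl _; exact: cvg_cst.
  apply: (limR_le (cvg_norm_rnorm h)); exists N => // n /= Nn; apply: (le_trans (series_tail_le xb Nn)).
  have := nondecreasing_cvgn_le b_mono b_cvg n.
  by move: hN; lra.
have fin : (fun m => series (y^~ m) N) @ \oo --> series y0 N.
  exact: cvg_bigsum.
have /cvg_rnorm/cvgrPdist_lt/(_ _ e4) := fin.
apply: filterS => m; rewrite !sub0r !normrN !ger0_norm ?rnorm_ge0// => hm.
have := tailN _ _ (yb^~ m) (yA m); have := tailN _ _ y0b y0t.
have := rnorm_dist (A m) (series (y^~ m) N) t.
have := rnorm_dist (series (y^~ m) N) (series y0 N) t.
by rewrite (rnorm_sub (series y0 N) t); lra.
Qed.
End bounded_operators.
Arguments cvg_bigsum {R T I} r {F l}.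

Section positive_operators.
Context {R : realType} {H : hilbertType R}.
Local Notation C := R[i].

(** Polarisation: the quadratic form is real at u + v and at u + iv. *)
Lemma positive_hermitian (T : H -> H) : linear T -> (forall v, 0 <= ⟨v, T v⟩) ->
  forall u v, ⟨u, T v⟩^* = ⟨v, T u⟩.
Proof.
move=> T_lin T_ge0 u v.
have real x : ⟨x, T x⟩^* = ⟨x, T x⟩ by rewrite conj_Creal// ger0_real.
have i0 : 'i != 0 :> C by exact: neq0Ci.
have h1 : ⟨u, T v⟩^* + ⟨v, T u⟩^* = ⟨u, T v⟩ + ⟨v, T u⟩.
  have := real (u + v).
  rewrite (linD T_lin) !(braketDl, braketDr) !rmorphD /= !real.
  move: (⟨u, T u⟩) (⟨v, T v⟩) (⟨u, T v⟩) (⟨v, T u⟩) (⟨u, T v⟩^*) (⟨v, T u⟩^*).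
  move=> a b c d e f /eqP; rewrite -subr_eq0 => E; apply/eqP; rewrite -subr_eq0.
  by move: E; congr (is_true (_ == _)); ring.
have h2 : - ⟨u, T v⟩^* + ⟨v, T u⟩^* = ⟨u, T v⟩ - ⟨v, T u⟩.
  have := real (u + 'i *: v).
  rewrite (linD T_lin) (linZ T_lin) !(braketDl, braketDr, braketZl, braketZr).
  rewrite !(rmorphD, rmorphM) /= !conjCK !conjCi !real.
  move: (⟨u, T u⟩) (⟨v, T v⟩) (⟨u, T v⟩) (⟨v, T u⟩) (⟨u, T v⟩^*) (⟨v, T u⟩^*).
  move=> a b c d e f /eqP; rewrite -subr_eq0 => E; apply: (mulfI i0).
  apply/eqP; rewrite -subr_eq0.
  by move: E; congr (is_true (_ == _)); ring.
have two0 : 2 != 0 :> C by rewrite pnatr_eq0.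
apply: (mulfI two0); move: h1 h2; move: (⟨u, T v⟩) (⟨v, T u⟩) (⟨u, T v⟩^*) (⟨v, T u⟩^*).
move=> c d e f h1 h2; transitivity ((e + f) - (- e + f)); first by ring.
by rewrite h1 h2; ring.
Qed.

(** The point is independence of the basis f. Expanding the diagonal operator inside a partial trace
    over f and exchanging the sums gives terms that tend to w_i <h_i, B h_i> and are dominated by
    w_i times a bound of B. *)
Lemma trace_multiplier (h : nat -> H) (w : nat -> R) (M : R) (B : H -> H) (t : C) :
  orthonormal_seq h -> total_seq h ->
  (forall k, 0 <= w k) -> (forall n, series w n <= M) ->
  bounded_operator B -> (forall u v, ⟨u, B v⟩^* = ⟨v, B u⟩) ->
  series (fun k => (w k)%:C * ⟨h k, B (h k)⟩ : C^o) @ \oo --> (t : C^o) ->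
  trace (multiplier h h (fun k => (w k)%:C) \o B) = t.
Proof.
move=> h_on h_tot w0 wM [B_lin B_cont] B_herm ht.
have wkM k : w k <= M.
  apply: le_trans (wM k.+1); rewrite /series /= big_nat_recr//= lerDr.
  exact: sumr_ge0.
have w_le k : rnorm (w k)%:C <= M by rewrite rnormR ger0_norm.
have [MB MB0 hMB] := bounded_op_bound B_lin B_cont.
have adj u v : ⟨B u, v⟩ = ⟨u, B v⟩ by rewrite -braket_conj B_herm.
have key f : orthonormal_basis f -> series (fun k => ⟨f k, multiplier h h (fun k => (w k)%:C) (B (f k))⟩ : C^o) @ \oo --> (t : C^o).
  move=> /orthonormal_basisP[f_on f_tot].
  have norm_h i : rnorm (h i) = 1.
    apply/eqP; rewrite -(@eqrXn2 _ 2) ?rnorm_ge0// expr1n; apply/eqP/complexI.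
    by rewrite -braket_norm h_on eqxx.
  pose x i m : C^o := \sum_(0 <= k < m) ⟨f k, h i⟩ * ⟨h i, B (f k)⟩.
  have x_cvg i : x i @ \oo --> (⟨h i, B (h i)⟩ : C^o).
    rewrite -adj; apply: cvg_ext (parseval_braket (B (h i)) (h i) f_on f_tot) => n.
    by rewrite /series /x /=; apply: eq_bigr => k _; rewrite adj mulrC.
  have x_le i m : rnorm (x i m) <= MB.
    (* The right-hand factor is the projection of [h i] onto the first m vectors of [f], which
       bounds the partial sum uniformly in m. *)
    have -> : x i m = ⟨B (h i), \sum_(0 <= k < m) ⟨f k, h i⟩ *: f k⟩.
      by rewrite braket_sumr; apply: eq_bigr => k _; rewrite braketZr adj.
    rewrite (le_trans (rnorm_braket _ _))// -[MB]mulr1 ler_pM ?rnorm_ge0//.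
      by rewrite (le_trans (hMB _))// norm_h mulr1.
    rewrite -(@ler_pXn2r _ 2) ?nnegrE ?rnorm_ge0// rnorm_sum_orthonormal//.
    by rewrite (le_trans (bessel _ _ f_on))// norm_h.
  apply: (@tannery _ C^o (fun i => w i * MB) (M * MB) (fun i m => (w i)%:C * x i m)
    (fun i => (w i)%:C * ⟨h i, B (h i)⟩)) ht.
  - by move=> n; rewrite /series /= -mulr_suml; apply: ler_wpM2r; [exact: ltW | exact: wM].
  - by move=> i m; rewrite rnormM rnormR ger0_norm// ler_wpM2l.
  - by move=> i; apply: cvgM (x_cvg i); exact: cvg_cst.
  - move=> m; rewrite {2}/series /=.
    have h1 k : series (fun i => (w i)%:C * (⟨f k, h i⟩ * ⟨h i, B (f k)⟩) : C^o) @ \oo -->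
        (⟨f k, multiplier h h (fun k => (w k)%:C) (B (f k))⟩ : C^o).
      exact: (cvg_braket_multiplier h_on h_on w_le (f k) (B (f k))).
    have := cvg_bigsum (T := C^o) (index_iota 0 m) h1.
    apply: cvg_ext => n; rewrite /series /= exchange_big /=.
    by apply: eq_bigr => i _; rewrite /x mulr_sumr.
(* [h] is itself a basis, so it determines any candidate value. *)
apply: xget_unique => // t' ht'.
have hb : orthonormal_basis h by apply/orthonormal_basisP.
exact: (@cvg_uniq _ C^o _ _ _ (ht' _ hb) (key _ hb)).
Qed.

End positive_operators.

(** * Displaced number states *)

Section fock_polynomials.
Context {C : numClosedFieldType}.
Implicit Types (z : C) (p q : {poly C}).

(** The displacement generator on Bargmann polynomials, where creation is multiplication by X and
    annihilation is the derivative. *)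
Definition pg z p : {poly C} := z *: ('X * p) - z^* *: p^`().

Lemma pg_linear z : linear (pg z).
Proof. by move=> a p q; rewrite /pg derivD derivZ -!mul_polyC; ring. Qed.

Lemma pgE z p : pg z p = z *: ('X * p) - z^* *: p^`(). Proof. by []. Qed.

Lemma iter_pgZ z m a p : iter m (pg z) (a *: p) = a *: iter m (pg z) p.
Proof. by elim: m => //= m ->; rewrite (linZ (pg_linear z)). Qed.

Lemma deriv_pg z p : (pg z p)^`() = pg z p^`() + z *: p.
Proof.
by rewrite !pgE derivB !derivZ derivM derivX -!mul_polyC; ring.
Qed.

Lemma pg_mulX z p : pg z ('X * p) = 'X * pg z p - z^* *: p.
Proof.
by rewrite !pgE derivM derivX -!mul_polyC; ring.
Qed.

(** The commutator of the derivative with [pg z] is the scalar z, so passing m factors costs m z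
    times one factor less. At m = 0 the coefficient vanishes, which makes [m.-1] harmless. *)
Lemma deriv_iter_pg z m p :
  (iter m (pg z) p)^`() = iter m (pg z) p^`() + (m%:R * z) *: iter m.-1 (pg z) p.
Proof.
elim: m => [|m IHm] /=; first by rewrite mul0r scale0r addr0.
rewrite deriv_pg IHm (linD (pg_linear z)) (linZ (pg_linear z)) -addrA; congr (_ + _).
case: m {IHm} => [|m] /=; first by rewrite mul0r scale0r mul1r add0r.
by rewrite -scalerDl -[in RHS]natr1 [in RHS]mulrDl mul1r.
Qed.

Lemma iter_pg_mulX z m p :
  iter m (pg z) ('X * p) = 'X * iter m (pg z) p - (m%:R * z^*) *: iter m.-1 (pg z) p.
Proof.
elim: m => [|m IHm] /=; first by rewrite mul0r scale0r subr0.
rewrite IHm (linB (pg_linear z)) (linZ (pg_linear z)) pg_mulX -addrA; congr (_ + _).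
case: m {IHm} => [|m] /=; first by rewrite mul0r scale0r mul1r subr0.
by rewrite -opprD -scalerDl -[in RHS]natr1 [in RHS]mulrDl mul1r addrC.
Qed.

Lemma size_pg z p n : (size p <= n)%N -> (size (pg z p) <= n.+1)%N.
Proof.
move=> pn; rewrite pgE (leq_trans (size_polyD _ _))// geq_max size_polyN.
rewrite (leq_trans (size_scale_leq _ _))/=; last first.
  by rewrite (leq_trans (size_polyMleq _ _))// size_polyX addSn.
rewrite (leq_trans (size_scale_leq _ _))// (leq_trans (size_poly _ _))//.
by rewrite (leq_trans (leq_pred _))// leqW.
Qed.

Lemma size_iter_pg z m p n : (size p <= n)%N -> (size (iter m (pg z) p) <= n + m)%N.
Proof. by move=> pn; elim: m => [|m IHm] /=; rewrite ?addn0// addnS size_pg. Qed.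

Lemma pg_real z (h : C) p : h \is Num.real -> pg (h * z) p = h *: pg z p.
Proof.
move=> h_real; rewrite !pgE rmorphM /= (conj_Creal h_real).
by rewrite scalerBr !scalerA.
Qed.

Lemma iter_pg_real z (h : C) m p : h \is Num.real ->
  iter m (pg (h * z)) p = h ^+ m *: iter m (pg z) p.
Proof.
move=> h_real; elim: m => [|m IHm] /=; first by rewrite expr0 scale1r.
by rewrite IHm pg_real// (linZ (pg_linear z)) scalerA exprS.
Qed.

(** Only the derivative part of the last step reaches the constant term, and [deriv_iter_pg]
    evaluates it because the derivative of 1 is zero. *)
Lemma coef0_iter_pg1 z m : (iter m.+2 (pg z) 1)`_0 =
  - (`|z| ^+ 2 * m.+1%:R) * (iter m (pg z) 1)`_0.
Proof.
rewrite iterS pgE coefB !coefZ coefXM mulr0 sub0r deriv_iter_pg.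
rewrite -polyC1 derivC coefD coefZ (_ : iter m.+1 (pg z) 0 = 0); last first.
  by elim: m.+1 => //= k ->; rewrite (lin0 (pg_linear z)).
by rewrite coef0 add0r /= normCK; ring.
Qed.

(* The two relations characterise the matrix [W j k = <a^j 0, D(z) a^k 0>] up
   to its vacuum entry: they say that [a D(z) = D(z) (a + z)] and
   [D(z) a^+ 0 = - z^* D(z) 0] on the dual vacuum. *)
Definition displacement_recursion z (W : nat -> nat -> C) :=
  (forall j k, W j.+1 k = k%:R * W j k.-1 + z * W j k) /\
  (forall k, W 0 k.+1 = - z^* * W 0 k).

(** The relations are linear and determine all entries from the vacuum one, so two solutions are
    proportional; the cross-multiplied form needs no division. *)
Lemma displacement_recursion_uniq z (W W' : nat -> nat -> C) :
  displacement_recursion z W -> displacement_recursion z W' ->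
  forall j k, W j k * W' 0 0 = W' j k * W 0 0.
Proof.
move=> [W1 W2] [W1' W2']; elim=> [|j IHj] k.
  by elim: k => [|k IHk]; [rewrite mulrC | rewrite W2 W2' -!mulrA IHk].
by rewrite W1 W1' !mulrDl -!mulrA !IHj.
Qed.

Lemma displacement_recursion0 : displacement_recursion 0 (fun j k => j`!%:R * (j == k)%:R).
Proof.
split=> [j [|k]|k] /=; rewrite ?conjC0 ?oppr0 ?mul0r ?addr0 ?mulr0// eqSS.
by have [->|] := eqVneq j k; rewrite ?mulr0// !mulr1 factS natrM.
Qed.

End fock_polynomials.

Section fock_vectors.
Context {R : realType} {H : hilbertType R} (ket : nat -> H).
Hypotheses (ket_on : orthonormal_seq ket).
Local Notation C := R[i].
Implicit Types (z : C) (p q : {poly C}).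

Definition sqfact k : R := Num.sqrt k`!%:R.

Lemma sqfact_gt0 k : 0 < sqfact k.
Proof. by rewrite sqrtr_gt0 ltr0n fact_gt0. Qed.

Lemma sqfact0 : sqfact 0 = 1.
Proof. by rewrite /sqfact fact0 sqrtr1. Qed.

Lemma sqfact_sqr k : sqfact k ^+ 2 = k`!%:R.
Proof. by rewrite sqr_sqrtr// ler0n. Qed.

Lemma sqfactS k : sqfact k.+1 = Num.sqrt k.+1%:R * sqfact k.
Proof. by rewrite /sqfact factS natrM sqrtrM. Qed.

Lemma sqfactC_neq0 k : (sqfact k)%:C != 0 :> C.
Proof. by rewrite fmorph_eq0 gt_eqF ?sqfact_gt0. Qed.

Lemma sqrtnatC_sqr k : (Num.sqrt (k%:R : R))%:C ^+ 2 = k%:R :> C.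
Proof. by rewrite -rmorphXn /= sqr_sqrtr// rmorph_nat. Qed.

Lemma sqfactC_sqr k : (sqfact k)%:C ^+ 2 = k`!%:R :> C.
Proof. by rewrite -rmorphXn /= sqfact_sqr rmorph_nat. Qed.

(* The Bargmann representation: the monomial of degree [k] stands for
   [sqrt k! |k>]. *)
Definition fock_vector p : H := \sum_(0 <= k < size p) (p`_k * (sqfact k)%:C) *: ket k.

Lemma fock_vectorE n p : (size p <= n)%N ->
  fock_vector p = \sum_(0 <= k < n) (p`_k * (sqfact k)%:C) *: ket k.
Proof.
move=> pn; rewrite (big_cat_nat (n := size p))//= [X in _ = _ + X]big_nat_cond.
rewrite [X in _ = _ + X]big1 ?addr0// => k /andP[/andP[pk _] _].
by rewrite nth_default// mul0r scale0r.
Qed.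

Lemma fock_vector_linear : linear fock_vector.
Proof.
move=> a p q; pose n := maxn (size (a *: p + q)) (maxn (size p) (size q)).
rewrite !(@fock_vectorE n) ?leq_max ?leqnn ?orbT//.
rewrite scaler_sumr -big_split /=; apply: eq_bigr => k _.
by rewrite coefD coefZ scalerA -scalerDl; congr (_ *: _); ring.
Qed.

Lemma braket_fock_vector j p : ⟨ket j, fock_vector p⟩ = p`_j * (sqfact j)%:C.
Proof.
rewrite braket_osum_partial//; case: ifPn => //.
by rewrite -leqNgt => pj; rewrite nth_default// mul0r.
Qed.

Lemma fock_vectorX k : fock_vector ('X^k) = (sqfact k)%:C *: ket k.
Proof.
rewrite /fock_vector size_polyXn (bigD1_seq k) ?mem_index_iota ?iota_uniq ?ltnSn//=.
rewrite coefXn eqxx mul1r big1 ?addr0// => j jk.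
by rewrite coefXn (negPf jk) mul0r scale0r.
Qed.

Lemma creation_fock_vector p : creation ket (fock_vector p) = fock_vector ('X * p).
Proof.
apply: limn_eq; apply: cvg_near_cst; exists (size p) => // n /= pn.
rewrite (@fock_vectorE n.+1 ('X * p)) ?(leq_trans (size_polyMleq _ _))// ?size_polyX//.
rewrite big_nat_recl// coefXM mul0r scale0r add0r /series /=.
apply: eq_bigr => k _; rewrite braket_fock_vector coefXM /= sqfactS rmorphM.
by congr (_ *: _); rewrite /=; ring.
Qed.

Lemma annihilation_fock_vector p : annihilation ket (fock_vector p) = fock_vector p^`().
Proof.
apply: limn_eq; apply: cvg_near_cst; exists (size p) => // n /= pn.
rewrite (@fock_vectorE n p^`()) ?(leq_trans (size_poly _ _))// ?(leq_trans (leq_pred _))//.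
apply: eq_bigr => k _; rewrite braket_fock_vector coef_deriv sqfactS rmorphM.
rewrite -[p`_k.+1 *+ k.+1]mulr_natl -(sqrtnatC_sqr k.+1) /=.
by congr (_ *: _); ring.
Qed.

Lemma displacement_generatorE z p :
  displacement_generator ket z (fock_vector p) = fock_vector (pg z p).
Proof.
rewrite /displacement_generator creation_fock_vector annihilation_fock_vector.
by rewrite pgE (linB fock_vector_linear) !(linZ fock_vector_linear).
Qed.

Lemma iter_displacement_generator z m p :
  iter m (displacement_generator ket z) (fock_vector p) = fock_vector (iter m (pg z) p).
Proof. by elim: m => //= m ->; rewrite displacement_generatorE. Qed.

Lemma ketE k : ket k = fock_vector ((sqfact k)%:C^-1 *: 'X^k).
Proof.
rewrite (linZ fock_vector_linear) fock_vectorX scalerA mulVf ?scale1r//.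
exact: sqfactC_neq0.
Qed.

(** An l^1 majorant of the norm of [fock_vector p], easier to propagate than the norm itself because
    it is estimated coefficient by coefficient. *)
Definition fock_l1 n p : R := \sum_(0 <= k < n) sqfact k * rnorm p`_k.

Lemma rnorm_ket k : rnorm (ket k) = 1.
Proof.
apply/eqP; rewrite -(@eqrXn2 _ 2) ?rnorm_ge0// expr1n; apply/eqP/complexI.
by rewrite -braket_norm ket_on eqxx.
Qed.

Lemma rnorm_fock_vector n p : (size p <= n)%N -> rnorm (fock_vector p) <= fock_l1 n p.
Proof.
move=> /fock_vectorE ->; apply: (le_trans (rnorm_sum _ _ _)).
apply: ler_sum => k _; rewrite rnormZ rnorm_ket mulr1 rnormM rnormR.
by rewrite ger0_norm 1?mulrC// ltW// sqfact_gt0.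
Qed.

Lemma sqrt_nat_le m n : (m <= n)%N -> Num.sqrt (m%:R : R) <= Num.sqrt n%:R.
Proof. by move=> mn; rewrite ler_wsqrtr// ler_nat. Qed.

(** Below degree n, creation and annihilation each multiply the majorant by at most sqrt n; the
    factor 2 adds the two. *)
Lemma fock_l1_pg z n p : (size p <= n)%N ->
  fock_l1 n.+1 (pg z p) <= 2 * rnorm z * Num.sqrt n%:R * fock_l1 n p.
Proof.
move=> pn.
have -> : 2 * rnorm z * Num.sqrt n%:R * fock_l1 n p =
    rnorm z * (Num.sqrt n%:R * fock_l1 n p) + rnorm z * (Num.sqrt n%:R * fock_l1 n p).
  by ring.
apply: (@le_trans _ _ (rnorm z * fock_l1 n.+1 ('X * p) + rnorm z * fock_l1 n.+1 p^`())).
  rewrite /fock_l1 !mulr_sumr -big_split /=; apply: ler_sum => k _.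
  rewrite mulrCA [X in _ + X]mulrCA -mulrDr ler_wpM2l ?(ltW (sqfact_gt0 _))//.
  rewrite pgE coefB !coefZ; apply: (le_trans (rnormD _ _)).
  by rewrite rnormN !rnormM rnorm_conj.
have n0 : 0 <= Num.sqrt n%:R :> R by rewrite sqrtr_ge0.
apply: lerD; rewrite ler_wpM2l ?rnorm_ge0//.
- rewrite /fock_l1 big_nat_recl// coefXM rnorm0 mulr0 add0r mulr_sumr.
  apply: ler_sum_nat => k /= kn; rewrite coefXM /= sqfactS -mulrA.
  by rewrite ler_wpM2r ?mulr_ge0 ?rnorm_ge0 ?(ltW (sqfact_gt0 _))// sqrt_nat_le.
- case: n pn {n0} => [|n] pn.
    move: pn; rewrite leqn0 size_poly_eq0 => /eqP->.
    by rewrite /fock_l1 big_nat1 deriv0 coef0 rnorm0 mulr0 big_geq// mulr0.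
  rewrite /fock_l1 big_nat_recr//= big_nat_recr//= !coef_deriv.
  rewrite !(@nth_default _ _ p) ?(leq_trans pn)// ?mul0rn ?rnorm0 ?mulr0 ?addr0.
  rewrite [X in _ <= _ * X]big_nat_recl// mulrDr.
  rewrite ler_wpDl ?mulr_ge0 ?sqrtr_ge0 ?rnorm_ge0 ?(ltW (sqfact_gt0 _))//.
  rewrite mulr_sumr; apply: ler_sum_nat => k /= kn.
  rewrite coef_deriv -[p`_k.+1 *+ k.+1]mulr_natl rnormM rnorm_nat sqfactS.
  rewrite -[k.+1%:R in leLHS](@sqr_sqrtr R) ?ler0n// expr2.
  rewrite [leLHS](_ : _ = Num.sqrt k.+1%:R * (Num.sqrt k.+1%:R * sqfact k * rnorm p`_k.+1)).
    by rewrite ler_wpM2r ?mulr_ge0 ?sqrtr_ge0 ?rnorm_ge0 ?(ltW (sqfact_gt0 _))// sqrt_nat_le// ltnW.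
  by ring.
Qed.

(** The successive factors sqrt(k+1), ..., sqrt(k+m) turn the initial value [sqfact k] into
    [sqfact (k + m)]. *)
Lemma fock_l1_iter z m k :
  fock_l1 (k.+1 + m) (iter m (pg z) 'X^k) <= (2 * rnorm z) ^+ m * sqfact (k + m).
Proof.
elim: m => [|m IHm].
  rewrite expr0 mul1r !addn0 /fock_l1 /= big_nat_recr//= coefXn eqxx rnorm1 mulr1.
  rewrite big_nat_cond big1 ?add0r// => j /andP[/andP[_ jk] _].
  by rewrite coefXn ltn_eqF// rnorm0 mulr0.
rewrite addnS iterS; apply: (le_trans (fock_l1_pg _ _)).
  by rewrite size_iter_pg// size_polyXn.
rewrite addnS sqfactS exprS -addSn.
rewrite [leRHS](_ : _ = 2 * rnorm z * Num.sqrt (k.+1 + m)%:R * ((2 * rnorm z) ^+ m * sqfact (k + m))); last by ring.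
by rewrite ler_wpM2l ?mulr_ge0 ?sqrtr_ge0 ?rnorm_ge0.
Qed.

End fock_vectors.

(** From index N on, the partial sum plus twice the next term is non-increasing. *)
Lemma series_ratio_bounded {R : realType} (b : nat -> R) N :
  (forall m, 0 <= b m) -> (forall m, (N <= m)%N -> b m.+1 <= b m / 2) ->
  exists M, forall n, series b n <= M.
Proof.
move=> b0 hb; exists (series b N + 2 * b N) => n.
have mono m l : (m <= l)%N -> series b m <= series b l.
  move=> ml; rewrite -subr_ge0 sub_series_geq//; exact: sumr_ge0.
case: (leqP n N) => [/mono h|/ltnW Nn].
  by apply: (le_trans h); rewrite lerDl mulr_ge0.
suff : series b n + 2 * b n <= series b N + 2 * b N.
  by apply: le_trans; rewrite lerDl mulr_ge0.
elim: n Nn => [|n IHn]; first by rewrite leqn0 => /eqP->.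
rewrite leq_eqVlt => /predU1P[->//|]; rewrite ltnS => Nn.
apply: le_trans (IHn Nn); rewrite {1}/series /= big_nat_recr//= -/(series b n).
by have := hb _ Nn; rewrite -[\sum_(_ <= _ < _) _]/(series b n); lra.
Qed.

(** * The exponential series on number states *)

Section displacement_vectors.
Context {R : realType} {H : hilbertType R} (ket : nat -> H).
Hypotheses (ket_on : orthonormal_seq ket) (ket_tot : total_seq ket).
Local Notation C := R[i].
Implicit Types (z : C) (p q : {poly C}).

Definition displacement_bound (r : R) k m : R :=
  (2 * r) ^+ m * sqfact (k + m) / m`!%:R / sqfact k.

Lemma displacement_bound_ge0 r k m : 0 <= r -> 0 <= displacement_bound r k m.
Proof.
by move=> r0; rewrite !mulr_ge0 ?exprn_ge0 ?mulr_ge0 ?invr_ge0 ?(ltW (sqfact_gt0 _)).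
Qed.

Lemma displacement_bound_series r k : 0 <= r ->
  exists M, forall n, series (displacement_bound r k) n <= M.
Proof.
(* The ratio of consecutive terms is 2r sqrt(k+m+1)/(m+1), at most 1/2 as soon as 16 r^2 (k+m+1) is
   at most (m+1)^2. Since k+m+1 is at most (k+1)(m+1), it is enough that m+1 be at least c. *)
move=> r0; pose c := 16 * r ^+ 2 * k.+1%:R.
have c0 : 0 <= c by rewrite !mulr_ge0 ?exprn_ge0.
apply: (@series_ratio_bounded _ _ (Num.truncn c).+1) => [m|m cm].
  exact: displacement_bound_ge0.
have {}cm : c <= m.+1%:R.
  have := truncnS_gt c => /ltW /le_trans; apply.
  by rewrite ler_nat leqW.
rewrite /displacement_bound addnS sqfactS exprS factS natrM invfM.
rewrite [leLHS](_ : _ = 2 * r * Num.sqrt (k + m).+1%:R / m.+1%:R *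
    ((2 * r) ^+ m * sqfact (k + m) / m`!%:R / sqfact k)); last by ring.
rewrite [leRHS]mulrC ler_wpM2r ?(displacement_bound_ge0 k m r0)//.
rewrite ler_pdivrMr ?ltr0n// -(@ler_pXn2r _ 2) ?nnegrE ?mulr_ge0 ?sqrtr_ge0//.
rewrite !exprMn sqr_sqrtr ?ler0n// exprVn.
have h1 : (k + m).+1%:R <= k.+1%:R * m.+1%:R :> R.
  by rewrite -natrM ler_nat; nia.
have h2 : c * m.+1%:R <= m.+1%:R ^+ 2 by rewrite expr2 ler_wpM2r.
have : 16 * r ^+ 2 * (k + m).+1%:R <= c * m.+1%:R.
  rewrite (_ : c * _ = 16 * r ^+ 2 * (k.+1%:R * m.+1%:R)); last by rewrite /c; ring.
  by rewrite ler_wpM2l ?mulr_ge0 ?exprn_ge0.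
move=> /le_trans /(_ h2) h3.
rewrite (_ : 2 ^+ 2 * _ * _ = 16 * r ^+ 2 * (k + m).+1%:R / 4); last by field.
rewrite (_ : 2 ^- 2 * _ = m.+1%:R ^+ 2 / 4); last by field.
by rewrite ler_wpM2r.
Qed.

Definition displacement_term z k m : H :=
  (m`!%:R)^-1 *: iter m (displacement_generator ket z) (ket k).

Lemma displacement_termE z k m : displacement_term z k m =
  ((m`!%:R)^-1 * (sqfact k)%:C^-1) *: fock_vector ket (iter m (pg z) 'X^k).
Proof.
rewrite /displacement_term ketE iter_displacement_generator//.
rewrite (iter_pgZ z m (sqfact k)%:C^-1 'X^k).
by rewrite (linZ (fock_vector_linear ket)) scalerA.
Qed.

Lemma rnorm_displacement_term z k m :
  rnorm (displacement_term z k m) <= displacement_bound (rnorm z) k m.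
Proof.
rewrite displacement_termE rnormZ rnormM !rnormV rnorm_nat rnormR.
rewrite (ger0_norm (ltW (sqfact_gt0 _))) /displacement_bound.
rewrite [leRHS](_ : _ = m`!%:R^-1 / sqfact k * ((2 * rnorm z) ^+ m * sqfact (k + m))); last by ring.
rewrite ler_wpM2l ?mulr_ge0 ?invr_ge0 ?(ltW (sqfact_gt0 _))//.
apply: le_trans (fock_l1_iter z m k).
by apply: rnorm_fock_vector => //; rewrite size_iter_pg// size_polyXn.
Qed.

Lemma displacement_ket_cvg z k :
  series (displacement_term z k) @ \oo --> displacement_ket ket z k.
Proof.
suff : cvgn (series (displacement_term z k)) by [].
have [M hM] := displacement_bound_series k (rnorm_ge0 z).
have b0 := displacement_bound_ge0 k _ (rnorm_ge0 z).
apply: (@cvg_of_mono _ _ _ (series (displacement_bound (rnorm z) k)) M 0) => //.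
  by move=> m n mn; rewrite -subr_ge0 sub_series_geq//; exact: sumr_ge0.
move=> m n mn; rewrite expr1; apply: series_tail_le => // i.
exact: rnorm_displacement_term.
Qed.

(** The weights sqrt(j!) and sqrt(k!) pass to unnormalised number states, which removes the square
    roots from the ladder relations. *)
Definition displacement_entry z j k : C :=
  (sqfact j)%:C * (sqfact k)%:C * ⟨ket j, displacement_ket ket z k⟩.

Lemma displacement_entry_cvg z j k :
  series (fun m => (m`!%:R)^-1 * (j`!%:R * (iter m (pg z) 'X^k)`_j) : C^o) @ \oo -->
  (displacement_entry z j k : C^o).
Proof.
have h := cvg_braketr (ket j) (@displacement_ket_cvg z k).
apply: cvg_ext (cvgM (cvg_cst ((sqfact j)%:C * (sqfact k)%:C : C^o)) h) => n; rewrite /series /= braket_sumr.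
rewrite -[LHS]/((sqfact j)%:C * (sqfact k)%:C * \sum_(0 <= i < n) ⟨ket j, displacement_term z k i⟩).
rewrite mulr_sumr; apply: eq_bigr => m _.
rewrite displacement_termE braketZr braket_fock_vector// -(sqfactC_sqr j).
by field; rewrite sqfactC_neq0 pnatr_eq0 -lt0n fact_gt0.
Qed.

Lemma fact_invS m : (m.+1`!%:R)^-1 * m.+1%:R = (m`!%:R)^-1 :> C.
Proof.
by rewrite factS natrM invfM mulrAC mulVf ?mul1r// pnatr_eq0.
Qed.

Lemma mulC_cvg (a : C) (u : nat -> C) (l : C) :
  (u : nat -> C^o) @ \oo --> (l : C^o) ->
  (fun n => a * u n : C^o) @ \oo --> (a * l : C^o).
Proof. by move=> ul; apply: cvgM ul; exact: cvg_cst. Qed.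

Lemma cvg_seriesS (u : nat -> C) (l : C) :
  series (u : nat -> C^o) @ \oo --> (l : C^o) ->
  (fun n => series (u : nat -> C^o) n.+1) @ \oo --> (l : C^o).
Proof. by move=> h; rewrite (cvg_shiftS (series (u : nat -> C^o))). Qed.

(** The relation $a D(z) = D(z)(a + z)$, read off the exponential series: m/m! = 1/(m-1)! shifts the
    commutator terms by one index, so partial sums of lengths n and n+1 are compared. *)
Lemma displacement_entrySl z j k : displacement_entry z j.+1 k =
  k%:R * displacement_entry z j k.-1 + z * displacement_entry z j k.
Proof.
apply: (@cvg_uniq _ C^o _ _ _ (cvg_seriesS (@displacement_entry_cvg z j.+1 k))).
have h1 := mulC_cvg (a := k%:R) (cvg_seriesS (@displacement_entry_cvg z j k.-1)).
have h2 := mulC_cvg (a := z) (@displacement_entry_cvg z j k).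
apply: cvg_ext (cvgD h1 h2) => n.
pose s k n := \sum_(0 <= m < n) m`!%:R^-1 * (j`!%:R * (iter m (pg z) 'X^k)`_j).
suff : k%:R * s k.-1 n.+1 + z * s k n =
  \sum_(0 <= m < n.+1) m`!%:R^-1 * (j.+1`!%:R * (iter m (pg z) 'X^k)`_j.+1) by [].
rewrite /s !mulr_sumr.
have -> : \sum_(0 <= i < n) z * (i`!%:R^-1 * (j`!%:R * (iter i (pg z) 'X^k)`_j)) =
    \sum_(0 <= m < n.+1) m`!%:R^-1 * (j`!%:R * ((m%:R * z) *: iter m.-1 (pg z) 'X^k)`_j).
  rewrite [RHS]big_nat_recl// mul0r scale0r coef0 !mulr0 add0r.
  by apply: eq_bigr => m _ /=; rewrite coefZ -(fact_invS m); ring.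
rewrite -big_split /=; apply: eq_bigr => m _.
have := congr1 (fun p : {poly C} => p`_j) (deriv_iter_pg z m 'X^k).
rewrite derivXn -scaler_nat iter_pgZ coefD coefZ coef_deriv -[_ *+ _]mulr_natl => h.
rewrite [in RHS]factS natrM.
have -> : j.+1%:R * j`!%:R * (iter m (pg z) 'X^k)`_j.+1 =
  j`!%:R * (j.+1%:R * (iter m (pg z) 'X^k)`_j.+1) by ring.
by rewrite h; ring.
Qed.

(** The relation $D(z) a^\dagger = (a^\dagger - \bar z) D(z)$, by the same shift. *)
Lemma displacement_entrySr z j k : displacement_entry z j k.+1 =
  j%:R * displacement_entry z j.-1 k - z^* * displacement_entry z j k.
Proof.
apply: (@cvg_uniq _ C^o _ _ _ (cvg_seriesS (@displacement_entry_cvg z j k.+1))).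
have h1 := mulC_cvg (a := j%:R) (cvg_seriesS (@displacement_entry_cvg z j.-1 k)).
have h2 := mulC_cvg (a := z^*) (@displacement_entry_cvg z j k).
apply: cvg_ext (cvgB h1 h2) => n.
pose s j n := \sum_(0 <= m < n) m`!%:R^-1 * (j`!%:R * (iter m (pg z) 'X^k)`_j).
suff : j%:R * s j.-1 n.+1 - z^* * s j n =
  \sum_(0 <= m < n.+1) m`!%:R^-1 * (j`!%:R * (iter m (pg z) 'X^(k.+1))`_j) by [].
rewrite /s !mulr_sumr.
have -> : \sum_(0 <= i < n) z^* * (i`!%:R^-1 * (j`!%:R * (iter i (pg z) 'X^k)`_j)) =
    \sum_(0 <= m < n.+1) m`!%:R^-1 * (j`!%:R * ((m%:R * z^*) *: iter m.-1 (pg z) 'X^k)`_j).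
  rewrite [RHS]big_nat_recl// mul0r scale0r coef0 !mulr0 add0r.
  by apply: eq_bigr => m _ /=; rewrite coefZ -(fact_invS m); ring.
rewrite -sumrB; apply: eq_bigr => m _.
rewrite exprS iter_pg_mulX coefB coefXM.
case: j {s h1 h2} => [|j] /=; first by rewrite ?mulr0n; ring.
by rewrite factS natrM; ring.
Qed.

(** Odd terms vanish, and the even ones form the exponential series at -|z|^2/2. *)
Lemma displacement_entry00 z : displacement_entry z 0 0 = (expR (- (rnorm z ^+ 2 / 2)))%:C.
Proof.
set kappa := - (rnorm z ^+ 2 / 2).
pose a m : C := m`!%:R^-1 * (0`!%:R * (iter m (pg z) 'X^0)`_0).
have aSS m : a m.+2 = kappa%:C * 2 / m.+2%:R * a m.
  rewrite /a expr0 coef0_iter_pg1 -(fact_invS m) -(fact_invS m.+1).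
  rewrite /kappa rmorphN rmorphM fmorphV /= rmorphXn /= rnormE rmorph_nat.
  have : m.+2%:R != 0 :> C by rewrite pnatr_eq0.
  move: (m.+2%:R) (m.+1%:R) (m.+2`!%:R^-1) => x y t x0.
  by field.
have a_odd m : a m.*2.+1 = 0.
  elim: m => [|m IHm]; last by rewrite doubleS aSS IHm mulr0.
  rewrite /a expr0 /= pgE coefB coefZ coefXM mulr0 -polyC1 derivC scaler0 coef0.
  by rewrite subr0 !mulr0.
have a_even m : a m.*2 = (exp_coeff kappa m)%:C.
  elim: m => [|m IHm].
    by rewrite /a /exp_coeff /= !expr0 coef1 /= !mulr1 !invr1 mulr1.
  rewrite doubleS aSS IHm /exp_coeff /= exprS factS natrM -doubleS -mul2n natrM.
  rewrite !(rmorphM, fmorphV, rmorphXn, rmorph_nat) /=.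
  have : m.+1%:R != 0 :> C by rewrite pnatr_eq0.
  have : m`!%:R != 0 :> C by rewrite pnatr_eq0 -lt0n fact_gt0.
  by move: (m.+1%:R) (m`!%:R) => x y y0 x0; field; rewrite x0 y0.
have a_sum n : series a n.*2 = (series (exp_coeff kappa) n)%:C.
  elim: n => [|n IHn]; first by rewrite /series /= !big_geq.
  rewrite doubleS /series /= !big_nat_recr//= rmorphD /= -/(series a n.*2) a_odd addr0.
  by rewrite -[\sum_(_ <= _ < n.*2) _]/(series a n.*2) IHn a_even.
have h : (fun n => series (a : nat -> C^o) n.*2) @ \oo --> (displacement_entry z 0 0 : C^o).
  apply: cvg_comp (@displacement_entry_cvg z 0 0) => B [N _ hN].
  by exists N => // n /= Nn; apply: hN => /=; rewrite -addnn (leq_trans Nn)// leq_addr.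
rewrite -/(displacement_entry z 0 0 : C^o); apply: (@cvg_uniq _ C^o _ _ _ h).
apply: (@cvg_rnorm_le _ C^o _ _ (fun n => `|series (exp_coeff kappa) n - expR kappa|)).
  by apply: nearW => n; rewrite a_sum -rmorphB rnormR.
rewrite -(normr0 R); apply: cvg_norm; rewrite -(subrr (expR kappa)).
by apply: cvgB; [exact: is_cvg_series_exp_coeff | exact: cvg_cst].
Qed.

End displacement_vectors.

(** * Unitarity and composition of displacements *)

Section displacement_unitary.
Context {R : realType} {H : hilbertType R} (ket : nat -> H).
Hypotheses (ket_on : orthonormal_seq ket) (ket_tot : total_seq ket).
Local Notation C := R[i].
Implicit Types (z w : C).
Local Notation dk := (displacement_ket ket).
Local Notation de := (displacement_entry ket).

Lemma displacement_entry_rec z : displacement_recursion z (de z).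
Proof.
split=> [j k|k]; first exact: displacement_entrySl.
by rewrite displacement_entrySr// mulr0n mul0r sub0r mulNr.
Qed.

Lemma displacement_entry00_neq0 z : de z 0 0 != 0.
Proof. by rewrite displacement_entry00// fmorph_eq0 gt_eqF// expR_gt0. Qed.

(** $D(z)^\dagger = D(-z)$ on matrix elements: conjugating and transposing swaps the two ladder
    relations, giving a solution for -z with the same real vacuum entry. *)
Lemma displacement_entry_conj z j k : (de z k j)^* = de (- z) j k.
Proof.
pose W j k := (de z k j)^*.
have W00 : W 0 0 = de (- z) 0 0.
  by rewrite /W !displacement_entry00// rnormN conj_Creal// realC_real.
have W_rec : displacement_recursion (- z) W.
  split=> [{}j {}k|{}k]; rewrite /W.
    rewrite displacement_entrySr// rmorphB !rmorphM /= conjCK conjC_nat.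
    by rewrite mulNr.
  rewrite displacement_entrySl// mulr0n mul0r add0r rmorphM rmorphN /=.
  by rewrite opprK.
have := displacement_recursion_uniq W_rec (displacement_entry_rec (- z)) j k.
by rewrite W00 => /(mulIf (displacement_entry00_neq0 _)).
Qed.

Lemma braket_ket_displacement_ket z j k :
  ⟨ket j, dk z k⟩ = de z j k / ((sqfact j)%:C * (sqfact k)%:C).
Proof.
rewrite /displacement_entry mulrAC divff ?mul1r//.
by rewrite mulf_neq0// sqfactC_neq0.
Qed.

Lemma braket_displacement_ket_ket z j k : ⟨dk z j, ket k⟩ = ⟨ket j, dk (- z) k⟩.
Proof.
rewrite -braket_conj !braket_ket_displacement_ket rmorphM /= displacement_entry_conj.
by rewrite fmorphV rmorphM /= !(conj_Creal (realC_real _)) [X in _ / X]mulrC.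
Qed.

(** The matrix elements of D(z) D(w), with D(z) moved to the left as its adjoint D(-z). *)
Definition displacement_product z w j k : C :=
  (sqfact j)%:C * (sqfact k)%:C * ⟨dk (- z) j, dk w k⟩.

Lemma displacement_product_cvg z w j k :
  series (fun l => (l`!%:R)^-1 * (de z j l * de w l k) : C^o) @ \oo -->
  (displacement_product z w j k : C^o).
Proof.
have h := parseval_braket (dk (- z) j) (dk w k) ket_on ket_tot.
apply: cvg_ext (mulC_cvg (a := (sqfact j)%:C * (sqfact k)%:C) h) => n.
rewrite /series /= mulr_sumr; apply: eq_bigr => l _.
rewrite braket_displacement_ket_ket opprK !braket_ket_displacement_ket -sqfactC_sqr.
by field; rewrite !sqfactC_neq0.
Qed.

(** The composition law at the level of recursions: a ladder operator is carried through D(z) and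
    then D(w), across the inserted resolution of the identity, and picks up z and then w. *)
Lemma displacement_product_rec z w :
  displacement_recursion (z + w) (displacement_product z w).
Proof.
pose s (x : nat -> C) n := \sum_(0 <= l < n) (l`!%:R)^-1 * x l.
(* Moving a ladder operator from one factor to the other shifts the intermediate photon number l by
   one, hence the two lengths. *)
have shift (x y : nat -> C) n :
    s (fun l => l%:R * x l.-1 * y l) n.+1 = s (fun l => x l * y l.+1) n.
  rewrite /s big_nat_recl//= mulr0n !mul0r mulr0 add0r.
  by apply: eq_bigr => l _; rewrite -(fact_invS l); ring.
have sD (x y : nat -> C) n : s (fun l => x l + y l) n = s x n + s y n.
  by rewrite /s -big_split /=; apply: eq_bigr => l _; ring.
have sZ (a : C) (x : nat -> C) n : s (fun l => a * x l) n = a * s x n.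
  by rewrite /s mulr_sumr; apply: eq_bigr => l _; ring.
split=> [j k|k].
- have h := @displacement_product_cvg z w j.+1 k.
  apply: (@cvg_uniq _ C^o _ _ _ (cvg_seriesS h)).
  have h1 := mulC_cvg (a := k%:R) (@displacement_product_cvg z w j k.-1).
  have h2 := mulC_cvg (a := w) (@displacement_product_cvg z w j k).
  have h3 := mulC_cvg (a := z) (cvg_seriesS (@displacement_product_cvg z w j k)).
  rewrite mulrDl [z * _ + _]addrC addrA.
  apply: cvg_ext (cvgD (cvgD h1 h2) h3) => n.
  suff : k%:R * s (fun l => de z j l * de w l k.-1) n
       + w * s (fun l => de z j l * de w l k) n
       + z * s (fun l => de z j l * de w l k) n.+1
     = s (fun l => de z j.+1 l * de w l k) n.+1 by [].
  rewrite -!sZ -sD.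
  have -> : (fun l => k%:R * (de z j l * de w l k.-1) + w * (de z j l * de w l k)) =
      (fun l => de z j l * de w l.+1 k).
    by apply/funext => l; rewrite displacement_entrySl//; ring.
  rewrite -(shift (de z j) (fun l => de w l k)) -sD; congr (s _ _).
  by apply/funext => l; rewrite displacement_entrySl//; ring.
- have h := @displacement_product_cvg z w 0 k.+1.
  apply: (@cvg_uniq _ C^o _ _ _ (cvg_seriesS h)).
  have h1 := mulC_cvg (a := - z^*) (@displacement_product_cvg z w 0 k).
  have h2 := mulC_cvg (a := - w^*) (cvg_seriesS (@displacement_product_cvg z w 0 k)).
  rewrite rmorphD /= opprD mulrDl.
  apply: cvg_ext (cvgD h1 h2) => n.
  suff : - z^* * s (fun l => de z 0 l * de w l k) n
       + - w^* * s (fun l => de z 0 l * de w l k) n.+1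
     = s (fun l => de z 0 l * de w l k.+1) n.+1 by [].
  rewrite -!sZ.
  have -> : (fun l => - z^* * (de z 0 l * de w l k)) = (fun l => de w l k * de z 0 l.+1).
    by apply/funext => l; rewrite displacement_entrySr// mulr0n mul0r sub0r; ring.
  rewrite -(shift (fun l => de w l k) (de z 0)) -sD; congr (s _ _).
  by apply/funext => l; rewrite displacement_entrySr//; ring.
Qed.

Lemma displacement_entry_col0 z j : de z j 0 = z ^+ j * de z 0 0.
Proof.
elim: j => [|j IHj]; first by rewrite expr0 mul1r.
by rewrite displacement_entrySl// mulr0n mul0r add0r IHj exprS mulrA.
Qed.

(** The squared coordinates of a coherent state are the Poisson weights with mean |z|^2. *)
Lemma rnorm_displacement_vacuum z : rnorm (dk z 0) = 1.
Proof.
apply/eqP; rewrite -(@eqrXn2 _ 2) ?rnorm_ge0// expr1n; apply/eqP.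
have h := parseval (dk z 0) ket_on ket_tot.
rewrite -(cvg_lim (@Rhausdorff R) h) -[RHS](expRxMexpNx_1 (rnorm z ^+ 2)).
apply: cvg_lim => //.
have h2 : (fun n => series (exp_coeff (rnorm z ^+ 2)) n * expR (- rnorm z ^+ 2)) @ \oo -->
    expR (rnorm z ^+ 2) * expR (- rnorm z ^+ 2).
  by apply: cvgM; [exact: is_cvg_series_exp_coeff | exact: cvg_cst].
apply: cvg_ext h2 => n.
rewrite /series /= mulr_suml; apply: eq_bigr => k _.
rewrite braket_ket_displacement_ket displacement_entry_col0 displacement_entry00//.
rewrite sqfact0 mulr1 !rnormM rnormV rnormX !rnormR !ger0_norm ?expR_ge0 ?(ltW (sqfact_gt0 _))//.
rewrite !exprMn exprVn sqfact_sqr -expRM_natl.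
rewrite (_ : 2%:R * - (rnorm z ^+ 2 / 2) = - rnorm z ^+ 2); last by field.
by rewrite /exp_coeff /= -!exprM mulnC mulrAC.
Qed.

(** The product of D(-z) and D(z) solves the recursion at 0, as the identity does, and the
    normalised vacuum fixes the constant. *)
Lemma displacement_ket_orthonormal z : orthonormal_seq (dk z).
Proof.
move=> j k.
have := displacement_product_rec (- z) z; rewrite addNr => h.
have := displacement_recursion_uniq h displacement_recursion0 j k.
rewrite fact0 eqxx !mulr1 /displacement_product !opprK sqfact0 mul1r.
rewrite braket_norm rnorm_displacement_vacuum expr1n !mulr1 => E.
have : (sqfact j)%:C * (sqfact k)%:C != 0 :> C by rewrite mulf_neq0// sqfactC_neq0.
move=> /mulfI; apply; rewrite E -sqfactC_sqr.
by have [->|] := eqVneq j k; rewrite ?mulr0// !mulr1 expr2.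
Qed.

End displacement_unitary.

Section displacement_operator.
Context {R : realType} {H : hilbertType R} (ket : nat -> H).
Hypotheses (ket_on : orthonormal_seq ket) (ket_tot : total_seq ket).
Local Notation C := R[i].
Implicit Types (z w : C).
Local Notation dk := (displacement_ket ket).
Local Notation de := (displacement_entry ket).
Local Notation D := (displacement ket).

Lemma displacementE z : D z = multiplier ket (dk z) (fun _ => 1).
Proof.
apply/funext => v; rewrite /displacement /multiplier /osum; congr (limn (series _)).
by apply/funext => k; rewrite mul1r.
Qed.

Let dk_on := displacement_ket_orthonormal ket_on ket_tot.
Let one_le (k : nat) : rnorm (1 : C) <= 1. Proof. by rewrite rnorm1. Qed.

Lemma displacement_linear z : linear (D z).
Proof. by rewrite displacementE; exact: multiplier_linear one_le. Qed.

Lemma displacement_basis z k : D z (ket k) = dk z k.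
Proof. by rewrite displacementE (multiplier_basis ket_on (dk_on z) one_le) scale1r. Qed.

Lemma braket_dk_displacement z j v : ⟨dk z j, D z v⟩ = ⟨ket j, v⟩.
Proof. by rewrite displacementE (braket_multiplier ket_on (dk_on z) one_le) mul1r. Qed.

Lemma braket_displacement z j v : ⟨ket j, D z v⟩ = ⟨dk (- z) j, v⟩.
Proof.
rewrite displacementE.
have h := cvg_braket_multiplier ket_on (dk_on z) one_le (ket j) v.
apply: (@cvg_uniq _ C^o _ _ _ h).
apply: cvg_ext (parseval_braket (dk (- z) j) v ket_on ket_tot) => n.
rewrite /series /=; apply: eq_bigr => k _; rewrite mul1r.
by rewrite braket_displacement_ket_ket// opprK.
Qed.

Lemma rnorm_displacement_le z v : rnorm (D z v) <= rnorm v.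
Proof.
by rewrite displacementE -[leRHS]mul1r; exact: rnorm_multiplier ket_on (dk_on z) one_le v.
Qed.

(** For the lower bound, Bessel's inequality for [D z v] against [dk z] is enough, as the
    coordinates there are those of v. Completeness of [dk z] is itself deduced from this lemma. *)
Lemma rnorm_displacement z v : rnorm (D z v) = rnorm v.
Proof.
apply/le_anti; rewrite rnorm_displacement_le andTb.
rewrite -(@ler_pXn2r _ 2) ?nnegrE ?rnorm_ge0//.
apply: (limR_le (parseval v ket_on ket_tot)); apply: nearW => n.
rewrite (le_trans _ (bessel (D z v) n (dk_on z)))//.
by rewrite le_eqVlt; apply/orP; left; apply/eqP; apply: eq_bigr => k _;
  rewrite braket_dk_displacement.
Qed.

Lemma displacement_ket_total z : total_seq (dk z).
Proof.
move=> v zv0; have : D (- z) v = 0.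
  by apply: ket_tot => k; rewrite braket_displacement opprK.
move=> /(congr1 (@rnorm R H)); rewrite rnorm_displacement rnorm0 => /eqP.
by rewrite rnorm_eq0 => /eqP.
Qed.

(** The factor r is the ratio of the vacuum entries, hence common to all k; it has modulus one
    because displacements are isometric. *)
Lemma displacement_displacement_ket z w : exists2 r : C, rnorm r = 1 &
  forall k, D z (dk w k) = r *: dk (z + w) k.
Proof.
pose r := displacement_product ket z w 0 0 / de (z + w) 0 0.
have h k : D z (dk w k) = r *: dk (z + w) k.
  apply: (total_ext ket_tot) => j; rewrite braketZr braket_displacement.
  have := displacement_recursion_uniq (displacement_product_rec ket_on ket_tot z w)
    (displacement_entry_rec ket_on (z + w)) j k.
  have de0 : de (z + w) 0 0 != 0 by exact: displacement_entry00_neq0.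
  rewrite braket_ket_displacement_ket /r.
  move=> /(canRL (mulfK de0)) E.
  have -> : ⟨dk (- z) j, dk w k⟩ =
      displacement_product ket z w j k / ((sqfact j)%:C * (sqfact k)%:C).
    rewrite /displacement_product mulrAC divff ?mul1r//.
    by rewrite mulf_neq0// sqfactC_neq0.
  by rewrite E; ring.
exists r => //; have := congr1 (@rnorm R H) (h 0).
by rewrite rnormZ rnorm_displacement !(rnorm_ket (dk_on _)) mulr1.
Qed.

(** The exponential series from its second-order term on, with h^m at most h^2 for h in [0,1]. *)
Lemma displacement_ket_taylor z k : exists2 c : R, 0 <= c &
  forall h : R, 0 <= h -> h <= 1 ->
    rnorm (dk (h%:C * z) k - (ket k + h%:C *: displacement_generator ket z (ket k)))
      <= h ^+ 2 * c.
Proof.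
have [M hM] := displacement_bound_series k (rnorm_ge0 z).
have b0 := displacement_bound_ge0 k _ (rnorm_ge0 z).
exists M => [|h h0 h1]; first by have := hM 0; rewrite /series /= big_geq.
have hterm m : displacement_term ket (h%:C * z) k m = h%:C ^+ m *: displacement_term ket z k m.
  rewrite !displacement_termE// iter_pg_real ?realC_real// (linZ (fock_vector_linear ket)).
  by rewrite !scalerA mulrC.
have cv : (fun n => series (displacement_term ket (h%:C * z) k) n -
    (ket k + h%:C *: displacement_generator ket z (ket k))) @ \oo -->
    dk (h%:C * z) k - (ket k + h%:C *: displacement_generator ket z (ket k)).
  by apply: cvgB; [exact: displacement_ket_cvg | exact: cvg_cst].
apply: (limR_le (cvg_norm_rnorm cv)); exists 2 => // -[|[|n]]//= _.
have -> : ket k + h%:C *: displacement_generator ket z (ket k) =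
    series (displacement_term ket (h%:C * z) k) 2.
  rewrite /series /= big_nat_recr// big_nat1 !hterm expr0 expr1 scale1r.
  by rewrite /displacement_term fact0 invr1 !scale1r.
rewrite sub_series_geq//; apply: (le_trans (rnorm_sum _ _ _)).
apply: (@le_trans _ _ (h ^+ 2 * \sum_(2 <= m < n.+2) displacement_bound (rnorm z) k m)).
  rewrite mulr_sumr; apply: ler_sum_nat => m /andP[m2 _].
  rewrite hterm rnormZ rnormX rnormR ger0_norm//.
  apply: ler_pM; rewrite ?exprn_ge0 ?rnorm_ge0 ?rnorm_displacement_term//.
  exact: ler_wiXn2l.
rewrite ler_wpM2l ?exprn_ge0//; apply: le_trans (hM n.+2).
by rewrite -sub_series_geq// lerBlDr lerDl /series /= sumr_ge0.
Qed.

Lemma displacement_generator_ket z k : displacement_generator ket z (ket k) =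
  (z * (Num.sqrt k.+1%:R)%:C) *: ket k.+1 - (z^* * (Num.sqrt k%:R)%:C) *: ket k.-1.
Proof.
rewrite (ketE ket k) displacement_generatorE// pgE -scalerAr -exprS derivZ derivXn.
rewrite (linB (fock_vector_linear ket)) !(linZ (fock_vector_linear ket)).
rewrite -scaler_nat (linZ (fock_vector_linear ket)) !fock_vectorX !scalerA.
have h0 : (sqfact k)%:C != 0 :> C := sqfactC_neq0 k.
congr (_ *: _ - _ *: _).
  by rewrite sqfactS rmorphM /=; field.
case: k h0 => [|k] h0 /=; first by rewrite sqrtr0 mulr0n mulr0 !mul0r mulr0.
rewrite sqfactS rmorphM /= -(sqrtnatC_sqr k.+1).
have s0 : (Num.sqrt (k.+1%:R : R))%:C != 0 :> C.
  by rewrite fmorph_eq0 gt_eqF// sqrtr_gt0 ltr0n.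
by field; rewrite s0 sqfactC_neq0.
Qed.

End displacement_operator.

(** What the twirling estimate retains of a measurement: each POVM element gives a Hermitian form of
    norm at most one. The common bound makes all constants independent of the POVM and of the
    outcome set. *)
Definition bounded_form {R : realType} {H : hilbertType R} (b : H -> H -> R[i]) : Prop :=
  [/\ forall u, scalar (b u), forall u v, (b u v)^* = b v u &
      forall u v, rnorm (b u v) <= rnorm u * rnorm v].

(** * Twirling *)

Section bounded_forms.
Context {R : realType} {H : hilbertType R} (b : H -> H -> R[i]).
Hypothesis b_form : bounded_form b.

Lemma formDr u v w : b u (v + w) = b u v + b u w.
Proof. by case: b_form => h _ _; exact: (@linD _ H R[i]^o _ (h u)). Qed.

Lemma formZr u a v : b u (a *: v) = a * b u v.
Proof. by case: b_form => h _ _; exact: (@linZ _ H R[i]^o _ (h u)). Qed.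

Lemma formDl u v w : b (u + v) w = b u w + b v w.
Proof. by case: b_form => _ h _; rewrite -!(h w) formDr rmorphD. Qed.

Lemma formZl u a v : b (a *: u) v = a^* * b u v.
Proof. by case: b_form => _ h _; rewrite -!(h v) formZr rmorphM. Qed.

Lemma formNr u v : b u (- v) = - b u v.
Proof. by rewrite -scaleN1r formZr mulN1r. Qed.

Lemma formNl u v : b (- u) v = - b u v.
Proof. by rewrite -scaleN1r formZl rmorphN rmorph1 mulN1r. Qed.

End bounded_forms.

Section twirl.
Context {R : realType} {H : hilbertType R} (ket : nat -> H).
Hypotheses (ket_on : orthonormal_seq ket) (ket_tot : total_seq ket).
Local Notation C := R[i].
Implicit Types (z w : C) (b : H -> H -> C).
Local Notation dk := (displacement_ket ket).
Local Notation G := (displacement_generator ket).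

Lemma bounded_form_displacement b z : bounded_form b ->
  bounded_form (fun u v => b (displacement ket z u) (displacement ket z v)).
Proof.
move=> bf; have D_lin := displacement_linear ket_on ket_tot z.
split=> [u a v w|u v|u v].
- by rewrite D_lin (formDr bf) (formZr bf).
- by case: bf => _ ->.
- by case: bf => _ _ h; rewrite (le_trans (h _ _))// !rnorm_displacement.
Qed.

(** Transporting the form by D(z) reduces the expansion at z to one at 0, so the constant E depends
    neither on b nor on z. *)
Lemma form_taylor w j k : exists2 E : R, 0 <= E & forall b z (h : R),
  bounded_form b -> 0 <= h -> h <= 1 ->
  let D := displacement ket z in
  rnorm (b (dk (z + h%:C * w) j) (dk (z + h%:C * w) k)
    - b (dk z j) (dk z k)
    - h%:C * (b (D (G w (ket j))) (D (ket k)) + b (D (ket j)) (D (G w (ket k)))))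
  <= h ^+ 2 * E.
Proof.
have [cj cj0 hcj] := displacement_ket_taylor ket_on w j.
have [ck ck0 hck] := displacement_ket_taylor ket_on w k.
pose gj := rnorm (G w (ket j)); pose gk := rnorm (G w (ket k)).
have gj0 : 0 <= gj by exact: rnorm_ge0.
have gk0 : 0 <= gk by exact: rnorm_ge0.
(* One summand for the product of the two first-order terms, one for the Taylor error on the left
   against a unit vector, one for the error on the right against a vector of norm at most 1 + gj. *)
exists (gj * gk + cj + (1 + gj) * ck).
  by rewrite !addr_ge0 ?mulr_ge0// addr_ge0.
move=> b z h bf h0 h1; cbv zeta; set D := displacement ket z.
pose bz u v := b (D u) (D v).
have bzf : bounded_form bz by exact: bounded_form_displacement.
have bz_le u v : rnorm (bz u v) <= rnorm u * rnorm v by case: bzf.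
(* The phase of the composition law cancels between the two arguments of the form. *)
have [r r1 hr] := displacement_displacement_ket ket_on ket_tot z (h%:C * w).
have rr : r^* * r = 1 by rewrite mulrC mulC_conj r1 expr1n.
have -> : b (dk (z + h%:C * w) j) (dk (z + h%:C * w) k) =
    bz (dk (h%:C * w) j) (dk (h%:C * w) k).
  by rewrite /bz /D !hr (formZl bf) (formZr bf) mulrA rr mul1r.
rewrite -!(displacement_basis ket_on ket_tot z) -/D -!/(bz _ _).
have {}hcj := hcj _ h0 h1; have {}hck := hck _ h0 h1.
set uh := dk (h%:C * w) j; set vh := dk (h%:C * w) k.
move: hcj hck; rewrite -/uh -/vh.
set ej := uh - _; set ek := vh - _ => hcj hck.
have uhE : uh = ket j + h%:C *: G w (ket j) + ej by rewrite addrC subrK.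
have vhE : vh = ket k + h%:C *: G w (ket k) + ek by rewrite addrC subrK.
have -> : bz uh vh - bz (ket j) (ket k)
     - h%:C * (bz (G w (ket j)) (ket k) + bz (ket j) (G w (ket k))) =
   h%:C ^+ 2 * bz (G w (ket j)) (G w (ket k)) + bz ej vh
     + bz (ket j + h%:C *: G w (ket j)) ek.
  rewrite {1}uhE (formDl bzf _ ej) [in X in X + _ - _ - _]vhE.
  rewrite !(formDl bzf, formDr bzf, formZl bzf, formZr bzf) !(conj_Creal (realC_real _)).
  by ring.
have vh1 : rnorm vh = 1 by exact: (rnorm_ket (displacement_ket_orthonormal ket_on ket_tot _)).
have hC2 : rnorm (h%:C ^+ 2) = h ^+ 2 by rewrite rnormX rnormR ger0_norm.
apply: (le_trans (rnormD _ _)); rewrite mulrDr lerD//; last first.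
  apply: (le_trans (bz_le _ _)); rewrite mulrCA; apply: ler_pM; rewrite ?rnorm_ge0//.
  apply: (le_trans (rnormD _ _)); rewrite (rnorm_ket ket_on) lerD2l rnormZ rnormR.
  by rewrite ger0_norm// ler_piMl.
apply: (le_trans (rnormD _ _)); rewrite mulrDr lerD//.
  by rewrite rnormM hC2 ler_wpM2l ?exprn_ge0// bz_le.
by apply: (le_trans (bz_le _ _)); rewrite vh1 mulr1.
Qed.

Definition grid (q m l : nat) : C :=
  (m%:R / q%:R : R)%:C * 1 + (l%:R / q%:R : R)%:C * 'i.

Lemma gridSl q m l : grid q m.+1 l = grid q m l + (q%:R^-1)%:C * 1.
Proof. by rewrite /grid -natr1 mulrDl !rmorphD /= mul1r; ring. Qed.

Lemma gridSr q m l : grid q m l.+1 = grid q m l + (q%:R^-1)%:C * 'i.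
Proof. by rewrite /grid -natr1 mulrDl !rmorphD /= mul1r; ring. Qed.

(* [w |k+1><k| + w^* |k><k+1|] is the quadrature whose commutators with the
   generators in the directions [w = 1] and [w = i] add up to
   [4 sqrt(k+1) (|k+1><k+1| - |k><k|)]. *)
Definition quadrature b k w z : C :=
  w * b (dk z k) (dk z k.+1) + w^* * b (dk z k.+1) (dk z k).

Lemma quadrature_le b k w z : bounded_form b -> rnorm w = 1 ->
  rnorm (quadrature b k w z) <= 2.
Proof.
move=> [_ _ b_le] w1; apply: (le_trans (rnormD _ _)).
have h j l : rnorm (b (dk z j) (dk z l)) <= 1.
  apply: (le_trans (b_le _ _)).
  by rewrite !(rnorm_ket (displacement_ket_orthonormal ket_on ket_tot _)) mulr1.
by rewrite !rnormM rnorm_conj w1 !mul1r (_ : 2 = 1 + 1)// lerD.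
Qed.

(** The derivative of [quadrature b k w] at z in the direction w, by the product rule. *)
Definition quadrature_slope b k w z : C :=
  let D := displacement ket z in
  w * (b (D (G w (ket k))) (D (ket k.+1)) + b (D (ket k)) (D (G w (ket k.+1)))) +
  w^* * (b (D (G w (ket k.+1))) (D (ket k)) + b (D (ket k.+1)) (D (G w (ket k)))).

(** Each direction contributes 2 sqrt(k+1) |w|^2 times the diagonal difference. The entries two
    levels apart carry w^2 or its conjugate and cancel, since 1 + i^2 = 0. *)
Lemma quadrature_slope_sum b k z : bounded_form b ->
  quadrature_slope b k 1 z + quadrature_slope b k 'i z =
  4%:R * (Num.sqrt k.+1%:R)%:C * (b (dk z k.+1) (dk z k.+1) - b (dk z k) (dk z k)).
Proof.
move=> bf; have bzf := bounded_form_displacement z bf.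
rewrite -!(displacement_basis ket_on ket_tot z) /quadrature_slope /=.
set bz := fun u v => b (displacement ket z u) (displacement ket z v).
rewrite -/bz in bzf; rewrite -!/(bz _ _) !displacement_generator_ket//=.
rewrite !(formDl bzf, formDr bzf, formNl bzf, formNr bzf, formZl bzf, formZr bzf).
rewrite !rmorphM /= !(conj_Creal (realC_real _)) !conjCK !conjCi !rmorph1.
have ii : 'i * 'i = -1 :> C by rewrite -expr2 sqrCi.
move: (Num.sqrt _)%:C (Num.sqrt _)%:C (Num.sqrt _)%:C => s0 s1 s2.
move: (bz (ket k.+1) (ket k.+1)) (bz (ket k) (ket k)) => x y.
move: (bz (ket k.-1) (ket k.+1)) (bz (ket k.+1) (ket k.-1)) => p q.
move: (bz (ket k.+2) (ket k)) (bz (ket k) (ket k.+2)) => p' q'.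
by ring: ii.
Qed.

Lemma quadrature_step k w : rnorm w = 1 -> exists2 E : R, 0 <= E &
  forall b z (h : R), bounded_form b -> 0 <= h -> h <= 1 ->
  rnorm (quadrature b k w (z + h%:C * w) - quadrature b k w z
         - h%:C * quadrature_slope b k w z) <= h ^+ 2 * E.
Proof.
move=> w1; have [E1 E10 hE1] := form_taylor w k k.+1.
have [E2 E20 hE2] := form_taylor w k.+1 k.
exists (E1 + E2) => [|b z h bf h0 h1]; first exact: addr_ge0.
have {}hE1 := hE1 b z h bf h0 h1; have {}hE2 := hE2 b z h bf h0 h1.
rewrite /quadrature /quadrature_slope.
set x1 := b (dk z k) _; set x2 := b (dk z k.+1) _.
move: hE1 hE2; rewrite /= -/x1 -/x2.
set y1 := b (dk (_ + _) k) _; set y2 := b (dk (_ + _) k.+1) _.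
set t1 := b _ _ + b _ _; set t2 := b _ _ + b _ _.
move=> hE1 hE2.
rewrite [X in rnorm X](_ : _ = w * (y1 - x1 - h%:C * t1) + w^* * (y2 - x2 - h%:C * t2)); last by ring.
move: (y1 - x1 - _) (y2 - x2 - _) hE1 hE2 => a1 a2 hE1 hE2.
apply: (le_trans (rnormD _ _)); rewrite !rnormM rnorm_conj w1 !mul1r.
by rewrite [leRHS]mulrDr lerD.
Qed.

(** Each line telescopes: its two ends cost at most 2 each and its q^2 remainders at most E/q^2
    each. The family [zz] is arbitrary so that both the grid and its transpose can be used. *)
Lemma quadrature_grid b k w (q : nat) (zz : nat -> nat -> C) (E : R) :
  bounded_form b -> rnorm w = 1 -> (0 < q)%N ->
  (forall b z (h : R), bounded_form b -> 0 <= h -> h <= 1 ->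
    rnorm (quadrature b k w (z + h%:C * w) - quadrature b k w z
         - h%:C * quadrature_slope b k w z) <= h ^+ 2 * E) ->
  (forall m l, zz m.+1 l = zz m l + (q%:R^-1)%:C * w) ->
  rnorm (\sum_(0 <= l < (q ^ 2)%N) \sum_(0 <= m < (q ^ 2)%N)
           (q%:R^-1)%:C * quadrature_slope b k w (zz m l))
    <= q%:R ^+ 2 * (4 + E).
Proof.
move=> bf w1 q0 hE zzS; have qR0 : 0 < q%:R :> R by rewrite ltr0n.
have h0 : 0 <= q%:R^-1 :> R by rewrite invr_ge0 ler0n.
have h1 : q%:R^-1 <= 1 :> R by rewrite invf_le1// ler1n.
apply: (le_trans (rnorm_sum _ _ _)).
apply: (@le_trans _ _ (\sum_(0 <= l < (q ^ 2)%N) (4 + E))); last first.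
  by rewrite sumr_const_nat subn0 -[_ *+ _]mulr_natl natrX.
apply: ler_sum => l _.
pose T m := quadrature b k w (zz m l).
pose e m := T m.+1 - T m - (q%:R^-1)%:C * quadrature_slope b k w (zz m l).
have -> : \sum_(0 <= m < (q ^ 2)%N) (q%:R^-1)%:C * quadrature_slope b k w (zz m l) =
    T (q ^ 2)%N - T 0 - \sum_(0 <= m < (q ^ 2)%N) e m.
  rewrite -(telescope_sumr T)// -sumrB; apply: eq_bigr => m _.
  by rewrite /e opprB addrC subrK.
have he m : rnorm (e m) <= q%:R^-1 ^+ 2 * E by rewrite /e /T zzS; exact: hE.
apply: (le_trans (rnormD _ _)); rewrite rnormN lerD//.
  apply: (le_trans (rnormD _ _)); rewrite rnormN (_ : 4 = 2 + 2 :> R); last by ring.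
  by rewrite lerD// quadrature_le.
apply: (le_trans (rnorm_sum _ _ _)).
apply: (@le_trans _ _ (\sum_(0 <= m < (q ^ 2)%N) q%:R^-1 ^+ 2 * E)); first exact: ler_sum.
rewrite sumr_const_nat subn0 -[_ *+ _]mulr_natl natrX mulrA -exprMn divff ?gt_eqF//.
by rewrite expr1n mul1r.
Qed.

Lemma twirl_step k : exists2 E : R, 0 <= E & forall b (q : nat),
  bounded_form b -> (0 < q)%N ->
  rnorm (\sum_(0 <= l < (q ^ 2)%N) \sum_(0 <= m < (q ^ 2)%N)
    (b (dk (grid q m l) k.+1) (dk (grid q m l) k.+1)
     - b (dk (grid q m l) k) (dk (grid q m l) k))) <= q%:R ^+ 3 * E.
Proof.
have i1 : rnorm ('i : C) = 1 by rewrite /rnorm normCi.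
have [E1 E10 hE1] := quadrature_step k rnorm1.
have [Ei Ei0 hEi] := quadrature_step k i1.
exists (8 + E1 + Ei) => [|b q bf q0]; first by rewrite !addr_ge0.
have qR0 : 0 < q%:R :> R by rewrite ltr0n.
have S1 := quadrature_grid bf rnorm1 q0 hE1 (gridSl q).
have Si := quadrature_grid (zz := fun m l => grid q l m) bf i1 q0 hEi (fun m l => gridSr q l m).
rewrite exchange_big /= in Si.
set s := Num.sqrt (k.+1%:R : R).
have s1 : 1 <= s by rewrite -sqrtr1 ler_wsqrtr// ler1n.
set S := \sum_(0 <= l < _) _; set S' := \sum_(0 <= l < _) _ in S1.
set S'' := \sum_(0 <= l < _) _ in Si.
(* Adding the two directions leaves only the diagonal difference; the factor 1/q is what turns the
   bound q^2 into q^3. *)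
have SE : (q%:R^-1)%:C * (4 * s%:C) * S = S' + S''.
  rewrite /S /S' /S'' -big_split mulr_sumr; apply: eq_bigr => l _ /=.
  rewrite -big_split mulr_sumr; apply: eq_bigr => m _ /=.
  by rewrite -mulrDr quadrature_slope_sum// -mulrA.
have : rnorm ((q%:R^-1)%:C * (4 * s%:C) * S) <= q%:R ^+ 2 * (8 + E1 + Ei).
  rewrite SE; apply: (le_trans (rnormD _ _)).
  by apply: (le_trans (lerD S1 Si)); rewrite -mulrDr ler_wpM2l ?exprn_ge0//; lra.
rewrite !rnormM rnorm_nat !rnormR !ger0_norm ?invr_ge0 ?(ltW qR0) ?(le_trans ler01)//.
move=> h; rewrite exprS -mulrA -ler_pdivrMl//; apply: le_trans h.
rewrite -mulrA ler_wpM2l ?invr_ge0 ?(ltW qR0)// -[leLHS]mul1r ler_wpM2r ?rnorm_ge0//.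
by move: s1; lra.
Qed.

(* Twirling over a grid of mesh [1/q] filling a square of side [q] makes the
   number states indistinguishable, uniformly over all measurements. *)
Lemma twirl k : exists2 E : R, 0 <= E & forall b (q : nat),
  bounded_form b -> (0 < q)%N ->
  rnorm (\sum_(0 <= l < (q ^ 2)%N) \sum_(0 <= m < (q ^ 2)%N)
    (b (dk (grid q m l) k) (dk (grid q m l) k)
     - b (dk (grid q m l) 0) (dk (grid q m l) 0))) <= q%:R ^+ 3 * E.
Proof.
elim: k => [|k [E E0 hE]].
  exists 0 => // b q bf q0; rewrite mulr0 big1 ?rnorm0// => l _.
  by rewrite big1// => m _; rewrite subrr.
have [E' E'0 hE'] := twirl_step k.
exists (E' + E) => [|b q bf q0]; first exact: addr_ge0.
rewrite mulrDr; apply: le_trans (lerD (hE' b q bf q0) (hE b q bf q0)).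
apply: le_trans (rnormD _ _); rewrite -big_split le_eqVlt; apply/orP; left; apply/eqP.
congr rnorm; apply: eq_bigr => l _ /=; rewrite -big_split; apply: eq_bigr => m _ /=.
by rewrite addrA subrK.
Qed.

End twirl.

(** * Rotations of the modes *)

Section multimode_forms.
Context {C : numClosedFieldType} {n : nat}.
Local Notation P := (mpoly n C).
Local Notation XX m := (mpolyX C m).
Local Notation X_ i := (mpolyX C (mnm1 i)).
Implicit Types (p q r : P) (m : multinom n).

Definition sesquilinear_form (K : P -> P -> C) : Prop :=
  (forall p, scalar (K p)) /\
  (forall r a p q, K (a *: p + q) r = a^* * K p r + K q r).

Section sesquilinear_theory.
Context (K : P -> P -> C) (K_sesq : sesquilinear_form K).

Lemma sesqDr p q r : K p (q + r) = K p q + K p r.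
Proof. by case: K_sesq => h _; exact: (@linD _ P C^o _ (h p)). Qed.

Lemma sesqZr p a q : K p (a *: q) = a * K p q.
Proof. by case: K_sesq => h _; exact: (@linZ _ P C^o _ (h p)). Qed.

Lemma sesq0r p : K p 0 = 0.
Proof. by case: K_sesq => h _; exact: (@lin0 _ P C^o _ (h p)). Qed.

Lemma sesq_sumr p I (s : seq I) (F : I -> P) :
  K p (\sum_(i <- s) F i) = \sum_(i <- s) K p (F i).
Proof. exact: (big_morph _ (sesqDr p) (sesq0r p)). Qed.

Lemma sesqDl p q r : K (p + q) r = K p r + K q r.
Proof. by case: K_sesq => _ h; rewrite -{1}[p]scale1r h conjC1 mul1r. Qed.

Lemma sesq0l r : K 0 r = 0.
Proof. by apply: (addrI (K 0 r)); rewrite -sesqDl !addr0. Qed.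

Lemma sesqZl a p r : K (a *: p) r = a^* * K p r.
Proof. by case: K_sesq => _ h; rewrite -[a *: p]addr0 h sesq0l addr0. Qed.

Lemma sesq_suml r I (s : seq I) (F : I -> P) :
  K (\sum_(i <- s) F i) r = \sum_(i <- s) K (F i) r.
Proof. exact: (big_morph (K^~ r) (fun p q => sesqDl p q r) (sesq0l r)). Qed.

End sesquilinear_theory.

Lemma sesquilinear_ext K K' : sesquilinear_form K -> sesquilinear_form K' ->
  (forall m m', K (XX m) (XX m') = K' (XX m) (XX m')) -> forall p q, K p q = K' p q.
Proof.
move=> Ks Ks' KK' p q; elim/mpolyind: p => [|a m p _ _ IHp].
  by rewrite (sesq0l Ks) (sesq0l Ks').
rewrite (sesqDl Ks) (sesqDl Ks') (sesqZl Ks) (sesqZl Ks') IHp; congr (_ * _ + _).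
elim/mpolyind: q {IHp} => [|b m' q _ _ IHq].
  by rewrite (sesq0r Ks) (sesq0r Ks').
by rewrite (sesqDr Ks) (sesqDr Ks') (sesqZr Ks) (sesqZr Ks') IHq KK'.
Qed.

(* [K p q] stands for [<p, D(zeta) q>] in the Bargmann representation. *)
Definition displacement_form (zeta : 'I_n -> C) (K : P -> P -> C) : Prop :=
  [/\ sesquilinear_form K,
      forall i p q, K (X_ i * p) q = K p (mderiv i q) + zeta i * K p q &
      forall i q, K 1 (X_ i * q) = - (zeta i)^* * K 1 q].

Lemma mpolyXS m i : XX (mnm_add (mnm1 i) m) = X_ i * XX m.
Proof. exact: mpolyXD. Qed.

Lemma multinom_ind (Q : multinom n -> Prop) :
  Q mnm0 -> (forall m i, Q m -> Q (mnm_add (mnm1 i) m)) -> forall m, Q m.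
Proof.
move=> Q0 QS m; have [d] := ubnP (mdeg m); elim: d m => // d IHd m md.
have [/eqP|] := posnP (mdeg m); first by rewrite mdeg_eq0 => /eqP->.
rewrite lt0n mdegE sum_nat_eq0 negb_forall => /existsP[i /= mi].
have -> : m = mnm_add (mnm1 i) (mnm_sub m (mnm1 i)).
  by rewrite addmC submK// lep1mP.
apply: QS; apply: IHd; rewrite -ltnS in md *.
have : mdeg m = mdeg (mnm_add (mnm1 i) (mnm_sub m (mnm1 i))).
  by rewrite addmC submK// lep1mP.
by rewrite mdegD mdeg1; lia.
Qed.

(** The multimode counterpart of [displacement_recursion_uniq]: products of one-mode solutions
    satisfy the same relations, which determine the form from its value at (1, 1). *)
Lemma displacement_form_monomials (zeta : 'I_n -> C) K (d : 'I_n -> nat -> nat -> C) :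
  displacement_form zeta K -> (forall i, displacement_recursion (zeta i) (d i)) ->
  forall m m', K (XX m) (XX m') * \prod_i d i 0 0 = K 1 1 * \prod_i d i (m i) (m' i).
Proof.
move=> [Ks K1 K2] dr; elim/multinom_ind => [|m i IHm] m'.
- rewrite mpolyX0; elim/multinom_ind: m' => [|m' i IHm'].
    by rewrite mpolyX0; congr (_ * _); apply: eq_bigr => i _; rewrite !mnm0E.
  rewrite mpolyXS K2 -mulrA IHm' mulrCA; congr (_ * _).
  rewrite (bigD1 i)//= [RHS](bigD1 i)//= mulrA; congr (_ * _); last first.
    by apply: eq_bigr => j ji; rewrite mnmDE mnm1E eq_sym (negPf ji).
  by have [_ h] := dr i; rewrite mnmDE mnm1E eqxx add1n mnm0E h.
- rewrite mpolyXS K1 mderivX (sesqZr Ks) mulrDl -!mulrA !IHm.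
  rewrite (bigD1 i)//= [X in _ + _ * (_ * X)](bigD1 i)//= [RHS](mulrC (K 1 1)) [X in X * K 1 1](bigD1 i)//=.
  have -> : \prod_(j | j != i) d j (m j) (mnm_sub m' (mnm1 i) j) =
      \prod_(j | j != i) d j (m j) (m' j).
    by apply: eq_bigr => j ji; rewrite mnmBE mnm1E eq_sym (negPf ji) subn0.
  have -> : \prod_(j | j != i) d j (mnm_add (mnm1 i) m j) (m' j) =
      \prod_(j | j != i) d j (m j) (m' j).
    by apply: eq_bigr => j ji; rewrite mnmDE mnm1E eq_sym (negPf ji) add0n.
  rewrite mnmDE mnmBE mnm1E eqxx add1n subn1; have [h _] := dr i; rewrite h.
  by move: (\prod_(_ | _) _) => t; ring.
Qed.

Lemma displacement_form_of_monomials (zeta : 'I_n -> C) K (d : 'I_n -> nat -> nat -> C) :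
  sesquilinear_form K -> (forall i, displacement_recursion (zeta i) (d i)) ->
  (forall m m', K (XX m) (XX m') = \prod_i d i (m i) (m' i)) -> displacement_form zeta K.
Proof.
move=> Ks dr hK; split=> // [i p q|i q].
- pose K1 p q := K (X_ i * p) q.
  pose K2 p q := K p (mderiv i q) + zeta i * K p q.
  suff : K1 p q = K2 p q by [].
  apply: sesquilinear_ext.
  + by split=> [r a s t|r a s t]; rewrite /K1 ?mulrDr -?scalerAr
      ?(sesqDr Ks, sesqZr Ks, sesqDl Ks, sesqZl Ks).
  + split=> [r a s t|r a s t]; rewrite /K2 ?mderivD ?mderivZ
      ?(sesqDr Ks, sesqZr Ks, sesqDl Ks, sesqZl Ks) /=; by ring.
  + move=> m m'; rewrite /K1 /K2 -mpolyXS mderivX (sesqZr Ks) !hK.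
    rewrite (bigD1 i)//= [X in _ = _ * X + _](bigD1 i)//= [X in _ = _ + _ * X](bigD1 i)//=.
    have -> : \prod_(j | j != i) d j (m j) (mnm_sub m' (mnm1 i) j) =
        \prod_(j | j != i) d j (m j) (m' j).
      by apply: eq_bigr => j ji; rewrite mnmBE mnm1E eq_sym (negPf ji) subn0.
    have -> : \prod_(j | j != i) d j (mnm_add (mnm1 i) m j) (m' j) =
        \prod_(j | j != i) d j (m j) (m' j).
      by apply: eq_bigr => j ji; rewrite mnmDE mnm1E eq_sym (negPf ji) add0n.
    rewrite mnmDE mnmBE mnm1E eqxx add1n subn1; have [h _] := dr i; rewrite h.
    by move: (\prod_(_ | _) _) => t; ring.
- elim/mpolyind: q => [|a m q _ _ IHq]; first by rewrite mulr0 (sesq0r Ks) mulr0.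
  rewrite mulrDr -scalerAr !(sesqDr Ks) !(sesqZr Ks) IHq mulrDr; congr (_ + _).
  rewrite mulrCA; congr (_ * _); rewrite -mpolyX0 -mpolyXS !hK.
  rewrite (bigD1 i)//= [in RHS](bigD1 i)//= mulrA; congr (_ * _); last first.
    by apply: eq_bigr => j ji; rewrite mnmDE mnm1E eq_sym (negPf ji).
  have [_ h] := dr i; by rewrite mnmDE mnm1E eqxx add1n mnm0E h.
Qed.

End multimode_forms.

Section mode_rotation.
Context {C : numClosedFieldType} {n : nat} (u : 'I_n -> 'I_n -> C).
Hypotheses (u_real : forall i j, (u i j)^* = u i j) (u_sym : forall i j, u i j = u j i).
Hypothesis u_unitary : forall i j, \sum_k u i k * u k j = (i == j)%:R.
Local Notation P := (mpoly n C).
Local Notation XX m := (mpolyX C m).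
Local Notation X_ i := (mpolyX C (mnm1 i)).
Implicit Types (p q r : P) (m : multinom n).

Definition rotated_var (j : 'I_n) : P := \sum_i u j i *: X_ i.

(** On Bargmann polynomials the second quantisation of [u] is a linear change of variables. *)
Definition rotate (p : P) : P := comp_mpoly [tuple rotated_var j | j < n] p.

Lemma rotateD p q : rotate (p + q) = rotate p + rotate q. Proof. exact: comp_mpolyD. Qed.
Lemma rotateZ a p : rotate (a *: p) = a *: rotate p. Proof. exact: comp_mpolyZ. Qed.
Lemma rotate0 : rotate 0 = 0. Proof. exact: comp_mpoly0. Qed.
Lemma rotate1 : rotate 1 = 1. Proof. exact: comp_mpoly1. Qed.
Lemma rotateM p q : rotate (p * q) = rotate p * rotate q.
Proof. exact: (rmorphM (comp_mpoly _)). Qed.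

Lemma rotate_sum I (s : seq I) (F : I -> P) :
  rotate (\sum_(i <- s) F i) = \sum_(i <- s) rotate (F i).
Proof. exact: (big_morph _ rotateD rotate0). Qed.

Lemma rotateXi j : rotate (X_ j) = rotated_var j.
Proof. by rewrite /rotate comp_mpolyXU -tnth_nth tnth_mktuple. Qed.

Lemma rotateX m : rotate (XX m) = \prod_j rotated_var j ^+ m j.
Proof.
rewrite /rotate comp_mpolyX; apply: eq_bigr => j _.
by rewrite tnth_mktuple.
Qed.

Definition rotated_deriv (j : 'I_n) (q : P) : P := \sum_i u j i *: mderiv i q.

Lemma rotated_derivD j p q : rotated_deriv j (p + q) = rotated_deriv j p + rotated_deriv j q.
Proof.
by rewrite /rotated_deriv -big_split; apply: eq_bigr => i _; rewrite mderivD scalerDr.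
Qed.

Lemma rotated_derivZ j a p : rotated_deriv j (a *: p) = a *: rotated_deriv j p.
Proof.
rewrite /rotated_deriv scaler_sumr; apply: eq_bigr => i _.
by rewrite mderivZ !scalerA mulrC.
Qed.

Lemma rotated_derivM j p q :
  rotated_deriv j (p * q) = rotated_deriv j p * q + p * rotated_deriv j q.
Proof.
rewrite /rotated_deriv mulr_suml mulr_sumr -big_split; apply: eq_bigr => i _ /=.
by rewrite mderivM scalerDr scalerAl scalerAr.
Qed.

Lemma mderivXi i j : mderiv i (X_ j) = (i == j)%:R :> P.
Proof.
rewrite mderivX mnm1E eq_sym; have [->|_] := eqVneq i j; last by rewrite scale0r.
rewrite scale1r (_ : mnm_sub _ _ = mnm0) ?mpolyX0//.
by apply/mnmP => k; rewrite mnmBE mnm0E subnn.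
Qed.

Lemma rotated_deriv_var j k : rotated_deriv j (rotated_var k) = (j == k)%:R.
Proof.
rewrite /rotated_deriv; under eq_bigr => i _.
  rewrite /rotated_var (big_morph (mderiv i) (mderivD i) (mderiv0 _ i)).
  rewrite (bigD1 i)//= mderivZ mderivXi eqxx big1 ?addr0; last first.
    by move=> l li; rewrite mderivZ mderivXi eq_sym (negPf li) scaler0.
  rewrite scalerA; over.
rewrite -scaler_suml (eq_bigr (fun i => u j i * u i k)) => [|i _]; last by rewrite (u_sym k).
by rewrite u_unitary scaler_nat.
Qed.

(** The chain rule: both sides obey the Leibniz rule, so it is enough to compare them on the
    variables, where [u] is its own inverse. *)
Lemma rotated_deriv_rotate j q : rotated_deriv j (rotate q) = rotate (mderiv j q).
Proof.
have h1 : rotated_deriv j (rotate 1) = rotate (mderiv j 1).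
  rewrite rotate1 -mpolyC1 mderivC rotate0 /rotated_deriv big1// => i _.
  by rewrite mderivC scaler0.
have hM p r : rotated_deriv j (rotate p) = rotate (mderiv j p) ->
    rotated_deriv j (rotate r) = rotate (mderiv j r) ->
    rotated_deriv j (rotate (p * r)) = rotate (mderiv j (p * r)).
  by move=> hp hr; rewrite rotateM rotated_derivM mderivM rotateD !rotateM hp hr.
elim/mpolyind: q => [|a m p _ _ IHp].
  by rewrite -(scale0r 1) rotateZ rotated_derivZ mderivZ rotateZ h1.
rewrite rotateD rotateZ rotated_derivD rotated_derivZ IHp mderivD mderivZ.
rewrite rotateD rotateZ; congr (_ *: _ + _); elim/(@multinom_ind n): m {IHp} => [|m i IHm].
  by rewrite mpolyX0.
rewrite mpolyXS; apply: hM => //.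
rewrite rotateXi rotated_deriv_var mderivXi.
by case: (j == i); rewrite ?rotate1 ?rotate0.
Qed.

(** Displacement vectors rotate with the variables. Realness of [u] makes its coefficients leave the
    antilinear argument unchanged. *)
Lemma displacement_form_rotate (zeta : 'I_n -> C) K : displacement_form zeta K ->
  displacement_form (fun j => \sum_i u j i * zeta i) (fun p q => K (rotate p) (rotate q)).
Proof.
move=> [Ks K1 K2]; split=> [|j p q|j q].
- by split=> [p a q r|r a p q]; rewrite rotateD rotateZ
    ?(sesqDr Ks) ?(sesqZr Ks) ?(sesqDl Ks) ?(sesqZl Ks).
- rewrite /= rotateM rotateXi /rotated_var mulr_suml (sesq_suml Ks) -rotated_deriv_rotate.
  rewrite (sesq_sumr Ks) mulr_suml -big_split; apply: eq_bigr => i _ /=.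
  by rewrite -scalerAl (sesqZl Ks) (sesqZr Ks) K1 u_real; ring.
- rewrite /= rotate1 rotateM rotateXi /rotated_var mulr_suml (sesq_sumr Ks).
  rewrite rmorph_sum -sumrN mulr_suml; apply: eq_bigr => i _ /=.
  by rewrite -scalerAl (sesqZr Ks) K2 rmorphM /= u_real; ring.
Qed.

Lemma rotate_rotate p : rotate (rotate p) = p.
Proof.
elim/mpolyind: p => [|a m p _ _ IHp]; first by rewrite !rotate0.
rewrite !(rotateD, rotateZ) IHp; congr (_ *: _ + _).
elim/(@multinom_ind n): m {IHp} => [|m i IHm]; first by rewrite mpolyX0 !rotate1.
rewrite mpolyXS !rotateM IHm; congr (_ * _); rewrite rotateXi.
rewrite /rotated_var rotate_sum.
under eq_bigr => j _ do rewrite rotateZ rotateXi /rotated_var scaler_sumr.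
rewrite exchange_big (bigD1 i)//= [X in _ + X]big1 => [|k ki].
  under eq_bigr => j _ do rewrite scalerA.
  by rewrite -scaler_suml u_unitary eqxx scale1r addr0.
under eq_bigr => j _ do rewrite scalerA.
by rewrite -scaler_suml u_unitary eq_sym (negPf ki) scale0r.
Qed.

(** Linear substitutions preserve the degree, so the rotation commutes with the total photon number;
    this is why it fixes thermal powers. *)
Lemma rotateX_supp m m' : m' \in msupp (rotate (XX m)) -> mdeg m' = mdeg m.
Proof.
suff /dhomogP h : rotate (XX m) \is ishomog1 (mdeg m) (@mdeg n) by move=> /h.
rewrite rotateX mdegE; apply: (big_ind2 (fun p d => p \is ishomog1 d (@mdeg n))) => //.
- exact: dhomog1.
- by move=> p d q e hp hq; exact: dhomogM.
- move=> j _; rewrite -[X in ishomog1 X]mul1n; apply: dhomogMn.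
  by rewrite /rotated_var rpred_sum// => i _; rewrite rpredZ// dhomogX; apply/eqP; exact: mdeg1.
Qed.

End mode_rotation.

Section householder.
Context {C : numClosedFieldType} {n : nat} (s : C).
Hypotheses (s_real : s^* = s) (s_sqr : n.+1%:R * s ^+ 2 = 1) (s_neq1 : s != 1).

(* The reflection exchanging the first basis vector and (s, ..., s). *)
Definition householder (i j : 'I_n.+1) : C :=
  (i == j)%:R - ((i == ord0)%:R - s) * ((j == ord0)%:R - s) / (1 - s).

Let s1 : 1 - s != 0. Proof. by rewrite subr_eq0 eq_sym. Qed.

Lemma householder_real i j : (householder i j)^* = householder i j.
Proof.
by rewrite /householder !(rmorphB, rmorphM, fmorphV, rmorph1, rmorph_nat, rmorph_nat) /= s_real.
Qed.

Lemma householder_sym i j : householder i j = householder j i.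
Proof. by rewrite /householder eq_sym mulrAC [_ / _ * _]mulrAC; congr (_ - _); ring. Qed.

Lemma sum_householder_vec : \sum_(i < n.+1) ((i == ord0)%:R - s) = 1 - n.+1%:R * s.
Proof.
rewrite sumrB (bigD1 ord0)//= big1 ?addr0 => [|i /negPf->//].
by rewrite sumr_const card_ord mulr_natl.
Qed.

(** The squared length 2(1 - s) identifies [householder] as the identity minus twice the projection
    onto this vector. *)
Lemma sum_householder_vec_sqr : \sum_(i < n.+1) ((i == ord0)%:R - s) ^+ 2 = 2 * (1 - s).
Proof.
under eq_bigr => i _.
  rewrite (_ : _ ^+ 2 = (i == ord0)%:R * (1 - 2 * s) + s ^+ 2); first over.
  by case: (i == ord0); rewrite /= ?mulr1n ?mulr0n; ring.
rewrite big_split /= -mulr_suml (bigD1 ord0)//= big1 ?addr0 => [|i /negPf->//].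
by rewrite sumr_const card_ord -[s ^+ 2 *+ _]mulr_natl s_sqr; ring.
Qed.

Lemma householder_unitary i j : \sum_k householder i k * householder k j = (i == j)%:R.
Proof.
pose v (i : 'I_n.+1) := (i == ord0)%:R - s : C.
have -> : \sum_k householder i k * householder k j =
  \sum_k ((i == k)%:R * (k == j)%:R) - \sum_k ((i == k)%:R * (v k * v j / (1 - s)))
  - \sum_k ((k == j)%:R * (v i * v k / (1 - s))) + v i * v j / (1 - s) ^+ 2 * \sum_k v k ^+ 2.
  rewrite mulr_sumr -!sumrB -big_split; apply: eq_bigr => k _ /=.
  by rewrite /householder -!/(v _); field.
have dl (f : 'I_n.+1 -> C) : \sum_k (i == k)%:R * f k = f i.
  rewrite (bigD1 i)//= eqxx mul1r big1 ?addr0// => k /negPf.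
  by rewrite eq_sym => ->; rewrite mul0r.
have dr (f : 'I_n.+1 -> C) : \sum_k (k == j)%:R * f k = f j.
  by rewrite (bigD1 j)//= eqxx mul1r big1 ?addr0// => k /negPf ->; rewrite mul0r.
by rewrite sum_householder_vec_sqr !dl dr; field.
Qed.

(** Row sums are the action on the constant vector (z, ..., z): a displacement common to all modes
    goes entirely to mode 0, with factor n s = sqrt n. *)
Lemma householder_row0 : \sum_k householder ord0 k = n.+1%:R * s.
Proof.
rewrite sumrB -mulr_suml -mulr_sumr sum_householder_vec.
rewrite (bigD1 ord0)//= big1 ?addr0 => [|k /negPf]; last by rewrite eq_sym => ->.
by field.
Qed.

Lemma householder_row j : j != ord0 -> \sum_k householder j k = 0.
Proof.
move=> /negPf j0; rewrite sumrB -mulr_suml -mulr_sumr sum_householder_vec j0.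
rewrite (bigD1 j)//= eqxx big1 ?addr0 => [|k /negPf]; last by rewrite eq_sym => ->.
apply: (mulIf s1); rewrite mul0r mulrBl divfK// mul1r.
rewrite (_ : 1 - s - _ = 1 - n.+1%:R * s ^+ 2); last by ring.
by rewrite s_sqr subrr.
Qed.

End householder.

(** Orthonormal families and series are indexed by [nat], so occupation patterns have to be
    enumerated. *)
Lemma multinom_enumeration d : exists enc : nat -> multinom d.+1, bijective enc.
Proof.
have : ([set: multinom d.+1] #= [set: nat])%card.
  apply: eq_card_nat; first exact: countableP.
  move=> /(finite_image (fun m : multinom d.+1 => m ord0)); apply: contra_not infinite_nat.
  apply: sub_finite_set => k _; exists (Multinom [tuple k | _ < d.+1]) => //.
  by rewrite multinomE tnth_mktuple.
move=> /card_set_bijP[f]; rewrite setTT_bijective => f_bij.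
by have [g fK gK] := f_bij; exists g; exists f.
Qed.

(** * Number bases of a tensor power *)

Section tensor_modes.
Context {R : realType} {H Hn : hilbertType R} {n : nat}.
Variable tens : ('I_n -> H) -> Hn.
Hypothesis tensP : is_tensor_power tens.
Local Notation C := R[i].

Lemma tens_linear u i : linear (fun x => tens (subst_at u i x)).
Proof. by case: tensP. Qed.

Lemma braket_tens u v : ⟨tens u, tens v⟩ = \prod_i ⟨u i, v i⟩.
Proof. by case: tensP. Qed.

Lemma rnorm_tens u : rnorm (tens u) = \prod_i rnorm (u i).
Proof.
apply/eqP; rewrite -(@eqrXn2 _ 2) ?rnorm_ge0 ?prodr_ge0// => [|i _]; last exact: rnorm_ge0.
apply/eqP/complexI; rewrite -braket_norm braket_tens -prodrXl rmorph_prod.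
by apply: eq_bigr => i _; rewrite braket_norm.
Qed.

Definition modes (e : nat -> H) (m : multinom n) : Hn := tens (fun i => e (m i)).

Lemma modes_orthonormal e m m' : orthonormal_seq e ->
  ⟨modes e m, modes e m'⟩ = (m == m')%:R.
Proof.
move=> e_on; rewrite braket_tens; have [->|mm'] := eqVneq m m'.
  by rewrite big1// => i _; rewrite e_on eqxx.
have [i mi] : exists i, m i != m' i.
  apply/existsP; rewrite -negb_forall; apply: contraNN mm' => /forallP h.
  by apply/eqP/mnmP => i; apply/eqP.
by rewrite (bigD1 i)//= e_on (negPf mi) mul0r.
Qed.

Lemma modes_total e v : orthonormal_seq e -> total_seq e ->
  (forall m, ⟨modes e m, v⟩ = 0) -> v = 0.
Proof.
move=> e_on e_tot hv; have [_ _ dense] := tensP.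
apply: (dense_span_orthogonal dense) => _ [u _ <-].
(* Slots below k hold arbitrary vectors, the others basis vectors; slot k is freed by linearity and
   continuity in that slot. *)
suff h k : forall u, (forall i : 'I_n, (k <= i)%N -> exists a, u i = e a) -> ⟨tens u, v⟩ = 0.
  by apply: (h n) => i; rewrite leqNgt ltn_ord.
elim: k => [|k IHk] {}u hu.
  have [a ha] : exists a : 'I_n -> nat, forall i, u i = e (a i).
    by have [a ha] := boolp.choice (fun i => hu i (leq0n i)); exists a.
  have := hv (Multinom [tuple a i | i < n]); rewrite /modes.
  rewrite (_ : (fun i => _) = u)//.
  by apply/funext => i; rewrite ha multinomE tnth_mktuple.
have [kn|nk] := ltnP k n; last first.
  by apply: IHk => i ki; apply: hu; have := ltn_ord i; lia.
pose i0 := Ordinal kn.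
pose S x : C^o := ⟨v, tens (subst_at u i0 x)⟩.
have S_lin : linear S.
  by move=> a x y; rewrite /S (tens_linear u i0) braketDr braketZr.
have S_cont : continuous S.
  apply: (@linear_rnorm_continuous _ _ _ _ (rnorm v * \prod_(i | i != i0) rnorm (u i))) => // x.
  apply: (le_trans (rnorm_braket _ _)); rewrite -mulrA ler_wpM2l ?rnorm_ge0//.
  rewrite rnorm_tens (bigD1 i0)//= /subst_at eqxx mulrC le_eqVlt; apply/orP; left.
  by apply/eqP; congr (_ * _); apply: eq_bigr => j /negPf ->.
have S0 : S = (fun=> 0).
  apply: (@continuous_ext_basis R H C^o e S (fun=> 0) e_on e_tot S_lin S_cont).

  - by move=> a x y; rewrite scaler0 addr0.
  - exact: cst_continuous.
  - move=> a; rewrite /S -braket_conj IHk ?conjC0// => j kj.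
    rewrite /subst_at; case: eqVneq => [_|ji]; first by exists a.
    apply: hu; rewrite ltn_neqAle kj andbT; apply: contraNN ji => /eqP kE.
    by apply/eqP/val_inj.
have := congr1 (fun f => f (u i0)) S0; rewrite /S /= => h.
rewrite -braket_conj -[X in tens X](_ : subst_at u i0 (u i0) = u) ?h ?conjC0//.
by apply/funext => j; rewrite /subst_at; case: eqVneq => [->|].
Qed.

Definition mfact (m : multinom n) : C := \prod_i (sqfact (m i))%:C.

Lemma mfact_neq0 m : mfact m != 0.
Proof. by apply/prodf_neq0 => i _; exact: sqfactC_neq0. Qed.

Lemma mfact_conj m : (mfact m)^* = mfact m.
Proof.
by rewrite rmorph_prod; apply: eq_bigr => i _ /=; rewrite conj_Creal// realC_real.
Qed.

Lemma mfactV_conj m : ((mfact m)^-1)^* = (mfact m)^-1.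
Proof.
rewrite -[LHS]mul1r -(mulVf (mfact_neq0 m)) -{2}mfact_conj -mulrA -rmorphM.
by rewrite mulfV ?mfact_neq0// rmorph1 mulr1.
Qed.

Local Notation P := (mpoly n C).
Implicit Types (p q : P).

(** The multimode Bargmann map. The family [h] is left free so that the same polynomials describe
    displaced modes. *)
Definition poly_vector (h : multinom n -> Hn) p : Hn :=
  \sum_(m <- msupp p) (mcoeff m p * mfact m) *: h m.

Lemma poly_vectorE h p (r : seq (multinom n)) : uniq r -> {subset msupp p <= r} ->
  poly_vector h p = \sum_(m <- r) (mcoeff m p * mfact m) *: h m.
Proof.
move=> r_uniq pr; rewrite (bigID (fun m => m \in msupp p))/= [X in _ = _ + X]big1.
  rewrite addr0 -big_filter; apply: perm_big; apply: uniq_perm; rewrite ?filter_uniq ?msupp_uniq//.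
  move=> m; rewrite mem_filter andbC; case: (boolP (m \in msupp p)) => [/pr->//|_].
  by rewrite andbF.
by move=> m /memN_msupp_eq0 ->; rewrite mul0r scale0r.
Qed.

Lemma poly_vector_linear h : linear (poly_vector h).
Proof.
move=> a p q; pose r := undup (msupp (a *: p + q) ++ msupp p ++ msupp q).
have r_uniq : uniq r by exact: undup_uniq.
rewrite !(poly_vectorE h r_uniq).
- rewrite scaler_sumr -big_split; apply: eq_bigr => m _ /=.
  by rewrite mcoeffD mcoeffZ scalerA -scalerDl; congr (_ *: _); ring.
- by move=> m mp; rewrite mem_undup !mem_cat mp !orbT.
- by move=> m mp; rewrite mem_undup !mem_cat mp !orbT.
- by move=> m mp; rewrite mem_undup !mem_cat mp.
Qed.

Lemma poly_vectorX h m : poly_vector h (mpolyX C m) = mfact m *: h m.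
Proof. by rewrite /poly_vector msuppX big_seq1 mcoeffX eqxx mul1r. Qed.

Lemma poly_vector_form h h' :
  sesquilinear_form (fun p q => ⟨poly_vector h p, poly_vector h' q⟩).
Proof.
split=> [p a q r|r a p q]; rewrite (poly_vector_linear h' _ _ _, poly_vector_linear h _ _ _).
  by rewrite braketDr braketZr.
by rewrite braketDl braketZl.
Qed.

Lemma modes_form (e e' : nat -> H) (zeta : C) :
  displacement_recursion zeta
    (fun j k => (sqfact j)%:C * (sqfact k)%:C * ⟨e j, e' k⟩) ->
  displacement_form (fun _ => zeta)
    (fun p q => ⟨poly_vector (modes e) p, poly_vector (modes e') q⟩).
Proof.
move=> de_rec; apply: displacement_form_of_monomials => [||m m'].
- exact: poly_vector_form.
- by move=> i; exact: de_rec.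
- rewrite !poly_vectorX braketZl braketZr mfact_conj braket_tens /mfact.
  by rewrite -!big_split; apply: eq_bigr => i _ /=; rewrite mulrA.
Qed.

End tensor_modes.

Section rotated_modes.
Context {R : realType} {H Hn : hilbertType R} {d : nat}.
Local Notation n := d.+2.
Variable tens : ('I_n -> H) -> Hn.
Hypothesis tensP : is_tensor_power tens.
Local Notation C := R[i].

Definition inv_sqrt_modes : C := ((Num.sqrt n%:R)^-1)%:C.
Local Notation s := inv_sqrt_modes.

Lemma inv_sqrt_modes_real : s^* = s.
Proof. by rewrite conj_Creal// realC_real. Qed.

Lemma inv_sqrt_modes_sqr : n%:R * s ^+ 2 = 1.
Proof.
by rewrite -rmorphXn /= exprVn sqr_sqrtr ?ler0n// fmorphV rmorph_nat mulfV//.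
Qed.

(** At least two modes are needed here: the reflection divides by 1 - s. *)
Lemma inv_sqrt_modes_neq1 : s != 1.
Proof.
apply/eqP => s1; have := inv_sqrt_modes_sqr; rewrite s1 expr1n mulr1 => /eqP.
by rewrite -[1]/(1%:R) eqr_nat.
Qed.

Lemma inv_sqrt_modesV : n%:R * s = (Num.sqrt n%:R)%:C.
Proof.
have s0 : s != 0 by rewrite fmorph_eq0 invr_eq0 gt_eqF// sqrtr_gt0 ltr0n.
by apply: (mulIf s0); rewrite -mulrA -expr2 inv_sqrt_modes_sqr /s fmorphV divff// -invr_eq0 -fmorphV.
Qed.

Local Notation u := (householder s).
Let u_real := householder_real (n := d.+1) inv_sqrt_modes_real.
Let u_sym := householder_sym (n := d.+1) s.
Let u_unitary := householder_unitary inv_sqrt_modes_sqr inv_sqrt_modes_neq1.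

(** Number states of the rotated modes, the signal mode being [ord0]. With displaced number states
    for [e], the same formula gives their displaced versions. *)
Definition rotated_modes (e : nat -> H) (m : multinom n) : Hn :=
  (mfact m)^-1 *: poly_vector (modes tens e) (rotate u (mpolyX C m)).

Definition rotated_shift (z : C) (j : 'I_n) : C :=
  if j == ord0 then (Num.sqrt n%:R)%:C * z else 0.

Lemma rotated_shiftE z j : \sum_i u j i * z = rotated_shift z j.
Proof.
rewrite -mulr_suml /rotated_shift; case: eqVneq => [->|j0].
  by rewrite (householder_row0 inv_sqrt_modes_neq1) inv_sqrt_modesV.
by rewrite (householder_row inv_sqrt_modes_sqr inv_sqrt_modes_neq1 j0) mul0r.
Qed.

(** After rotation the displacement vector is (sqrt n zeta, 0, ..., 0), so the form factorises over
    the modes. Shift zero gives orthonormality; number states against displaced ones give the action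
    of the displacement. *)
Lemma rotated_modes_form (e e' : nat -> H) (zeta : C)
    (dd : 'I_n -> nat -> nat -> C) m m' :
  displacement_recursion zeta (fun j k => (sqfact j)%:C * (sqfact k)%:C * ⟨e j, e' k⟩) ->
  (forall j, displacement_recursion (rotated_shift zeta j) (dd j)) ->
  ⟨rotated_modes e m, rotated_modes e' m'⟩ * \prod_j dd j 0 0 =
  ⟨e 0, e' 0⟩ ^+ n * \prod_j (dd j (m j) (m' j) / ((sqfact (m j))%:C * (sqfact (m' j))%:C)).
Proof.
move=> e_rec dd_rec; have [y yE] : exists y, ⟨e 0, e' 0⟩ ^+ n = y by exists (⟨e 0, e' 0⟩ ^+ n).
rewrite yE.
have := displacement_form_rotate u_real u_sym u_unitary (modes_form tensP e_rec).
under [fun j => _]eq_fun do rewrite rotated_shiftE.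
move=> /displacement_form_monomials /(_ dd_rec m m') E.
rewrite braketZl braketZr mfactV_conj -!mulrA E rotate1 -mpolyX0 !poly_vectorX.
rewrite braketZl braketZr mfact_conj braket_tens//.
have mfact0 : mfact (@mnm0 n) = 1 :> C.
  by rewrite /mfact big1// => i _; rewrite mnm0E sqfact0.
have -> : \prod_(i < n) ⟨e (@mnm0 n i), e' (@mnm0 n i)⟩ = y.
  rewrite -yE -[X in _ ^+ X]card_ord -prodr_const; apply: eq_bigr => i _.
  by rewrite !mnm0E.
have -> : \prod_i dd i (m i) (m' i) = mfact m * mfact m' *
    \prod_j (dd j (m j) (m' j) / ((sqfact (m j))%:C * (sqfact (m' j))%:C)).
  rewrite -!big_split; apply: eq_bigr => i _ /=.
  by rewrite mulrCA mulfV ?mulr1// mulf_neq0// sqfactC_neq0.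
rewrite mfact0 !mul1r; move: (\prod_j _) => x {yE}.
move: (mfact m) (mfact m') (mfact_neq0 (R := R) m) (mfact_neq0 (R := R) m') => a b a0 b0.
by field; rewrite a0 b0.
Qed.

Lemma rotated_shift0 j : rotated_shift 0 j = 0.
Proof. by rewrite /rotated_shift mulr0 if_same. Qed.

Lemma rotated_modes_orthonormal e m m' : orthonormal_seq e ->
  ⟨rotated_modes e m, rotated_modes e m'⟩ = (m == m')%:R.
Proof.
move=> e_on.
have e_rec : displacement_recursion 0 (fun j k => (sqfact j)%:C * (sqfact k)%:C * ⟨e j, e k⟩).
  rewrite (_ : (fun j k => _) = fun j k => j`!%:R * (j == k)%:R); first exact: displacement_recursion0.
  apply/funext => j; apply/funext => k; rewrite e_on -(sqfactC_sqr j).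
  by have [->|] := eqVneq j k; rewrite ?mulr0.
have dd_rec (j : 'I_n) : displacement_recursion (rotated_shift 0 j)
    (fun j k => j`!%:R * (j == k)%:R : C).
  by rewrite rotated_shift0; exact: displacement_recursion0.
have := rotated_modes_form m m' e_rec dd_rec.
rewrite [X in _ * X = _](_ : _ = 1) ?mulr1 => [->|]; last first.
  by rewrite big1// => j _; rewrite fact0 mulr1.
rewrite e_on eqxx expr1n mul1r; have [->|mm'] := eqVneq m m'.
  rewrite big1// => i _; rewrite eqxx mulr1 -expr2 -sqfactC_sqr divff//.
  by rewrite expf_neq0// sqfactC_neq0.
have [i mi] : exists i, m i != m' i.
  apply/existsP; rewrite -negb_forall; apply: contraNN mm' => /forallP h.
  by apply/eqP/mnmP => i; apply/eqP.
by rewrite (bigD1 i)//= (negPf mi) mulr0 !mul0r.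
Qed.

Lemma poly_vector_supp (h : multinom n -> Hn) p (Q : Hn -> Prop) :
  Q 0 -> (forall a x y, Q x -> Q y -> Q (a *: x + y)) ->
  (forall m, m \in msupp p -> Q (h m)) -> Q (poly_vector h p).
Proof.
move=> Q0 QS; rewrite /poly_vector; elim: (msupp p : seq _) => [|m r IHr] hQ.
  by rewrite big_nil.
rewrite big_cons; apply: QS; first by apply: hQ; rewrite mem_head.
by apply: IHr => m' m'r; apply: hQ; rewrite inE m'r orbT.
Qed.

Lemma rotated_modes_total e v : orthonormal_seq e -> total_seq e ->
  (forall m, ⟨rotated_modes e m, v⟩ = 0) -> v = 0.
Proof.
move=> e_on e_tot hv; apply: (modes_total tensP e_on e_tot) => m.
have h m' : ⟨poly_vector (modes tens e) (rotate u (mpolyX C m')), v⟩ = 0.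
  have := hv m'; rewrite braketZl => /eqP; rewrite mulf_eq0 conjC_eq0 invr_eq0.
  by rewrite (negPf (mfact_neq0 _)) => /eqP.
have : ⟨poly_vector (modes tens e) (mpolyX C m), v⟩ = 0.
  rewrite -(rotate_rotate u_unitary (mpolyX C m)).
  elim/mpolyind: (rotate u (mpolyX C m)) => [|a m' p _ _ IHp].
    by rewrite rotate0 (lin0 (poly_vector_linear _)) braket0l.
  have -> : poly_vector (modes tens e) (rotate u (a *: mpolyX C m' + p)) =
      a *: poly_vector (modes tens e) (rotate u (mpolyX C m')) +
      poly_vector (modes tens e) (rotate u p).
    by rewrite rotateD rotateZ; exact: poly_vector_linear.
  rewrite (braketDl _ _ v) IHp addr0.
  rewrite (braketZl a _ v).
  by rewrite (h m') mulr0.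
rewrite poly_vectorX braketZl mfact_conj => /eqP.
by rewrite mulf_eq0 (negPf (mfact_neq0 _)) => /eqP.
Qed.

Lemma rotated_modes_eigen e m (S : Hn -> Hn) (w : nat -> C) : linear S ->
  (forall m, S (modes tens e m) = w (mdeg m) *: modes tens e m) ->
  S (rotated_modes e m) = w (mdeg m) *: rotated_modes e m.
Proof.
move=> S_lin hS; rewrite /rotated_modes (linZ S_lin) scalerA [w _ * _]mulrC -scalerA.
congr (_ *: _).
apply: (poly_vector_supp (Q := fun x => S x = w (mdeg m) *: x)).
- by rewrite (lin0 S_lin) scaler0.
- move=> a x y Sx Sy; rewrite (linD S_lin) (linZ S_lin) Sx Sy scalerDr !scalerA.
  by rewrite mulrC.
- by move=> m' /rotateX_supp <-; exact: hS.
Qed.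

Context (ket : nat -> H) (ket_on : orthonormal_seq ket) (ket_tot : total_seq ket).

Lemma rotated_modes_displacement z m m' :
  ⟨rotated_modes ket m, rotated_modes (displacement_ket ket z) m'⟩ =
  if [forall (j | j != ord0), m j == m' j]
  then ⟨ket (m ord0), displacement_ket ket ((Num.sqrt n%:R)%:C * z) (m' ord0)⟩ else 0.
Proof.
pose dd j := displacement_entry ket (rotated_shift z j).
have dd_rec (j : 'I_n) : displacement_recursion (rotated_shift z j) (dd j).
  exact: displacement_entry_rec.
have := rotated_modes_form m m' (displacement_entry_rec ket_on z) dd_rec.
(* Both sides are exp(-n |z|^2/2), so the vacuum factors cancel. *)
have -> : \prod_j dd j 0 0 = ⟨ket 0, displacement_ket ket z 0⟩ ^+ n.
  rewrite (bigD1 ord0)//= big1 => [|j /negPf j0]; rewrite /dd.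
    rewrite mulr1 braket_ket_displacement_ket sqfact0 mulr1 divr1.
    rewrite !displacement_entry00// -rmorphXn /= -expRM_natl /rotated_shift.
    rewrite rnormM rnormR ger0_norm ?sqrtr_ge0// exprMn sqr_sqrtr ?ler0n//.
    by congr (expR _)%:C; ring.
  rewrite displacement_entry00// /rotated_shift j0 rnorm0 expr0n /= mul0r oppr0.
  by rewrite expR0.
rewrite [LHS]mulrC => /mulfI -> //; last first.
  rewrite expf_neq0// braket_ket_displacement_ket mulf_neq0//.
    exact: displacement_entry00_neq0.
  by rewrite invr_eq0 mulf_neq0// sqfactC_neq0.
rewrite (bigD1 ord0)//= -braket_ket_displacement_ket /dd /rotated_shift eqxx.
have dz0 j k : displacement_entry ket 0 j k / ((sqfact j)%:C * (sqfact k)%:C) = (j == k)%:R.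
  have := displacement_recursion_uniq (displacement_entry_rec ket_on 0)
    displacement_recursion0 j k.
  rewrite displacement_entry00// rnorm0 expr0n /= mul0r oppr0 expR0 fact0 !mulr1.
  move=> ->; rewrite -(sqfactC_sqr j); have [->|_] := eqVneq j k.
    by rewrite mulr1 expr2 divff// mulf_neq0// sqfactC_neq0.
  by rewrite mulr0 mul0r.
case: ifPn => [/forall_inP h|].
  rewrite big1 ?mulr1// => j j0; rewrite (negPf j0) dz0.
  by rewrite h.
rewrite negb_forall => /existsP[j]; rewrite negb_imply => /andP[j0 mj].
by rewrite [X in _ * X](bigD1 j)//= (negPf j0) dz0 (negPf mj) mul0r mulr0.
Qed.

End rotated_modes.

(** * Thermal states *)

Section thermal_states.
Context {R : realType}.
Local Notation C := R[i].

Definition thermal_weight (N : R) (k : nat) : R := (N + 1)^-1 * (N / (N + 1)) ^+ k.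

Lemma thermal_ratio_ge0 (N : R) : 0 < N -> 0 <= N / (N + 1).
Proof. by move=> N0; rewrite divr_ge0// ?addr_ge0// ltW. Qed.

Lemma thermal_ratio_lt1 (N : R) : 0 < N -> N / (N + 1) < 1.
Proof. by move=> N0; rewrite ltr_pdivrMr ?mul1r ?ltrDl// addr_gt0. Qed.

Lemma thermal_weight_ge0 (N : R) k : 0 < N -> 0 <= thermal_weight N k.
Proof.
move=> N0; rewrite mulr_ge0// ?exprn_ge0 ?thermal_ratio_ge0//.
by rewrite invr_ge0 addr_ge0// ltW.
Qed.

Lemma thermal_weight_sum (N : R) n : 0 < N ->
  \sum_(0 <= k < n) thermal_weight N k = 1 - (N / (N + 1)) ^+ n.
Proof.
move=> N0; have N1 : N + 1 != 0 by rewrite gt_eqF// addr_gt0.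
elim: n => [|n IHn]; first by rewrite big_geq// expr0 subrr.
by rewrite big_nat_recr//= IHn /thermal_weight exprS; field.
Qed.

Lemma thermal_weight_sum_le1 (N : R) n : 0 < N ->
  \sum_(0 <= k < n) thermal_weight N k <= 1.
Proof.
by move=> N0; rewrite thermal_weight_sum// gerBl exprn_ge0// thermal_ratio_ge0.
Qed.

Lemma thermal_weight_le1 (N : R) k : 0 < N -> thermal_weight N k <= 1.
Proof.
move=> N0; apply: le_trans (thermal_weight_sum_le1 k.+1 N0).
by rewrite big_nat_recr//= lerDr sumr_ge0// => i _; exact: thermal_weight_ge0.
Qed.

Context {H : hilbertType R} (ket : nat -> H).
Hypotheses (ket_on : orthonormal_seq ket) (ket_tot : total_seq ket).
Local Notation dk := (displacement_ket ket).
Let dk_on := displacement_ket_orthonormal ket_on ket_tot.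

Lemma thermalE N v : thermal ket N v =
  multiplier ket ket (fun k => (thermal_weight N k)%:C) v.
Proof. by []. Qed.

Lemma braket_thermal N j v : 0 < N ->
  ⟨ket j, thermal ket N v⟩ = (thermal_weight N j)%:C * ⟨ket j, v⟩.
Proof.
move=> N0; rewrite thermalE (@braket_multiplier _ _ _ ket ket _ 1)// => k.
by rewrite rnormR ger0_norm ?thermal_weight_ge0// thermal_weight_le1.
Qed.

Lemma adjoint_displacement z v : adjoint (displacement ket z) v = displacement ket (- z) v.
Proof.
have one_le (k : nat) : rnorm (1 : C) <= 1 by rewrite rnorm1.
have adj u : ⟨displacement ket (- z) v, u⟩ = ⟨v, displacement ket z u⟩.
  rewrite [displacement ket z]displacementE.
  have h := cvg_braket_multiplier ket_on (dk_on z) one_le v u.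
  apply: (@cvg_uniq _ C^o _ _ _ _ h).
  apply: cvg_ext (parseval_braket (displacement ket (- z) v) u ket_on ket_tot) => n.
  rewrite /series /=; apply: eq_bigr => k _.
  by rewrite mul1r -braket_conj braket_displacement// opprK braket_conj.
apply: xget_unique => // w hw; apply/eqP; rewrite -subr_eq0.
set x := w - _; have : ⟨x, x⟩ = 0 by rewrite {1}/x braketBl hw adj subrr.
rewrite braket_norm => /(@complexI _ _ 0)/eqP.
by rewrite expf_eq0 rnorm_eq0.
Qed.

Lemma braket_displaced_thermal z N j v : 0 < N ->
  ⟨dk z j, displaced_thermal ket z N v⟩ = (thermal_weight N j)%:C * ⟨dk z j, v⟩.
Proof.
move=> N0; rewrite /displaced_thermal /= braket_dk_displacement// braket_thermal//.
by rewrite adjoint_displacement braket_displacement// opprK.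
Qed.

End thermal_states.

Section thermal_powers.
Context {R : realType} {H Hn : hilbertType R} {d : nat}.
Local Notation n := d.+2.
Local Notation C := R[i].
Variables (ket : nat -> H) (tens : ('I_n -> H) -> Hn).
Hypotheses (ket_on : orthonormal_seq ket) (ket_tot : total_seq ket).
Hypothesis tensP : is_tensor_power tens.
Variable enc : nat -> multinom n.
Hypothesis enc_bij : bijective enc.
Local Notation dk := (displacement_ket ket).
Let dk_on := displacement_ket_orthonormal ket_on ket_tot.
Let dk_tot := displacement_ket_total ket_on ket_tot.

Definition mode_weight (N : R) (s : nat) : R := (N + 1)^-1 ^+ n * (N / (N + 1)) ^+ s.

Lemma mode_weightE N (m : multinom n) :
  mode_weight N (mdeg m) = \prod_i thermal_weight N (m i).
Proof.
rewrite /mode_weight /thermal_weight big_split prodr_const card_ord; congr (_ * _).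
by rewrite mdegE expr_sum.
Qed.

Lemma mode_weight_ge0 N s : 0 < N -> 0 <= mode_weight N s.
Proof.
move=> N0; rewrite mulr_ge0// exprn_ge0// ?thermal_ratio_ge0//.
by rewrite invr_ge0 addr_ge0// ltW.
Qed.

Lemma enc_orthonormal (h : multinom n -> Hn) :
  (forall m m', ⟨h m, h m'⟩ = (m == m')%:R) -> orthonormal_seq (h \o enc).
Proof. by move=> h_on j k /=; rewrite h_on (bij_eq enc_bij). Qed.

Lemma enc_total (h : multinom n -> Hn) :
  (forall v, (forall m, ⟨h m, v⟩ = 0) -> v = 0) -> total_seq (h \o enc).
Proof.
move=> h_tot v hv; apply: h_tot => m; have [dec _ decK] := enc_bij.
by rewrite -(decK m); exact: hv.
Qed.

Definition product_modes z : nat -> Hn := modes tens (dk z) \o enc.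
Definition signal_modes z : nat -> Hn := rotated_modes tens (dk z) \o enc.

Lemma product_modes_orthonormal z : orthonormal_seq (product_modes z).
Proof. by apply: enc_orthonormal => m m'; exact: modes_orthonormal. Qed.

Lemma product_modes_total z : total_seq (product_modes z).
Proof. by apply: enc_total => v; exact: (modes_total tensP (dk_on z) (@dk_tot z)). Qed.

Lemma signal_modes_orthonormal z : orthonormal_seq (signal_modes z).
Proof. by apply: enc_orthonormal => m m'; exact: rotated_modes_orthonormal. Qed.

Lemma signal_modes_total z : total_seq (signal_modes z).
Proof. by apply: enc_total => v; exact: (rotated_modes_total tensP (dk_on z) (@dk_tot z)). Qed.

(* The weights are the squared coordinates of a product vector, so that
   Bessel's inequality applies. *)
Lemma mode_weight_sum N k : 0 < N -> series (fun j => mode_weight N (mdeg (enc j))) k <= 1.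
Proof.
move=> N0; pose c k : C := (Num.sqrt (thermal_weight N k))%:C.
have c_sqr k' : rnorm (c k') ^+ 2 = thermal_weight N k'.
  by rewrite rnormR ger0_norm ?sqrtr_ge0// sqr_sqrtr// thermal_weight_ge0.
have c_l2 : l2_bound c 1.
  by move=> n'; under eq_bigr do rewrite c_sqr; exact: thermal_weight_sum_le1.
pose u := osum ket c.
have u_le : rnorm u ^+ 2 <= 1 by exact: rnorm_osum ket_on c_l2.
have := bessel (tens (fun=> u)) k (enc_orthonormal (fun m m' => modes_orthonormal tensP m m' ket_on)).
rewrite rnorm_tens// prodr_const card_ord -exprM mulnC exprM => h.
apply: (le_trans _ (le_trans h _)); last by rewrite exprn_ile1// exprn_ge0// rnorm_ge0.
rewrite /series /= le_eqVlt; apply/orP; left; apply/eqP; apply: eq_bigr => j _ /=.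
rewrite mode_weightE braket_tens// (big_morph _ rnormM rnorm1) -prodrXl.
by apply: eq_bigr => i _; rewrite (braket_osum _ ket_on c_l2) c_sqr.
Qed.

Lemma mode_weight_le1 N j : 0 < N -> mode_weight N (mdeg (enc j)) <= 1.
Proof.
move=> N0; apply: le_trans (mode_weight_sum j.+1 N0).
by rewrite /series /= big_nat_recr//= lerDr sumr_ge0// => i _; exact: mode_weight_ge0.
Qed.

Let w N j : C := (mode_weight N (mdeg (enc j)))%:C.

Lemma rnorm_mode_weight N j : 0 < N -> rnorm (w N j) <= 1.
Proof. by move=> N0; rewrite rnormR ger0_norm ?mode_weight_ge0// mode_weight_le1. Qed.

Lemma operator_power_thermal z N : 0 < N ->
  operator_power tens (displaced_thermal ket z N) =
  multiplier (product_modes z) (product_modes z) (w N).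
Proof.
move=> N0; have w_le := rnorm_mode_weight _ N0.
have h_on := product_modes_orthonormal z; have h_tot := @product_modes_total z.
have S_bnd := multiplier_bounded h_on h_on w_le.
have S_tens u : multiplier (product_modes z) (product_modes z) (w N) (tens u) =
    tens (fun i => displaced_thermal ket z N (u i)).
  apply: (total_ext h_tot) => k; rewrite (braket_multiplier h_on h_on w_le).
  rewrite /product_modes /= /modes !braket_tens// /w mode_weightE rmorph_prod -big_split.
  by apply: eq_bigr => i _ /=; rewrite braket_displaced_thermal.
apply: xget_unique => // S [[S_lin S_cont] hS]; have [M_lin M_cont] := S_bnd.
apply: (continuous_ext_basis h_on h_tot S_lin S_cont M_lin M_cont) => k.
by rewrite /product_modes /= /modes hS -S_tens.
Qed.

(** The weights depend on the total degree only, and each rotated mode combines product modes of its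
    own degree; hence the operator is diagonal in the rotated basis too. *)
Lemma operator_power_thermal_signal z N : 0 < N ->
  operator_power tens (displaced_thermal ket z N) =
  multiplier (signal_modes z) (signal_modes z) (w N).
Proof.
move=> N0; have w_le := rnorm_mode_weight _ N0; rewrite operator_power_thermal//.
have h_on := product_modes_orthonormal z; have h_tot := @product_modes_total z.
have g_on := signal_modes_orthonormal z; have g_tot := @signal_modes_total z.
have [S_lin S_cont] := multiplier_bounded h_on h_on w_le.
have [T_lin T_cont] := multiplier_bounded g_on g_on w_le.
apply: (continuous_ext_basis g_on g_tot S_lin S_cont T_lin T_cont) => k.
rewrite (multiplier_basis g_on g_on w_le) /w.
apply: (@rotated_modes_eigen R H Hn d tens (dk z) (enc k) _ (fun s => (mode_weight N s)%:C)) => // m.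
have [dec _ decK] := enc_bij.
have := multiplier_basis h_on h_on w_le (dec m).
by rewrite /product_modes /= /w decK.
Qed.

Lemma trace_thermal z N (B : Hn -> Hn) : 0 < N -> bounded_operator B ->
  (forall v, 0 <= ⟨v, B v⟩) -> (forall v, ⟨v, B v⟩ <= ⟨v, v⟩) ->
  (fun k => series (fun j => mode_weight N (mdeg (enc j)) *
     complex.Re ⟨signal_modes z j, B (signal_modes z j)⟩) k) @ \oo -->
  complex.Re (trace (operator_power tens (displaced_thermal ket z N) \o B)).
Proof.
move=> N0 B_bnd B_ge0 B_le.
pose c j := complex.Re ⟨signal_modes z j, B (signal_modes z j)⟩.
have cE j : ⟨signal_modes z j, B (signal_modes z j)⟩ = (c j)%:C.
  by rewrite /c RRe_real// ger0_real.
have g_on := signal_modes_orthonormal z.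
have c0 j : 0 <= c j by rewrite -lecR -cE.
have c1 j : c j <= 1.
  by rewrite -lecR -cE (le_trans (B_le _))// braket_norm (rnorm_ket g_on) expr1n.
pose s := series (fun j => mode_weight N (mdeg (enc j)) * c j).
have s_cvg : cvgn s.
  apply: nondecreasing_is_cvgn.
    move=> p q pq; rewrite -subr_ge0 sub_series_geq//; apply: sumr_ge0 => j _.
    by rewrite mulr_ge0// mode_weight_ge0.
  exists 1 => _ [k _ <-]; apply: le_trans (mode_weight_sum k N0).
  by apply: ler_sum => j _; rewrite ler_piMr ?mode_weight_ge0.
have -> : complex.Re (trace (operator_power tens (displaced_thermal ket z N) \o B)) = limn s.
  rewrite operator_power_thermal_signal//.
  rewrite (@trace_multiplier _ _ (signal_modes z) _ 1 B (limn s)%:C)//.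
  - exact: signal_modes_total.
  - by move=> k; exact: mode_weight_ge0.
  - by move=> k; exact: mode_weight_sum.
  - by apply: positive_hermitian => //; case: B_bnd.
  - apply: (@cvg_rnorm_le _ C^o _ _ (fun k => `|s k - limn s|)).
      apply: nearW => k; rewrite -rnormR rmorphB /= le_eqVlt; apply/orP; left; apply/eqP.
      congr (rnorm (_ - _)); rewrite /s /series /= rmorph_sum; apply: eq_bigr => j _.
      by rewrite cE -rmorphM.
    rewrite -(normr0 R); apply: cvg_norm; rewrite -(subrr (limn s)).
    by apply: cvgB => //; exact: cvg_cst.
exact: s_cvg.
Qed.

End thermal_powers.

(** * Measurements and decision rules *)

Section integrals_of_set_functions.
Context {R : realType} {dT : measure_display} {T : measurableType dT}.

Import HBNNSimple.

(** [outcome_prob] is a bare set function. Its integral evaluates it only at preimages under simple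
    functions, so it may be replaced by a genuine measure. *)
Lemma integral_eq_on_measurable (mu nu : set T -> \bar R) (D : set T) (f : T -> \bar R) :
  (forall B, measurable B -> mu B = nu B) ->
  (\int[mu]_(x in D) f x = \int[nu]_(x in D) f x)%E.
Proof.
move=> munu; rewrite /integral; congr (ereal_sup _ - ereal_sup _)%E.
all: apply/seteqP; split => _ [h hf <-]; exists h => //; rewrite /sintegral.
all: apply: eq_fsbigr => x _ /=; rewrite munu//.
all: exact: measurable_funPTI.
Qed.

End integrals_of_set_functions.

Section povm_measures.
Context {R : realType} {A : pmetricType R} {H : hilbertType R}.
Local Notation C := R[i].
Variable D : set (borelType A) -> H -> H.
Hypothesis D_povm : is_povm D.

Lemma cvg_Re (u : nat -> C) (l : C) : (u : nat -> C^o) @ \oo --> (l : C^o) ->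
  (fun k => complex.Re (u k)) @ \oo --> complex.Re l.
Proof.
move=> /cvg_rnorm ul; apply/cvgrPdist_lt => e e0.
move/cvgrPdist_lt: ul => /(_ e e0); apply: filterS => k.
rewrite sub0r normrN ger0_norm ?rnorm_ge0//; apply: le_lt_trans.
by rewrite distrC -raddfB; exact: Re_le_rnorm.
Qed.

Lemma povm_op B : measurable B -> bounded_operator (D B).
Proof. by case: D_povm => h _ _ /h[]. Qed.

Lemma povm_ge0 B v : measurable B -> 0 <= ⟨v, D B v⟩.
Proof. by case: D_povm => h _ _ /h[]. Qed.

(** The maximum with 0 gives non-negativity on every set, as the measure interface demands; taking
    the POVM property as an argument lets the measure instance be found from the term. *)
Definition povm_measure (_ : is_povm D) (v : H) (B : set (borelType A)) : \bar R :=
  (Num.max 0 (complex.Re ⟨v, D B v⟩))%:E.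

Lemma povm_measureE v B : measurable B -> povm_measure D_povm v B = (complex.Re ⟨v, D B v⟩)%:E.
Proof.
move=> mB; rewrite /povm_measure max_r//.
by have := povm_ge0 v mB; rewrite lecE => /andP[].
Qed.

(** Additivity for the constant sequence of empty sets makes a series with constant term converge,
    so that term is zero. *)
Let povm_measure0 v : povm_measure D_povm v set0 = 0%E.
Proof.
rewrite povm_measureE//; congr (_%:E).
case: D_povm => _ /(_ (fun _ => set0)) h _.
have tI : trivIset [set: nat] (fun=> set0 : set (borelType A)).
  by apply/trivIsetP => i j _ _ _; rewrite setI0.
have {}h := h (fun _ => measurable0) tI v v.
rewrite bigcup0// in h.
have h2 := cvg_seriesS h.
have h3 : (fun k => series (fun=> ⟨v, D set0 v⟩ : C^o) k.+1 -
    series (fun=> ⟨v, D set0 v⟩ : C^o) k) @ \oo --> (⟨v, D set0 v⟩ - ⟨v, D set0 v⟩ : C^o).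
  exact: cvgB h2 h.
rewrite subrr in h3.
suff -> : ⟨v, D set0 v⟩ = 0 by [].
apply: (@cvg_uniq _ C^o (fun=> ⟨v, D set0 v⟩)); first exact: cvg_cst.
by apply: cvg_ext h3 => k; rewrite sub_series_geq// big_nat1.
Qed.

Let povm_measure_ge0 v B : (0 <= povm_measure D_povm v B)%E.
Proof. by rewrite lee_fin le_max lexx. Qed.

Let povm_measure_sigma_additive v : semi_sigma_additive (povm_measure D_povm v).
Proof.
move=> F mF tF mUF; rewrite povm_measureE//.
have h : _ := cvg_Re (let: And3 _ add _ := D_povm in add F mF tF v v).
rewrite (_ : (fun k => _) = EFin \o
    (fun k => \sum_(0 <= i < k) complex.Re ⟨v, D (F i) v⟩)); last first.
  apply/funext => k /=; rewrite -sumEFin; apply: eq_bigr => i _.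
  by rewrite povm_measureE.
apply: cvg_EFin; first exact: nearW.
by apply: cvg_ext h => k /=; rewrite /series /= raddf_sum.
Qed.

HB.instance Definition _ v := measure_function.isMeasure.Build _ _ _ (povm_measure D_povm v)
  (povm_measure0 v) (povm_measure_ge0 v) (@povm_measure_sigma_additive v).

Lemma povm_measureT v : povm_measure D_povm v setT = (rnorm v ^+ 2)%:E.
Proof.
rewrite povm_measureE//; congr (_%:E); have [_ _ ->] := D_povm.
by rewrite /= braket_norm.
Qed.

Lemma povm_le v B : measurable B -> ⟨v, D B v⟩ <= ⟨v, v⟩.
Proof.
move=> mB; have := povm_ge0 v mB => D0.
rewrite braket_norm -(RRe_real (ger0_real D0)) lecR -lee_fin -povm_measureT.
by rewrite -povm_measureE// le_measure ?inE.
Qed.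

(** Cauchy-Schwarz for the positive form of a POVM element, which lies below the identity. *)
Lemma povm_form B : measurable B -> bounded_form (fun u v => ⟨u, D B v⟩).
Proof.
move=> mB; have [D_lin _] := povm_op mB; split.
- by move=> u a v w; rewrite D_lin braketDr braketZr.
- by move=> u v; apply: positive_hermitian => // w; exact: povm_ge0.
- move=> u v; rewrite -(@ler_pXn2r _ 2) ?nnegrE ?mulr_ge0 ?rnorm_ge0// exprMn.
  have := @psd_form_CS _ _ (fun u v => ⟨u, D B v⟩).
  move=> /(_ _ _ _ u v) h; apply: le_trans (h _ _ _) _.
  + by move=> x a y z; rewrite D_lin braketDr braketZr.
  + by move=> x y; apply: positive_hermitian => // w; exact: povm_ge0.
  + by move=> x; exact: povm_ge0.
  + have Re0 x : 0 <= complex.Re ⟨x, D B x⟩.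
      by have := povm_ge0 x mB; rewrite lecE => /andP[].
    have Rele x : complex.Re ⟨x, D B x⟩ <= rnorm x ^+ 2.
      by have := povm_le x mB; rewrite braket_norm lecE => /andP[].
    exact: ler_pM.
Qed.

End povm_measures.

Section risk_formula.
Context {R : realType} {A : pmetricType R} {H Hn : hilbertType R} {d : nat}.
Local Notation n := d.+2.
Variables (ket : nat -> H) (tens : ('I_n -> H) -> Hn).
Hypotheses (ket_on : orthonormal_seq ket) (ket_tot : total_seq ket).
Hypothesis tensP : is_tensor_power tens.
Variable enc : nat -> multinom n.
Hypothesis enc_bij : bijective enc.
Variable D : set (borelType A) -> Hn -> Hn.
Hypothesis D_povm : is_povm D.

(** On measurable sets the outcome law is the countable mixture of the laws in the displaced signal
    vectors with the thermal weights, and integration splits over a series of measures. *)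
Lemma quantum_riskE (L : R -> A -> R) z N : 0 < N ->
  measurable_fun [set: borelType A] (L N : borelType A -> R) -> (forall a, 0 <= L N a) ->
  quantum_risk ket tens L z N D =
  (\sum_(0 <= j <oo) (mode_weight (d := d) N (mdeg (enc j)))%:E *
    \int[povm_measure D_povm (signal_modes ket tens enc z j)]_(a in [set: borelType A]) (L N a)%:E)%E.
Proof.
move=> N0 mL L0.
pose p j : {nonneg R} := NngNum (mode_weight_ge0 (d := d) (mdeg (enc j)) N0).
pose nu j : {measure set (borelType A) -> \bar R} :=
  mscale (p j) (povm_measure D_povm (signal_modes ket tens enc z j)).
have fL0 (a : borelType A) : [set: borelType A] a -> (0 <= (L N a)%:E)%E by rewrite lee_fin.
rewrite /quantum_risk (@integral_eq_on_measurable _ _ _ _ (mseries nu 0)) => [|B mB].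
  rewrite ge0_integral_measure_series//; last exact/measurable_EFinP.
  apply: eq_eseriesr => j _; rewrite ge0_integral_mscale//.
  exact/measurable_EFinP.
have tr := @trace_thermal _ _ _ _ _ _ ket_on ket_tot tensP enc enc_bij z N (D B) N0 (povm_op D_povm mB)
  (fun v => povm_ge0 D_povm v mB) (fun v => povm_le D_povm v mB).
apply/esym/cvg_lim => //; rewrite (_ : (fun k => _) = EFin \o (series (fun j =>
    mode_weight (d := d) N (mdeg (enc j)) *
    complex.Re ⟨signal_modes ket tens enc z j, D B (signal_modes ket tens enc z j)⟩))).
  by apply: cvg_EFin; first exact: nearW.
apply/funext => k /=; rewrite /series /= -sumEFin; apply: eq_bigr => j _.
by rewrite /nu /mscale /= povm_measureE.
Qed.

End risk_formula.

(** * Sums over occupation patterns *)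

Section multinomial_sums.
Context {R : realType} {d : nat}.

Definition mcons (k : nat) (b : multinom d.+1) : multinom d.+2 :=
  Multinom [tuple if unlift ord0 i is Some j then b j else k | i < d.+2].

Definition mtail (m : multinom d.+2) : multinom d.+1 :=
  Multinom [tuple m (lift ord0 j) | j < d.+1].

Lemma mcons0 k b : mcons k b ord0 = k.
Proof. by rewrite multinomE tnth_mktuple unlift_none. Qed.

Lemma mcons_lift k b j : mcons k b (lift ord0 j) = b j.
Proof. by rewrite multinomE tnth_mktuple liftK. Qed.

Lemma mtailE (m : multinom d.+2) j : mtail m j = m (lift ord0 j).
Proof. by rewrite multinomE tnth_mktuple. Qed.

Lemma mconsK (m : multinom d.+2) : mcons (m ord0) (mtail m) = m.
Proof.
by apply/mnmP => i; case: (unliftP ord0 i) => [j|] ->; rewrite ?mcons0// mcons_lift mtailE.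
Qed.

Lemma mtailK k b : mtail (mcons k b) = b.
Proof. by apply/mnmP => i; rewrite mtailE mcons_lift. Qed.

Lemma mdeg_mcons k b : mdeg (mcons k b) = (k + mdeg b)%N.
Proof.
rewrite !mdegE big_ord_recl mcons0; congr (_ + _)%N.
by apply: eq_bigr => j _; rewrite mcons_lift.
Qed.

(** Built from tuples of ordinals so that [card_ord_partitions] counts it; the count is the binomial
    coefficient of the negative binomial law. *)
Definition degree_multinoms (s : nat) : seq (multinom d.+1) :=
  [seq Multinom (map_tuple (@nat_of_ord s.+1) t)
  | t <- enum [set t : d.+1.-tuple 'I_s.+1 | (\sum_(i <- t) i)%N == s]%SET].

Lemma size_degree_multinoms s : size (degree_multinoms s) = 'C(d + s, d).
Proof. by rewrite size_map -cardE card_ord_partitions. Qed.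

Lemma degree_multinoms_uniq s : uniq (degree_multinoms s).
Proof.
rewrite map_inj_uniq ?enum_uniq// => t u [htu].
by apply: val_inj => /=; apply: inj_map htu; exact: val_inj.
Qed.

Lemma mem_degree_multinoms s b : (b \in degree_multinoms s) = (mdeg b == s).
Proof.
apply/mapP/eqP => [[t]|bs].
  rewrite mem_enum inE => /eqP ts ->; rewrite mdegE -[RHS]ts big_tuple.
  by apply: eq_bigr => j _; rewrite multinomE tnth_map.
have b_le j : (b j < s.+1)%N by rewrite ltnS -bs mdegE (bigD1 j)//= leq_addr.
exists [tuple Ordinal (b_le j) | j < d.+1].
  rewrite mem_enum inE; apply/eqP; rewrite -[RHS]bs mdegE big_tuple; apply: eq_bigr => j _.
  by rewrite tnth_mktuple.
by apply/mnmP => j; rewrite multinomE tnth_map tnth_mktuple.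
Qed.

Local Open Scope ereal_scope.

Lemma esum_degree (f : multinom d.+1 -> \bar R) : (forall b, 0 <= f b) ->
  \esum_(b in [set: multinom d.+1]) f b =
  \sum_(0 <= s <oo) \sum_(b <- degree_multinoms s) f b.
Proof.
move=> f0; have -> : [set: multinom d.+1] = \bigcup_s [set b | mdeg b = s].
  by apply/seteqP; split => // b _; exists (mdeg b).
rewrite nneseries_sum_bigcup//; last by move=> s t _ _ [b [/= <- <-]].
apply: eq_eseriesr => s _.
have -> : [set b | mdeg b = s] = [set` degree_multinoms s].
  by apply/seteqP; split => b /=; rewrite mem_degree_multinoms => /eqP.
rewrite esum_fset//; last exact: finite_seq.
by apply/esym/fsbig_seq/degree_multinoms_uniq.
Qed.

Lemma sum_multinom (enc : nat -> multinom d.+2) (f : multinom d.+2 -> \bar R) :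
  bijective enc -> (forall m, 0 <= f m) ->
  \sum_(0 <= j <oo) f (enc j) =
  \sum_(0 <= s <oo) \sum_(0 <= k <oo) \sum_(b <- degree_multinoms s) f (mcons k b).
Proof.
move=> enc_bij f0; rewrite nneseries_esumT//.
rewrite -(@reindex_esum _ _ _ _ [set: multinom d.+2])//; last first.
  split=> //; first by move=> i j _ _; exact: bij_inj.
  by move=> m _; have [dec _ decK] := enc_bij; exists (dec m).
rewrite (@reindex_esum _ _ _ ([set: nat] `*`` (fun _ => [set: multinom d.+1])) _
  (fun p => mcons p.1 p.2)); last first.
  split=> //.
    move=> [k b] [k' b'] _ _ /= h; rewrite -(mtailK k b) -(mtailK k' b') h.
    by rewrite -(mcons0 k b) h mcons0.
  by move=> m _; exists (m ord0, mtail m) => //=; exact: mconsK.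
rewrite -(@esum_esum _ _ _ _ _ (fun k b => f (mcons k b)))//.
rewrite -nneseries_esumT => [|k]; last by apply: esum_ge0.
rewrite nneseries_interchange => [|s k]; last exact: sume_ge0.
by apply: eq_eseriesr => k _; exact: esum_degree.
Qed.

End multinomial_sums.

Section mode_weight_sums.
Context {R : realType} {d : nat}.
Implicit Type N : R.

Definition noise_weight N s : R := (N + 1)^-1 ^+ d.+1 * (N / (N + 1)) ^+ s.

Lemma noise_weight_ge0 N s : (0 < N)%R -> (0 <= noise_weight N s)%R.
Proof.
move=> N0; rewrite mulr_ge0// exprn_ge0// ?thermal_ratio_ge0//.
by rewrite invr_ge0 addr_ge0// ltW.
Qed.

Lemma mode_weight_mcons N k (b : multinom d.+1) :
  mode_weight (d := d) N (mdeg (mcons k b)) = thermal_weight N k * noise_weight N (mdeg b).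
Proof.
rewrite mdeg_mcons /mode_weight /thermal_weight /noise_weight exprS exprD.
by rewrite !mulrA; congr (_ * _); rewrite -!mulrA; congr (_ * _); rewrite mulrC.
Qed.

Lemma negbinE N s : negbin d.+1 N s = (size (degree_multinoms (d := d) s))%:R * noise_weight N s.
Proof.
by rewrite /negbin /noise_weight size_degree_multinoms addnS/= addnC -exprVn mulrA.
Qed.

Local Open Scope ereal_scope.

Lemma thermal_weight_series N : (0 < N)%R ->
  \sum_(0 <= k <oo) (thermal_weight N k)%:E = 1.
Proof.
move=> N0; apply/cvg_lim => //.
rewrite (_ : (fun k => _) = EFin \o (fun n => 1 - (N / (N + 1)) ^+ n)%R).
  apply: cvg_EFin; first exact: nearW.
  rewrite -[X in _ --> X]subr0; apply: cvgB; first exact: cvg_cst.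
  by apply: cvg_expr; rewrite ger0_norm ?thermal_ratio_ge0// thermal_ratio_lt1.
by apply/funext => n /=; rewrite sumEFin thermal_weight_sum.
Qed.

(** Disintegration of the thermal law: the signal occupation k is independent of the noise, and
    noise patterns of the same degree s have equal weight. *)
Lemma sum_mode_weight (enc : nat -> multinom d.+2) N (f : multinom d.+2 -> \bar R) :
  bijective enc -> (0 < N)%R -> (forall m, 0 <= f m) ->
  \sum_(0 <= j <oo) (mode_weight (d := d) N (mdeg (enc j)))%:E * f (enc j) =
  \sum_(0 <= s <oo) (noise_weight N s)%:E * \sum_(0 <= k <oo) (thermal_weight N k)%:E *
    \sum_(b <- degree_multinoms s) f (mcons k b).
Proof.
move=> enc_bij N0 f0.
have t0 k : 0 <= (thermal_weight N k)%:E by rewrite lee_fin thermal_weight_ge0.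
rewrite (@sum_multinom _ _ enc (fun m => (mode_weight (d := d) N (mdeg m))%:E * f m))//.
  apply: eq_eseriesr => s _; rewrite -nneseriesZl => [|k _]; last first.
    by rewrite mule_ge0// sume_ge0.
  apply: eq_eseriesr => k _; rewrite muleA -EFinM.
  rewrite ge0_sume_distrr//; apply: eq_big_seq => b; rewrite mem_degree_multinoms => /eqP <-.
  by rewrite mode_weight_mcons mulrC.
by move=> m; rewrite mule_ge0// lee_fin mode_weight_ge0.
Qed.

(** Obtained from the Bessel bound on the joint weights: summing out the signal mode, of mass 1,
    leaves the negative binomial weights. *)
Lemma negbin_sum_le1 (H Hn : hilbertType R) (ket : nat -> H) (tens : ('I_d.+2 -> H) -> Hn)
    (enc : nat -> multinom d.+2) N :
  orthonormal_seq ket -> is_tensor_power tens -> bijective enc -> (0 < N)%R ->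
  \sum_(0 <= s <oo) (negbin d.+1 N s)%:E <= 1.
Proof.
move=> ket_on tensP enc_bij N0.
have -> : \sum_(0 <= s <oo) (negbin d.+1 N s)%:E =
    \sum_(0 <= j <oo) (mode_weight (d := d) N (mdeg (enc j)))%:E.
  under [RHS]eq_eseriesr do rewrite -[X in X%:E]mulr1 EFinM.
  rewrite (@sum_mode_weight enc N (fun=> 1%:E))//.
  apply: eq_eseriesr => s _; rewrite negbinE mulrC EFinM; congr (_ * _).
  under eq_eseriesr do rewrite sumEFin big_const_seq count_predT iter_addr_0 muleC.
  rewrite nneseriesZl => [|k _]; last by rewrite lee_fin thermal_weight_ge0.
  by rewrite thermal_weight_series// mule1.
apply: lime_le.
  by apply: is_cvg_nneseries => j _ _; rewrite lee_fin mode_weight_ge0.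
apply: nearW => k; rewrite sumEFin lee_fin.
exact: (mode_weight_sum ket_on tensP enc_bij k N0).
Qed.

End mode_weight_sums.

(** * Measurements diagonal in a basis *)

Section diagonal_povms.
Context {R : realType} {A : pmetricType R} {H : hilbertType R}.
Local Notation C := R[i].
Variables (g : nat -> H) (theta : nat -> {measure set (borelType A) -> \bar R}).
Hypotheses (g_on : orthonormal_seq g) (g_tot : total_seq g).
Hypothesis thetaT : forall j, theta j setT = 1%E.

(** Measure in the basis g and, on result j, draw the action from [theta j]. *)
Definition diagonal_povm (B : set (borelType A)) : H -> H :=
  multiplier g g (fun j => (fine (theta j B))%:C).

Lemma fine_theta j B : measurable B -> (fine (theta j B))%:E = theta j B.
Proof.
move=> mB; apply: fineK; rewrite ge0_fin_numE// (@le_lt_trans _ _ 1%E) ?ltry//.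
by rewrite -(thetaT j) le_measure ?inE.
Qed.

Lemma fine_theta_ge0 j B : 0 <= fine (theta j B).
Proof. exact: fine_ge0. Qed.

Lemma rnorm_theta B : measurable B -> forall j, rnorm ((fine (theta j B))%:C : C) <= 1.
Proof.
move=> mB j; rewrite rnormR ger0_norm ?fine_theta_ge0// -lee_fin fine_theta//.
by rewrite -(thetaT j) le_measure ?inE.
Qed.

Lemma cvg_realC (r : nat -> R) (l : R) : r @ \oo --> l ->
  (fun k => (r k)%:C : C^o) @ \oo --> (l%:C : C^o).
Proof.
move=> rl; apply: (@cvg_rnorm_le _ C^o _ _ (fun k => `|r k - l|)).
  by apply: nearW => k; rewrite -rmorphB rnormR.
rewrite -(normr0 R) -(subrr l); apply: cvg_norm; apply: cvgB => //; exact: cvg_cst.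
Qed.

Lemma cvg_diagonal_povm B u v : measurable B ->
  series (fun j => (fine (theta j B))%:C * (⟨u, g j⟩ * ⟨g j, v⟩) : C^o) @ \oo -->
  (⟨u, diagonal_povm B v⟩ : C^o).
Proof. by move=> mB; exact: (cvg_braket_multiplier g_on g_on (rnorm_theta mB)). Qed.

Lemma cvg_diagonal_povm_diag B v : measurable B ->
  series (fun j => fine (theta j B) * rnorm ⟨g j, v⟩ ^+ 2) @ \oo -->
  complex.Re ⟨v, diagonal_povm B v⟩.
Proof.
move=> mB; have /cvg_Re := @cvg_diagonal_povm B v v mB.
apply: cvg_ext => k; rewrite /series /= raddf_sum; apply: eq_bigr => j _.
by rewrite -(braket_conj (g j) v) mulrC [X in X * _]mulrC mulC_conj -rmorphM /= mulrC.
Qed.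

Lemma diagonal_povm_ge0 B v : measurable B -> 0 <= ⟨v, diagonal_povm B v⟩.
Proof.
move=> mB; have hR := @cvg_diagonal_povm_diag B v mB.
have -> : ⟨v, diagonal_povm B v⟩ = (complex.Re ⟨v, diagonal_povm B v⟩)%:C.
  apply: (@cvg_uniq _ C^o _ _ _ (@cvg_diagonal_povm B v v mB)).
  apply: cvg_ext (cvg_realC hR) => k; rewrite /series /= rmorph_sum.
  apply: eq_bigr => j _.
  by rewrite rmorphM /= -mulC_conj braket_conj [⟨v, _⟩ * _]mulrC.
rewrite ler0c; rewrite -(cvg_lim _ hR)//; apply: limr_ge.
  by apply/cvg_ex; exists (complex.Re ⟨v, diagonal_povm B v⟩).
apply: nearW => k.
by apply: sumr_ge0 => j _; rewrite mulr_ge0 ?fine_theta_ge0// exprn_ge0// rnorm_ge0.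
Qed.

Lemma diagonal_povm_is_povm : is_povm diagonal_povm.
Proof.
split.
- move=> B mB; split; first exact: (multiplier_bounded g_on g_on (rnorm_theta mB)).
  by move=> v; exact: diagonal_povm_ge0.
- move=> F mF tF u v; have mUF := bigcup_measurable (fun i _ => mF i) : measurable (\bigcup_i F i).
  pose c j := ⟨u, g j⟩ * ⟨g j, v⟩.
  (* The majorant |<u,g_j><g_j,v>| is at most the sum of the two squares, which Bessel's inequality
     sums. *)
  apply: (@tannery _ C^o (fun j => rnorm (c j)) (rnorm u ^+ 2 + rnorm v ^+ 2)
    (fun j m => (\sum_(0 <= i < m) fine (theta j (F i)))%:C * c j)
    (fun j => (fine (theta j (\bigcup_i F i)))%:C * c j)).
  + move=> k; apply: le_trans (lerD (bessel u k g_on) (bessel v k g_on)).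
    rewrite -big_split /series /=; apply: ler_sum => j _.
    rewrite /c rnormM -(braket_conj (g j) u) rnorm_conj.
    have := rnorm_ge0 ⟨g j, u⟩; have := rnorm_ge0 ⟨g j, v⟩.
    by move: (rnorm _) (rnorm _) => a b; nra.
  + move=> j m; rewrite rnormM rnormR ger0_norm; last first.
      by apply: sumr_ge0 => i _; exact: fine_theta_ge0.
    apply: ler_piMl; first exact: rnorm_ge0.
    rewrite -lee_fin -sumEFin; under eq_bigr do rewrite fine_theta//.
    rewrite big_mkord -measure_bigsetU//.
    by rewrite -(thetaT j) le_measure ?inE//; exact: bigsetU_measurable.
  + move=> j; apply: cvgMr_tmp; apply: cvg_realC.
    have /fine_cvgP[_] : \sum_(0 <= i < m) theta j (F i) @[m --> \oo] --> 
        (fine (theta j (\bigcup_i F i)))%:E.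
      by rewrite fine_theta//; exact: measure_semi_sigma_additive.
    apply: cvg_ext => m /=; apply: EFin_inj.
    rewrite -sumEFin fineK; first by apply: eq_bigr => i _; rewrite fine_theta.
    by apply/sum_fin_numP => i _; rewrite -fine_theta.
  + move=> m.
    have h := cvg_bigsum (index_iota 0 m) (fun i => @cvg_diagonal_povm _ u v (mF i)).
    apply: cvg_ext h => k; rewrite /series /= exchange_big /=; apply: eq_bigr => j _.
    by rewrite rmorph_sum mulr_suml.
  + exact: cvg_diagonal_povm.
- apply/funext => v; apply: (total_ext g_tot) => k.
  rewrite (braket_multiplier g_on g_on (rnorm_theta measurableT)) thetaT /=.
  by rewrite mul1r.
Qed.

(** The probabilities |<g_j,v>|^2 sum to one and only average equal values. *)
Lemma diagonal_povm_const (mu : {measure set (borelType A) -> \bar R}) B v : measurable B ->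
  rnorm v = 1 -> (forall j, ⟨g j, v⟩ != 0 -> theta j B = mu B) ->
  (complex.Re ⟨v, diagonal_povm B v⟩)%:E = mu B.
Proof.
move=> mB v1 hv.
have [j gj] : exists j, ⟨g j, v⟩ != 0.
  apply: contrapT => h; move: v1; rewrite (g_tot (v := v)) ?rnorm0.
    by move/eqP; rewrite eq_sym oner_eq0.
  by move=> k; apply/eqP/negPn/negP => gk; apply: h; exists k.
rewrite -(hv j gj) -fine_theta//; congr (_%:E).
rewrite -(cvg_lim _ (@cvg_diagonal_povm_diag B v mB))//; apply: cvg_lim => //.
have h := cvgMr_tmp (b := fine (theta j B)) (parseval v g_on g_tot).
rewrite v1 expr1n mul1r in h.
apply: cvg_ext (h _) => k; rewrite /series /= mulr_suml; apply: eq_bigr => i _.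
have [->|gi] := eqVneq ⟨g i, v⟩ 0; first by rewrite rnorm0 expr0n mul0r mulr0.
by rewrite mulrC (hv j gj) (hv i gi).
Qed.

End diagonal_povms.

Section noise_measurement.
Context {R : realType} {A : pmetricType R} {H Hn : hilbertType R} {d : nat}.
Local Notation n := d.+2.
Variables (ket : nat -> H) (tens : ('I_n -> H) -> Hn).
Hypotheses (ket_on : orthonormal_seq ket) (ket_tot : total_seq ket).
Hypothesis tensP : is_tensor_power tens.
Variable enc : nat -> multinom n.
Hypothesis enc_bij : bijective enc.

(* Count the photons in the noise modes and apply the rule to their total. *)
Lemma noise_povm (delta : R.-pker nat ~> borelType A) :
  exists2 D : set (borelType A) -> Hn -> Hn, is_povm D &
    forall (L : R -> A -> R) z N M, 0 < N ->
      measurable_fun [set: borelType A] (L N : borelType A -> R) -> (forall a, 0 <= L N a <= M) ->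
      quantum_risk ket tens L z N D = classical_risk d.+1 L N delta.
Proof.
pose g := rotated_modes tens ket \o enc.
have g_on : orthonormal_seq g.
  by apply: enc_orthonormal => // m m'; exact: rotated_modes_orthonormal.
have g_tot : total_seq g.
  apply: enc_total => // v; exact: (rotated_modes_total tensP ket_on ket_tot).
pose theta j : {measure set (borelType A) -> \bar R} := delta (mdeg (mtail (enc j))).
have thetaT j : theta j setT = 1%E by exact: prob_kernel.
have D_povm := diagonal_povm_is_povm g_on g_tot thetaT.
exists (diagonal_povm g theta) => // L z N M N0 mL L0M.
have L0 a : 0 <= L N a by have /andP[] := L0M a.
rewrite (quantum_riskE ket_on ket_tot tensP enc_bij D_povm)//.
pose f (m : multinom n) := (\int[delta (mdeg (mtail m))]_(a in [set: borelType A]) (L N a)%:E)%E.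
transitivity (\sum_(0 <= j <oo) (mode_weight (d := d) N (mdeg (enc j)))%:E * f (enc j))%E.
  apply: eq_eseriesr => j _; congr (_ * _)%E.
  apply: integral_eq_on_measurable => B mB; rewrite povm_measureE//.
  apply: (diagonal_povm_const g_on g_tot thetaT) => //.
    exact: (rnorm_ket (signal_modes_orthonormal ket_on ket_tot tensP enc_bij z)).
  (* A displaced vector overlaps only number states with the same noise occupations, on which
     [theta] is constant; this removes the dependence on z. *)
  move=> i; rewrite /g /signal_modes /= rotated_modes_displacement//.
  case: ifP; last by rewrite eqxx.
  move=> /forallP h _; congr (delta _ _); congr mdeg; apply/mnmP => l; rewrite !mtailE.
  by have := h (lift ord0 l); rewrite eq_sym neq_lift => /eqP.
rewrite sum_mode_weight//; last by move=> m; apply: integral_ge0 => a _; rewrite lee_fin.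
apply: eq_eseriesr => s _; rewrite negbinE.
set I := integral _ _ _.
have I0 : (0 <= I)%E by apply: integral_ge0 => a _; rewrite lee_fin.
have If : I \is a fin_num.
  rewrite ge0_fin_numE// (@le_lt_trans _ _ (\int[delta s]_(a in [set: borelType A]) M%:E)%E)//.
    apply: ge0_le_integral => //.
    - by move=> a _; rewrite lee_fin.
    - exact/measurable_EFinP.
    - by move=> a _; rewrite lee_fin; have /andP[] := L0M a.
  by rewrite integral_cst// prob_kernel mule1 ltry.
have -> : (\sum_(0 <= k <oo) (thermal_weight N k)%:E *
    \sum_(b <- degree_multinoms s) f (mcons k b) =
    ((size (degree_multinoms (d := d) s))%:R)%:E * I)%E.
  transitivity (\sum_(0 <= k <oo) (thermal_weight N k)%:E *
     (((size (degree_multinoms (d := d) s))%:R)%:E * I))%E.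
    apply: eq_eseriesr => k _; congr (_ * _)%E.
    rewrite (eq_big_seq (fun=> (fine I)%:E)); last first.
      by move=> b; rewrite mem_degree_multinoms /f mtailK => /eqP ->; rewrite fineK.
    by rewrite sumEFin big_const_seq count_predT iter_addr_0 -{2}(fineK If) -EFinM mulr_natl.
  rewrite -(fineK If) -EFinM; set c := (_ * fine I)%R.
  under eq_eseriesr do rewrite muleC.
  rewrite nneseriesZl ?thermal_weight_series ?mule1// => k _.
  by rewrite lee_fin thermal_weight_ge0.
by rewrite muleA -EFinM mulrC.
Qed.

End noise_measurement.

(** * Integrals under setwise close measures *)

Section layer_cake.
Context {R : realType} {dT : measure_display} {T : measurableType dT}.

(** The sum is t times the number of levels t i, i < h, lying below x: for t > 0, x rounded up to a
    multiple of t and capped at t h. *)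
Lemma staircase (t x : R) h : 0 <= t -> 0 <= x ->
  Num.min x (t * h%:R) <= \sum_(0 <= i < h) t * (t * i%:R < x)%R%:R <= Num.min (x + t) (t * h%:R).
Proof.
move=> t0 x0; elim: h => [|h /andP[IH1 IH2]].
  by rewrite big_geq// mulr0 ge_min lexx orbT le_min lexx addr_ge0.
rewrite big_nat_recr//= -[h.+1%:R]natr1 mulrDr mulr1.
move: IH1 IH2; rewrite ge_min !le_min => IH1 /andP[IH2 IH3].
case: ltP => htx; rewrite ?mulr1 ?mulr0 ?addr0.
  have {}IH1 : t * h%:R <= \sum_(0 <= i < h) t * (t * i%:R < x)%R%:R.
    by case/orP: IH1 => //; apply: le_trans; exact: ltW.
  by rewrite ge_min lerD2r IH1 orbT !lerD2r IH3 (le_trans IH3) ?ltW.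
rewrite ge_min IH2 (le_trans IH3) ?lerDl// !andbT; apply/orP; left.
by case/orP: IH1 => // h1; apply: le_trans htx h1.
Qed.

Local Open Scope ereal_scope.

(* Setwise closeness of two measures controls integrals of bounded functions
   through a finite layer-cake decomposition. *)
Lemma layer_cake_le (mu nu : {measure set T -> \bar R}) (f : T -> R) (M e : R) :
  measurable_fun setT f -> (forall a, 0 <= f a <= M)%R -> (0 <= e)%R -> nu setT <= 1 ->
  (forall B, measurable B -> mu B <= nu B + e%:E) ->
  \int[mu]_a (f a)%:E <= \int[nu]_a (f a)%:E + (M * e)%:E.
Proof.
move=> mf f0M e0 nu1 munu.
have f0 a : (0 <= f a)%R by have /andP[] := f0M a.
have M0 : (0 <= M)%R.
  by have /andP[h1 h2] := f0M point; exact: le_trans h2.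
apply/lee_addgt0Pr => eps eps0.
(* The step height t = M/h is the price of replacing f by its staircase, so h is chosen to make it
   at most [eps]. *)
have [h h0 Mh] : exists2 h, (0 < h)%N & (M / h%:R <= eps)%R.
  exists (Num.trunc (M / eps)).+1 => //; rewrite ler_pdivrMr//.
  rewrite mulrC -ler_pdivrMr//; apply/ltW; rewrite truncnS_gt//.
set t := (M / h%:R)%R in Mh.
have t0 : (0 <= t)%R by rewrite divr_ge0.
have th : (t * h%:R = M)%R by rewrite mulfVK// pnatr_eq0 -lt0n.
pose F i := [set a | (t * i%:R < f a)%R].
have mF i : measurable (F i).
  rewrite -[F i]setTI; apply: (measurable_fun_ltr (f := cst _)) => //.
pose S a := \sum_(0 <= i < h) (t%:E * (\1_(F i) a)%:E).
have S_E a : S a = (\sum_(0 <= i < h) t * (t * i%:R < f a)%R%:R)%R%:E.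
  rewrite /S -sumEFin; apply: eq_bigr => i _; rewrite -EFinM indicE; congr (_ * (nat_of_bool _)%:R)%:E.
  by apply/idP/idP; rewrite inE.
have S_int (rho : {measure set T -> \bar R}) :
    \int[rho]_a S a = \sum_(0 <= i < h) t%:E * rho (F i).
  rewrite /S ge0_integral_sum//.
  - apply: eq_bigr => i _; rewrite ge0_integralZl//.
      by rewrite integral_indic// setIT.
    exact/measurable_EFinP/measurable_indic.
  - by move=> i; apply: measurable_funeM; exact/measurable_EFinP/measurable_indic.
  - by move=> i a _; rewrite mule_ge0// lee_fin.
have mS : measurable_fun setT S.
  apply: emeasurable_sum => i; apply: measurable_funeM.
  exact/measurable_EFinP/measurable_indic.
have fS a : (f a)%:E <= S a.
  rewrite S_E lee_fin; have /andP[h1 _] := staircase h t0 (f0 a).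
  apply: le_trans h1; rewrite th le_min lexx /=; by have /andP[] := f0M a.
have Sf a : S a <= (f a)%:E + t%:E.
  rewrite S_E lee_fin; have /andP[_ h1] := staircase h t0 (f0 a).
  by apply: le_trans h1 _; rewrite ge_min lexx.
apply: (@le_trans _ _ (\int[mu]_a S a)).
  apply: ge0_le_integral => //; first by move=> a _; rewrite lee_fin.
  exact/measurable_EFinP.
(* Each of the h levels costs t e, and t h = M. *)
apply: (@le_trans _ _ (\int[nu]_a S a + (M * e)%:E)).
  rewrite !S_int -th mulrAC mulr_natr EFinM.
  have -> : (t * e *+ h)%:E = \sum_(0 <= i < h) t%:E * e%:E.
    by rewrite -EFinM sumEFin sumr_const_nat subn0.
  rewrite -big_split /=; apply: lee_sum => i _; rewrite -ge0_muleDr//.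
  by apply: lee_wpmul2l; rewrite ?lee_fin//; exact: munu.
rewrite [X in _ <= X]addeAC; apply: leeD => //.
apply: (@le_trans _ _ (\int[nu]_a ((f a)%:E + t%:E))).
  apply: ge0_le_integral => //.
  - by move=> a _; rewrite S_E lee_fin; apply: sumr_ge0 => *; rewrite mulr_ge0.
  - by apply: emeasurable_funD => //; exact/measurable_EFinP.
rewrite ge0_integralD//; first last.
- exact/measurable_EFinP.
- by move=> a _; rewrite lee_fin.
apply: leeD => //; rewrite integral_cst//.
by apply: (@le_trans _ _ (t%:E * 1)); [exact: lee_wpmul2l|rewrite mule1 lee_fin].
Qed.

End layer_cake.

Section averaged_measures.
Context {R : realType} {A : pmetricType R} {H : hilbertType R}.
Variable D : set (borelType A) -> H -> H.
Hypothesis D_povm : is_povm D.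

Let inv_size_ge0 (vs : seq H) : 0 <= (size vs)%:R^-1 :> R.
Proof. by rewrite invr_ge0. Qed.

Definition average_measure (vs : seq H) : {measure set (borelType A) -> \bar R} :=
  mscale (NngNum (inv_size_ge0 vs)) (msum (fun i => povm_measure D_povm (nth 0 vs i)) (size vs)).

Local Open Scope ereal_scope.

Lemma average_measureE vs B : average_measure vs B =
  ((size vs)%:R^-1)%:E * \sum_(v <- vs) povm_measure D_povm v B.
Proof. by rewrite /average_measure /mscale /= /msum (big_nth 0%R) big_mkord. Qed.

Lemma average_measureT vs : vs != [::] -> (forall v, v \in vs -> rnorm v = 1%R) ->
  average_measure vs setT = 1.
Proof.
move=> vs0 vs1; rewrite average_measureE.
rewrite (eq_big_seq (fun=> 1%:E)); last first.
  by move=> v /vs1 v1; rewrite povm_measureT v1 expr1n.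
rewrite sumEFin big_const_seq count_predT iter_addr_0 -EFinM mulVf//.
by rewrite pnatr_eq0 size_eq0.
Qed.

Lemma integral_average (f : borelType A -> R) vs : measurable_fun setT f ->
  (forall a, (0 <= f a)%R) ->
  \int[average_measure vs]_a (f a)%:E =
  ((size vs)%:R^-1)%:E * \sum_(v <- vs) \int[povm_measure D_povm v]_a (f a)%:E.
Proof.
move=> mf f0; have f0' a : [set: borelType A] a -> 0 <= (f a)%:E by rewrite lee_fin.
rewrite ge0_integral_mscale//; last exact/measurable_EFinP.
rewrite ge0_integral_measure_sum//; last exact/measurable_EFinP.
by rewrite (big_nth 0%R) big_mkord.
Qed.

End averaged_measures.

(** * Twirling the signal mode *)

Section signal_twirl.
Context {R : realType} {A : pmetricType R} {H Hn : hilbertType R} {d : nat}.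
Local Notation n := d.+2.
Local Notation C := R[i].
Variables (ket : nat -> H) (tens : ('I_n -> H) -> Hn).
Hypotheses (ket_on : orthonormal_seq ket) (ket_tot : total_seq ket).
Hypothesis tensP : is_tensor_power tens.
Local Notation dk := (displacement_ket ket).
Let dk_on := displacement_ket_orthonormal ket_on ket_tot.

Let scale : R := Num.sqrt n%:R.

(** The division by sqrt n compensates for the factor sqrt n that the signal mode picks up, so that
    the signal is displaced along [grid q]. *)
Definition twirl_points (q : nat) : seq C :=
  [seq ((Num.sqrt n%:R : R)^-1)%:C * (grid q m l : C) | l <- iota 0 (q ^ 2), m <- iota 0 (q ^ 2)].

Lemma size_twirl_points q : size (twirl_points q) = (q ^ 4)%N.
Proof. by rewrite size_allpairs !size_iota -expnD. Qed.

Definition signal_vector (z : C) (k : nat) (b : multinom d.+1) : Hn :=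
  rotated_modes tens (dk z) (mcons k b).

Lemma rnorm_signal_vector z k b : rnorm (signal_vector z k b) = 1.
Proof.
apply/eqP; rewrite -(@eqrXn2 _ 2) ?rnorm_ge0// expr1n; apply/eqP/complexI.
by rewrite -braket_norm rotated_modes_orthonormal// eqxx.
Qed.

Lemma braket_rotated_slice b m k :
  ⟨rotated_modes tens ket m, rotated_modes tens ket (mcons k b)⟩ =
  (mtail m == b)%:R * (m ord0 == k)%:R.
Proof.
rewrite rotated_modes_orthonormal// -natrM mulnb; congr (nat_of_bool _)%:R.
apply/eqP/andP => [->|[/eqP <- /eqP <-]]; first by rewrite mtailK mcons0 !eqxx.
by rewrite mconsK.
Qed.

Lemma slice_orthonormal b : orthonormal_seq (fun k => rotated_modes tens ket (mcons k b)).
Proof. by move=> j k; rewrite braket_rotated_slice mtailK mcons0 eqxx mul1r. Qed.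

(* For fixed noise occupations [b], the signal mode embeds isometrically. *)
Definition slice (b : multinom d.+1) : H -> Hn :=
  multiplier ket (fun k => rotated_modes tens ket (mcons k b)) (fun=> 1).

Let one_le (k : nat) : rnorm (1 : C) <= 1. Proof. by rewrite rnorm1. Qed.

(** Comparing coordinates in the rotated number basis; this reduces a measurement on n modes to a
    bounded form on one mode. *)
Lemma signal_vectorE z k b : signal_vector z k b = slice b (dk (scale%:C * z) k).
Proof.
apply/eqP; rewrite -subr_eq0; apply/eqP.
apply: (rotated_modes_total tensP ket_on ket_tot) => m.
apply/eqP; rewrite braketBr subr_eq0; apply/eqP.
rewrite rotated_modes_displacement// mcons0.
have -> : [forall (j | j != ord0), m j == mcons k b j] = (mtail m == b).
  apply/forall_inP/eqP => [h|<- j].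
    apply/mnmP => j; rewrite mtailE -(mcons_lift k b j); apply/eqP/h.
    by rewrite eq_sym neq_lift.
  by case: (unliftP ord0 j) => [i ->|->]; rewrite ?eqxx// mcons_lift mtailE.
have h := cvg_braket_multiplier ket_on (slice_orthonormal b) one_le
  (rotated_modes tens ket m) (dk (scale%:C * z) k).
apply/esym/(@cvg_uniq _ C^o _ _ _ h).
have [mb|mb] := eqVneq (mtail m) b; last first.
  apply: (@cvg_ext C^o (fun=> 0)); last exact: cvg_cst.
  move=> j; rewrite /series /= big1// => i _.
  by rewrite braket_rotated_slice (negPf mb) !mul0r mulr0.
have h2 := parseval_braket (ket (m ord0)) (dk (scale%:C * z) k) ket_on ket_tot.
apply: cvg_ext h2 => j; rewrite /series /=; apply: eq_bigr => i _.
by rewrite mul1r braket_rotated_slice mb eqxx mul1r ket_on.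
Qed.

Variable D : set (borelType A) -> Hn -> Hn.
Hypothesis D_povm : is_povm D.

Lemma slice_form b B : measurable B -> bounded_form (fun u v => ⟨slice b u, D B (slice b v)⟩).
Proof.
move=> mB; have [lin herm bnd] := povm_form D_povm mB.
have s_lin := multiplier_linear ket_on (slice_orthonormal b) one_le.
have s_bnd v : rnorm (slice b v) <= rnorm v.
  by rewrite -[leRHS]mul1r; exact: (rnorm_multiplier ket_on (slice_orthonormal b) one_le).
split.
- move=> u a v w.
  have -> : slice b (a *: v + w) = a *: slice b v + slice b w by exact: s_lin.
  exact: lin.
- by move=> u v; exact: herm.
- move=> u v; apply: le_trans (bnd _ _) _.
  by apply: ler_pM; rewrite ?rnorm_ge0// s_bnd.
Qed.

End signal_twirl.
Arguments twirl_points {R} d q.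

Section average_twirl.
Context {R : realType} {A : pmetricType R} {H Hn : hilbertType R} {d : nat}.
Local Notation n := d.+2.
Local Notation C := R[i].
Variables (ket : nat -> H) (tens : ('I_n -> H) -> Hn).
Hypotheses (ket_on : orthonormal_seq ket) (ket_tot : total_seq ket).
Hypothesis tensP : is_tensor_power tens.
Local Notation signal := (signal_vector ket tens).

(** The constant E precedes the POVM, the grid size, the noise pattern and the outcome set, so a
    single grid can serve all patterns and sets. *)
Lemma average_twirl k : exists2 E : R, 0 <= E &
  forall (D : set (borelType A) -> Hn -> Hn) (D_povm : is_povm D) q b B,
    (0 < q)%N -> measurable B ->
    ((average_measure D_povm [seq signal z 0%N b | z <- twirl_points d q] B : \bar R) <=
     (average_measure D_povm [seq signal z k b | z <- twirl_points d q] B : \bar R) + (E / q%:R)%:E)%E.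
Proof.
have [E E0 hE] := twirl ket_on ket_tot k; exists E => // D D_povm q b B q0 mB.
have {hE} := hE _ q (slice_form ket_on tensP D_povm b mB) q0.
set c : R := Num.sqrt n%:R.
have c0 : c != 0 by rewrite gt_eqF// sqrtr_gt0 ltr0n.
have cz (w : C) : c%:C * ((c^-1)%:C * w) = w.
  by rewrite mulrA -rmorphM /= divff// mul1r.
pose r k z := complex.Re ⟨signal z k b, D B (signal z k b)⟩.
set S := (X in rnorm X <= _) => hE.
have SE : complex.Re S = \sum_(z <- twirl_points d q) (r k z - r 0%N z).
  rewrite /twirl_points big_flatten big_map raddf_sum /index_iota subn0; apply: eq_bigr => l _.
  rewrite big_map raddf_sum; apply: eq_bigr => m _.
  by rewrite raddfB /= /r !(signal_vectorE ket_on ket_tot tensP) -/c !cz.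
have hR : \sum_(z <- twirl_points d q) r 0%N z <=
    \sum_(z <- twirl_points d q) r k z + q%:R ^+ 3 * E.
  rewrite -lerBlDl -sumrB -[leLHS]opprK -sumrN; under eq_bigr do rewrite opprB.
  rewrite -SE; apply: le_trans hE; apply: le_trans (Re_le_rnorm S).
  by rewrite -normrN ler_norm.
have le_of_real (x y : \bar R) (a a' e : R) :
    x = a%:E -> y = a'%:E -> a <= a' + e -> (x <= y + e%:E)%E.
  by move=> -> ->; rewrite -EFinD lee_fin.
have aE k' : average_measure D_povm [seq signal z k' b | z <- twirl_points d q] B =
    ((q ^ 4)%N%:R^-1 * \sum_(z <- twirl_points d q) r k' z)%:E.
  rewrite average_measureE size_map size_twirl_points big_map EFinM -sumEFin.
  by congr (_ * _)%E; apply: eq_bigr => z _; rewrite povm_measureE.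
refine (le_of_real _ _ _ _ _ (aE 0%N) (aE k) _).
have q0' : (q%:R : R) != 0 by rewrite pnatr_eq0 -lt0n.
(* An error of size q^3 averaged over q^4 points. *)
have -> : E / q%:R = (q ^ 4)%N%:R^-1 * (q%:R ^+ 3 * E).
  by rewrite natrX; move: (q%:R : R) q0' => x x0; field.
by rewrite -mulrDr ler_wpM2l// invr_ge0.
Qed.

End average_twirl.

Section bounded_integrals.
Context {R : realType} {dT : measure_display} {T : measurableType dT}.
Local Open Scope ereal_scope.

Lemma integral_prob_bound (mu : {measure set T -> \bar R}) (f : T -> R) (M : R) :
  mu setT = 1 -> measurable_fun setT f -> (forall a, 0 <= f a <= M)%R ->
  exists2 r : R, (0 <= r <= M)%R & \int[mu]_a (f a)%:E = r%:E.
Proof.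
move=> mu1 mf f0M.
have I0 : 0 <= \int[mu]_a (f a)%:E.
  by apply: integral_ge0 => a _; rewrite lee_fin; have /andP[] := f0M a.
have IM : \int[mu]_a (f a)%:E <= M%:E.
  apply: (@le_trans _ _ (\int[mu]_a M%:E)); last by rewrite integral_cst// mu1 mule1.
  apply: ge0_le_integral => //.
  - by move=> a _; rewrite lee_fin; have /andP[] := f0M a.
  - exact/measurable_EFinP.
  - by move=> a _; rewrite lee_fin; have /andP[] := f0M a.
have If : \int[mu]_a (f a)%:E \is a fin_num.
  by rewrite ge0_fin_numE// (le_lt_trans IM)// ltry.
exists (fine (\int[mu]_a (f a)%:E)); last by rewrite fineK.
by rewrite -!lee_fin fineK// I0.
Qed.

End bounded_integrals.

Section tail_weights.
Context {R : realType}.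

Lemma thermal_weight_tail (N : R) k0 n : 0 < N ->
  \sum_(0 <= k < n) thermal_weight N k * (k0 <= k)%N%:R <= (N / (N + 1)) ^+ k0.
Proof.
move=> N0; have x0 := thermal_ratio_ge0 N0.
have [nk|/ltnW kn] := leqP n k0.
  rewrite big_nat big1 ?exprn_ge0// => k /andP[_ kn].
  by rewrite leqNgt (leq_trans kn nk) mulr0.
rewrite (big_cat_nat (n := k0))//= big_nat big1 => [|k /andP[_ kk0]]; last first.
  by rewrite leqNgt kk0 mulr0.
rewrite add0r; have := thermal_weight_sum n N0.
rewrite (big_cat_nat (n := k0))//= thermal_weight_sum// => /(canRL (addKr _)) h.
rewrite big_nat; under eq_bigr => k /andP[kk _] do rewrite kk mulr1.
rewrite -big_nat h; have := exprn_ge0 n x0.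
by move: (_ ^+ n) (_ ^+ k0) => a b; lra.
Qed.

(** Below the cutoff the twirling error applies; above it only the trivial bound M is available, but
    the thermal mass there is at most (N/(N+1))^k0. *)
Lemma thermal_weight_err (N eps M : R) k0 : 0 < N -> 0 <= M -> 0 <= eps ->
  M * (N / (N + 1)) ^+ k0 <= eps / 2 ->
  (\sum_(0 <= k <oo) (thermal_weight N k * (if (k < k0)%N then eps / 2 else M))%:E
     <= eps%:E)%E.
Proof.
move=> N0 M0 eps0 Mx.
have err0 k : 0 <= (if (k < k0)%N then eps / 2 else M).
  by case: ifP => // _; rewrite divr_ge0.
apply: lime_le.
  apply: is_cvg_nneseries => k _ _; rewrite lee_fin mulr_ge0//.
  exact: thermal_weight_ge0.
apply: nearW => n; rewrite sumEFin lee_fin.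
apply: (@le_trans _ _ (eps / 2 * \sum_(0 <= k < n) thermal_weight N k +
    M * \sum_(0 <= k < n) thermal_weight N k * (k0 <= k)%N%:R)).
  rewrite !mulr_sumr -big_split; apply: ler_sum => k _ /=.
  have t0 := thermal_weight_ge0 k N0; rewrite (leqNgt k0 k).
  case: ltnP => _; rewrite ?mulr0 ?mulr1 ?addr0 1?mulrC//.
  by rewrite [M * _]mulrC lerDr mulr_ge0// divr_ge0.
have h1 := thermal_weight_sum_le1 n N0; have h2 := thermal_weight_tail k0 n N0.
rewrite [leRHS]splitr; apply: lerD.
  by rewrite ler_piMr// divr_ge0.
by apply: le_trans Mx; apply: ler_wpM2l.
Qed.

End tail_weights.

Section average_kernels.
Context {R : realType} {A : pmetricType R} {H Hn : hilbertType R} {d : nat}.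
Local Notation n := d.+2.
Local Notation C := R[i].
Variables (ket : nat -> H) (tens : ('I_n -> H) -> Hn).
Hypotheses (ket_on : orthonormal_seq ket) (ket_tot : total_seq ket).
Hypothesis tensP : is_tensor_power tens.
Variable D : set (borelType A) -> Hn -> Hn.
Hypothesis D_povm : is_povm D.
Variable pts : seq C.
Hypothesis pts0 : pts != [::].
Local Notation signal := (signal_vector ket tens).

(* Given [s], measure a displaced vacuum of the signal mode accompanied by a
   uniform noise pattern of total degree [s]. *)
Definition average_kernel of orthonormal_seq ket & total_seq ket & is_tensor_power tens
    & pts != [::] : nat -> {measure set (borelType A) -> \bar R} :=
  fun s => average_measure D_povm
    [seq signal z 0%N b | b <- degree_multinoms s, z <- pts].

Local Notation delta := (average_kernel ket_on ket_tot tensP pts0).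

Let delta_measurable U : measurable U -> measurable_fun [set: nat] (delta ^~ U).
Proof. by []. Qed.

HB.instance Definition _ := isKernel.Build _ _ nat (borelType A) R delta delta_measurable.

Let delta_prob s : delta s setT = 1%E.
Proof.
apply: average_measureT.
  rewrite -size_eq0 size_allpairs muln_eq0 !size_eq0 (negPf pts0) orbF.
  by rewrite -size_eq0 size_degree_multinoms -lt0n bin_gt0 leq_addr.
move=> v /allpairsP[[b z] [_ _ ->]]; exact: rnorm_signal_vector.
Qed.

HB.instance Definition _ := Kernel_isProbability.Build _ _ nat (borelType A) R delta delta_prob.

Lemma classical_risk_average (L : R -> A -> R) N : 
  measurable_fun [set: borelType A] (L N : borelType A -> R) -> (forall a, 0 <= L N a) ->
  classical_risk d.+1 L N delta =
  (\sum_(0 <= s <oo) (noise_weight (d := d) N s)%:E *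
    \sum_(b <- degree_multinoms s)
      \int[average_measure D_povm [seq signal z 0%N b | z <- pts]]_(a in [set: borelType A]) (L N a)%:E)%E.
Proof.
move=> mL L0; apply: eq_eseriesr => s _; rewrite negbinE integral_average//.
rewrite big_flatten big_map size_allpairs.
set B := degree_multinoms s.
have B0 : ((size B)%:R : R) != 0.
  by rewrite pnatr_eq0 size_degree_multinoms -lt0n bin_gt0 leq_addr.
have p0 : ((size pts)%:R : R) != 0 by rewrite pnatr_eq0 size_eq0.
rewrite muleA -EFinM natrM.
(* The number of patterns in the negative binomial weight cancels against the uniform choice of a
   pattern. *)
have -> : (size B)%:R * noise_weight (d := d) N s * ((size B)%:R * (size pts)%:R)^-1 =
    noise_weight (d := d) N s * (size pts)%:R^-1.
  by field; rewrite B0 p0.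
rewrite EFinM -muleA; congr (_ * _)%E.
rewrite ge0_sume_distrr => [|b _]; last first.
  by apply: sume_ge0 => v _; apply: integral_ge0 => a _; rewrite lee_fin.
apply: eq_bigr => b _; rewrite integral_average// size_map; congr (_ * _)%E.
Qed.

End average_kernels.

Section lower_bound.
Context {R : realType} {A : pmetricType R} {H Hn : hilbertType R} {d : nat}.
Local Notation n := d.+2.
Local Notation C := R[i].
Variables (ket : nat -> H) (tens : ('I_n -> H) -> Hn).
Hypotheses (ket_on : orthonormal_seq ket) (ket_tot : total_seq ket).
Hypothesis tensP : is_tensor_power tens.
Variable enc : nat -> multinom n.
Hypothesis enc_bij : bijective enc.
Variable D : set (borelType A) -> Hn -> Hn.
Hypothesis D_povm : is_povm D.
Local Notation signal := (signal_vector ket tens).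

Lemma vanishing_power (M x eps : R) : 0 <= x < 1 -> 0 < eps ->
  exists k : nat, M * x ^+ k <= eps.
Proof.
move=> /andP[x0 x1] eps0.
have h : (fun k => M * x ^+ k) @ \oo --> M * 0.
  by apply: cvgMl_tmp; apply: cvg_expr; rewrite ger0_norm.
rewrite mulr0 in h; have /cvgrPdist_lt /(_ _ eps0) [k _ /(_ k (leqnn k))] := h.
by rewrite sub0r normrN => /ltW/(le_trans (ler_norm _)); exists k.
Qed.

Lemma twirled_family (M eps : R) k0 : 0 <= M -> 0 < eps ->
  exists2 pts : seq C, pts != [::] & exists2 e : R, 0 <= e /\ M * e <= eps &
  forall k b B, (k < k0)%N -> measurable B ->
    ((average_measure D_povm [seq signal z 0%N b | z <- pts] B : \bar R) <=
     (average_measure D_povm [seq signal z k b | z <- pts] B : \bar R) + e%:E)%E.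
Proof.
move=> M0 eps0.
have /choice[E hE] : forall k, exists E : R, 0 <= E /\
  forall (D : set (borelType A) -> Hn -> Hn) (D_povm : is_povm D) q b B,
    (0 < q)%N -> measurable B ->
    ((average_measure D_povm [seq signal z 0%N b | z <- twirl_points d q] B : \bar R) <=
     (average_measure D_povm [seq signal z k b | z <- twirl_points d q] B : \bar R)
       + (E / q%:R)%:E)%E.
  by move=> k; have [E E0 hE] := average_twirl (A := A) ket_on ket_tot tensP k; exists E.
pose Es := \sum_(0 <= k < k0) E k.
have Es0 : 0 <= Es by apply: sumr_ge0 => k _; case: (hE k).
(* One grid has to serve every k < k0, so the constants are added up and q is taken larger than M Es
   / eps. *)
pose q := (Num.trunc (M * Es / eps)).+1.
have q0 : 0 < (q%:R : R) by rewrite ltr0n.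
exists (twirl_points d q); first by rewrite -size_eq0 size_twirl_points expn_eq0.
exists (Es / q%:R).
  split; first by rewrite divr_ge0// ltW.
  rewrite mulrA ler_pdivrMr// [eps * _]mulrC -ler_pdivrMr//.
  by apply/ltW; exact: truncnS_gt.
move=> k b B kk0 mB; have [_ /(_ D D_povm q b B isT mB)] := hE k.
move=> h; apply: le_trans h _; apply: leeD => //.
rewrite lee_fin ler_pM2r ?invr_gt0// /Es (bigD1_seq k) ?mem_index_iota ?iota_uniq//=.
by rewrite lerDl; apply: sumr_ge0 => i _; case: (hE i).
Qed.

(** The grid and the rule depend only on D, M, x1 and eps, so they are the same for all admissible N
    and L; x1 enters only through the choice of the cutoff. *)
Lemma classical_risk_le_average (M x1 eps : R) : 0 <= M -> 0 <= x1 < 1 -> 0 < eps ->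
  exists2 pts : seq C, pts != [::] & exists delta : R.-pker nat ~> borelType A,
  forall (L : R -> A -> R) N, 0 < N -> N / (N + 1) <= x1 ->
    measurable_fun [set: borelType A] (L N : borelType A -> R) -> (forall a, 0 <= L N a <= M) ->
    (classical_risk d.+1 L N delta <=
     ((size pts)%:R^-1)%:E * \sum_(z <- pts) quantum_risk ket tens L z N D + eps%:E)%E.
Proof.
move=> M0 x1_01 eps0; have eps20 : 0 < eps / 2 by rewrite divr_gt0.
have [k0 hk0] := vanishing_power M x1_01 eps20.
have [pts pts0 [e [e0 Me] he]] := twirled_family k0 M0 eps20.
exists pts => //; exists (average_kernel D_povm ket_on ket_tot tensP pts0 : R.-pker nat ~> borelType A).
move=> L N N0 Nx mL L0M; have L0 a : 0 <= L N a by have /andP[] := L0M a.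
rewrite classical_risk_average//.
pose avg k b := average_measure D_povm [seq signal z k b | z <- pts].
have avgT k b : avg k b setT = 1%E.
  apply: average_measureT; first by rewrite -size_eq0 size_map size_eq0.
  by move=> v /mapP[z _ ->]; exact: rnorm_signal_vector.
(* Integrals of the bounded loss are replaced by real numbers, away from the arithmetic of infinite
   values. *)
have /choice[jv hjv] : forall kb : nat * multinom d.+1, exists r : R, 0 <= r <= M /\
    (\int[avg kb.1 kb.2]_(a in [set: borelType A]) (L N a)%:E)%E = r%:E.
  by move=> [k b]; have [r] := integral_prob_bound (avgT k b) mL L0M; exists r.
have jv0 k b : 0 <= jv (k, b) by have [/andP[]] := hjv (k, b).
have jvM k b : jv (k, b) <= M by have [/andP[]] := hjv (k, b).
have jvE k b : (\int[avg k b]_(a in [set: borelType A]) (L N a)%:E)%E = (jv (k, b))%:E.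
  by have [] := hjv (k, b).
pose err k := if (k < k0)%N then eps / 2 else M.
have err0 k : 0 <= err k by rewrite /err; case: ifP => // _; exact: ltW.
have jv_err k b : jv (0%N, b) <= jv (k, b) + err k.
  rewrite /err; case: ifP => kk0; last by rewrite (le_trans (jvM _ _))// lerDr.
  apply: (@le_trans _ _ (jv (k, b) + M * e)); last by rewrite lerD2l.
  rewrite -lee_fin EFinD -!jvE; apply: layer_cake_le => //; first by rewrite avgT.
  by move=> B mB; exact: he.
have w0 j : (0 <= (mode_weight (d := d) N (mdeg (enc j)))%:E)%E.
  by rewrite lee_fin mode_weight_ge0.
(* The thermal weights of the signal, of total mass one, are inserted so that both risks become sums
   over the same occupation patterns. *)
have -> : (\sum_(0 <= s <oo) (noise_weight (d := d) N s)%:E *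
    \sum_(b <- degree_multinoms s) \int[avg 0%N b]_(a in [set: borelType A]) (L N a)%:E =
    \sum_(0 <= j <oo) (mode_weight (d := d) N (mdeg (enc j)))%:E *
      (jv (0%N, mtail (enc j)))%:E)%E.
  rewrite (@sum_mode_weight _ _ enc N (fun m => (jv (0%N, mtail m))%:E))//; last first.
    by move=> m; rewrite lee_fin.
  apply: eq_eseriesr => s _; congr (_ * _)%E.
  under eq_bigr do rewrite jvE.
  transitivity (\sum_(0 <= k <oo) (thermal_weight N k)%:E *
      \sum_(b <- degree_multinoms s) (jv (0%N, b))%:E)%E; last first.
    apply: eq_eseriesr => k _; congr (_ * _)%E; apply: eq_bigr => b _.
    by rewrite mtailK.
  rewrite sumEFin; under [RHS]eq_eseriesr do rewrite muleC.
  rewrite nneseriesZl ?thermal_weight_series ?mule1// => k _.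
  by rewrite lee_fin thermal_weight_ge0.
apply: (@le_trans _ _ (\sum_(0 <= j <oo) (mode_weight (d := d) N (mdeg (enc j)))%:E *
    (jv (enc j ord0, mtail (enc j)))%:E +
    \sum_(0 <= j <oo) (mode_weight (d := d) N (mdeg (enc j)))%:E * (err (enc j ord0))%:E)%E).
  rewrite -nneseriesD; first last.
  - by move=> j _ _; rewrite mule_ge0// lee_fin.
  - by move=> j _ _; rewrite mule_ge0// lee_fin.
  apply: lee_nneseries => [j _ _|j _]; first by rewrite mule_ge0// lee_fin.
  by rewrite -muleDr// -EFinD; apply: lee_wpmul2l => //; rewrite lee_fin jv_err.
apply: leeD.
  rewrite le_eqVlt; apply/orP; left; apply/eqP.
  under [in RHS]eq_bigr do rewrite (quantum_riskE ket_on ket_tot tensP enc_bij D_povm)//.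
  have I0 z j : (0 <= \int[povm_measure D_povm (signal_modes ket tens enc z j)]_(a in [set: borelType A]) (L N a)%:E)%E.
    by apply: integral_ge0 => a _; rewrite lee_fin.
  rewrite -nneseries_sum; last by move=> z j _; apply: mule_ge0 (w0 _) (I0 _ _).
  rewrite -nneseriesZl; last by move=> j _; apply: sume_ge0 => z _; apply: mule_ge0 (w0 _) (I0 _ _).
  apply: eq_eseriesr => j _; rewrite -jvE /avg integral_average// size_map big_map.
  rewrite muleCA; congr (_ * _)%E.
  rewrite ge0_sume_distrr; last first.
    by move=> z _; apply: integral_ge0 => a _; rewrite lee_fin.
  apply: eq_bigr => z _.
  rewrite /signal_vector mconsK.
  by [].
rewrite (@sum_mode_weight _ _ enc N (fun m => (err (m ord0))%:E))//; last first.
  by move=> m; rewrite lee_fin.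
set T := (\sum_(0 <= k <oo) (thermal_weight N k * err k)%:E)%E.
have T_le : (T <= eps%:E)%E.
  apply: thermal_weight_err => //; first exact: ltW.
  apply: le_trans hk0; apply: ler_wpM2l => //.
  by rewrite lerXn2r ?nnegrE ?thermal_ratio_ge0//; case/andP: x1_01.
have tw0 k : 0 <= thermal_weight N k * err k by rewrite mulr_ge0// thermal_weight_ge0.
have T0 : (0 <= T)%E by apply: nneseries_ge0 => k _ _; rewrite lee_fin.
have Tf : T \is a fin_num by rewrite ge0_fin_numE// (le_lt_trans T_le)// ltry.
(* The error depends on the signal occupation only, so it factors into its thermal mean and the
   total noise mass. *)
have -> : (\sum_(0 <= s <oo) (noise_weight (d := d) N s)%:E * \sum_(0 <= k <oo)
    (thermal_weight N k)%:E * \sum_(b <- degree_multinoms (d := d) s) (err (mcons k b ord0))%:E =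
    T * \sum_(0 <= s <oo) (negbin d.+1 N s)%:E)%E.
  rewrite -(fineK Tf) -nneseriesZl => [|s _]; last first.
    by rewrite lee_fin negbinE mulr_ge0// noise_weight_ge0.
  apply: eq_eseriesr => s _.
rewrite negbinE (fineK Tf) [in RHS]EFinM muleC [RHS]muleA; congr (_ * _)%E.
  rewrite [RHS]muleC.
  rewrite /T -nneseriesZl => [|k _]; last by rewrite lee_fin.
  apply: eq_eseriesr => k _; under eq_bigr do rewrite mcons0.
  rewrite sumEFin big_const_seq count_predT iter_addr_0 -!EFinM; congr (_%:E).
  by rewrite -mulr_natl; ring.
apply: (@le_trans _ _ (T * 1)%E); last by rewrite mule1.
apply: lee_wpmul2l => //; exact: (negbin_sum_le1 ket_on tensP enc_bij).
Qed.

End lower_bound.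

(** * Continuity of the loss and measurability of the risks *)

Section loss_measurability.
Context {R : realType} {A : pmetricType R}.
Variables (K : set R) (L : R -> A -> R) (M : R).
Hypothesis A_compact : compact [set: A].
Hypothesis L_bound : forall N a, K N -> 0 <= L N a <= M.
Hypothesis L_continuous : {within K `*` [set: A], continuous (fun x => L x.1 x.2)}.

Lemma loss_near N a e : K N -> 0 < e ->
  \forall b \near a & N' \near within K (nbhs N), `|L N a - L N' b| < e.
Proof.
move=> KN e0.
have := (subspace_continuousP _ _).1 L_continuous (N, a) (conj KN I).
move=> /cvgrPdist_lt /(_ _ e0) [[U V] /= [nU nV] UV].
exists (V, [set N' | K N' /\ U N']).
  split; first exact: nV.
  by rewrite /within /=; have := nU; apply: filterS => N' UN' KN'.
by move=> [b N'] /= [Vb [KN' UN']]; apply: (UV (N', b)).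
Qed.

Lemma loss_measurable N : K N -> measurable_fun [set: borelType A] (L N : borelType A -> R).
Proof.
move=> KN mT; apply: (measurability _ (RGenOInfty.measurableE R)) => //.
move=> _ [_ [x ->] <-]; rewrite setTI; apply: sub_sigma_algebra => /=.
rewrite openE => a /=; rewrite in_itv/= andbT => La.
have e0 : 0 < L N a - x by rewrite subr_gt0.
have := loss_near a KN e0.
move=> [[V W] /= [nV nW] VW]; rewrite /interior; apply: filterS nV => b Vb.
have WN : W N by apply: (nbhs_singleton nW).
have /= := VW (b, N) (conj Vb WN).
rewrite /= in_itv/= andbT => /(le_lt_trans (ler_norm _)); lra.
Qed.

(** The tube lemma, by compactness of the action space. Continuity at (N, a) is used twice, for (N,
    b) and for (N', b), hence e/2. *)
Lemma loss_uniform N e : K N -> 0 < e ->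
  \forall N' \near within K (nbhs N), forall a, `|L N a - L N' a| <= e.
Proof.
move=> KN e0; have e20 : 0 < e / 2 by rewrite divr_gt0.
have /(_ _ (within K (nbhs N)) (fun N' a => `|L N a - L N' a| <= e)) :=
  (compact_near_coveringP [set: A]).1 A_compact.
have h (a : A) : [set: A] a -> \forall b \near a & N' \near within K (nbhs N),
    `|L N b - L N' b| <= e.
  move=> _; have [[V W] /= [nV nW] VW] := loss_near a KN e20.
  exists (V, W) => //= -[b N'] /= [Vb WN'].
  have WN : W N by apply: (nbhs_singleton nW).
  have /= h1 := VW (b, N) (conj Vb WN).
  have /= h2 := VW (b, N') (conj Vb WN').
  rewrite [X in `|X|](_ : _ = - (L N a - L N b) + (L N a - L N' b)); last by ring.
  rewrite (le_trans (ler_normD _ _))// normrN [leRHS]splitr.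
  by apply: lerD; exact: ltW.
move=> /(_ _ h); apply: filterS => N' hN' a; exact: hN'.
Qed.

Lemma integral_loss_cvg (mu : {measure set (borelType A) -> \bar R}) N :
  mu setT = 1%E -> K N ->
  fine (\int[mu]_(a in [set: borelType A]) (L N' a)%:E) @[N' --> within K (nbhs N)] -->
  fine (\int[mu]_(a in [set: borelType A]) (L N a)%:E).
Proof.
move=> mu1 KN; apply/cvgrPdist_le => e e0.
have h := loss_uniform KN e0; have hK : \forall N' \near within K (nbhs N), K N' by exact: withinT.
near=> N'.
have KN' : K N' by near: N'.
have Lu : forall a, `|L N a - L N' a| <= e by near: N'.
have [r _ rE] := integral_prob_bound mu1 (loss_measurable KN) (fun a => L_bound a KN).
have [r' _ rE'] := integral_prob_bound mu1 (loss_measurable KN') (fun a => L_bound a KN').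
have one_side N1 N2 r1 r2 : K N1 -> K N2 -> (forall a, `|L N1 a - L N2 a| <= e) ->
    (\int[mu]_(a in [set: borelType A]) (L N1 a)%:E)%E = r1%:E ->
    (\int[mu]_(a in [set: borelType A]) (L N2 a)%:E)%E = r2%:E -> r1 <= r2 + e.
  move=> K1 K2 L12 E1 E2; rewrite -lee_fin EFinD -E1 -E2.
  have L0 N'' a : K N'' -> (0 <= (L N'' a)%:E)%E.
    by move=> K2'; rewrite lee_fin; have /andP[] := L_bound a K2'.
  have mL N'' : K N'' -> measurable_fun [set: borelType A] (fun a : borelType A => (L N'' a)%:E).
    by move=> /loss_measurable ?; exact/measurable_EFinP.
  apply: (@le_trans _ _ (\int[mu]_(a in [set: borelType A]) ((L N2 a)%:E + e%:E))%E).
    apply: ge0_le_integral => //.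
    - by move=> a _; exact: L0.
    - exact: mL.
    - by apply: emeasurable_funD; [exact: mL|].
    - move=> a _; rewrite -EFinD lee_fin -lerBlDl.
      exact: le_trans (ler_norm _) (L12 a).
  rewrite ge0_integralD//; last 3 first.
  - by move=> a _; exact: L0.
  - exact: mL.
  - by move=> a _; rewrite lee_fin ltW.
  by rewrite integral_cst// mu1 mule1.
rewrite rE rE' /= ler_distl; apply/andP; split.
  by rewrite lerBlDr; apply: (one_side N' N) => // a; rewrite distrC.
exact: (one_side N N').
Unshelve. all: by end_near.
Qed.

End loss_measurability.

Section risk_measurability.
Context {R : realType} {A : pmetricType R} {H Hn : hilbertType R} {d : nat}.
Local Notation n := d.+2.
Variables (ket : nat -> H) (tens : ('I_n -> H) -> Hn).
Hypotheses (ket_on : orthonormal_seq ket) (ket_tot : total_seq ket).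
Hypothesis tensP : is_tensor_power tens.
Variable enc : nat -> multinom n.
Hypothesis enc_bij : bijective enc.
Variables (K : set R) (L : R -> A -> R) (M : R).
Hypotheses (K_gt0 : forall N, K N -> 0 < N) (K_compact : compact K).
Hypothesis A_compact : compact [set: A].
Hypothesis L_bound : forall N a, K N -> 0 <= L N a <= M.
Hypothesis L_continuous : {within K `*` [set: A], continuous (fun x => L x.1 x.2)}.

Lemma mode_weight_continuous s (N : R) : 0 < N ->
  mode_weight (d := d) N' s @[N' --> N] --> mode_weight (d := d) N s.
Proof.
move=> N0; have N1 : N + 1 != 0 by rewrite gt_eqF// addr_gt0.
have h1 : N' + 1 @[N' --> N] --> N + 1 by apply: cvgD; [exact: cvg_id|exact: cvg_cst].
have h2 : (N' + 1)^-1 @[N' --> N] --> (N + 1)^-1 by exact: cvgV.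
have hX (f : R -> R) (l : R) k : f N' @[N' --> N] --> l -> f N' ^+ k @[N' --> N] --> l ^+ k.
  move=> fl; exact: (continuous_cvg _ (@exprn_continuous _ k l) fl).
apply: cvgM; apply: hX => //; apply: cvgM => //; exact: cvg_id.
Qed.

Lemma compact_measurable_set : measurable (K : set R).
Proof. by apply: closed_measurable; apply: compact_closed K_compact; exact: Rhausdorff. Qed.

(** On K the risk is a series of non-negative functions of N, each continuous: a thermal weight
    times the integral of the loss under a fixed law. *)
Lemma quantum_risk_measurable (D : set (borelType A) -> Hn -> Hn) z : is_povm D ->
  measurable_fun K (fun N => quantum_risk ket tens L z N D).
Proof.
move=> D_povm.
pose f j N := (mode_weight (d := d) N (mdeg (enc j)) *
  fine (\int[povm_measure D_povm (signal_modes ket tens enc z j)]_(a in [set: borelType A]) (L N a)%:E))%R.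
have nu1 j : povm_measure D_povm (signal_modes ket tens enc z j) setT = 1%E.
  by rewrite povm_measureT (rnorm_ket (signal_modes_orthonormal ket_on ket_tot tensP enc_bij z)) expr1n.
have KL0 N : K N -> forall a, 0 <= L N a by move=> KN a; have /andP[] := L_bound a KN.
have f0 j N : K N -> 0 <= f j N.
  move=> KN; rewrite mulr_ge0 ?mode_weight_ge0 ?fine_ge0//; first exact: K_gt0.
  by apply: integral_ge0 => a _; rewrite lee_fin KL0.
have fE N : K N -> quantum_risk ket tens L z N D = (\sum_(0 <= j <oo | j \in predT) (f j N)%:E)%E.
  move=> KN; rewrite (quantum_riskE ket_on ket_tot tensP enc_bij D_povm)//.
  - apply: eq_eseriesr => j _; rewrite /f.
    have [r _ ->] := integral_prob_bound (nu1 j)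
      (loss_measurable L_continuous KN) (fun a => L_bound a KN).
    by rewrite EFinM.
  - exact: K_gt0.
  - exact: (loss_measurable L_continuous KN).
  - exact: KL0.
apply: (eq_measurable_fun (fun N => \sum_(0 <= j <oo | j \in predT) (f j N)%:E)%E).
  by move=> N; rewrite inE => /fE ->.
apply: ge0_emeasurable_sum => [j N KN _|j _]; first by rewrite lee_fin f0.
apply/measurable_EFinP; apply: subspace_continuous_measurable_fun.
  exact: compact_measurable_set.
apply/subspace_continuousP => N KN; apply: cvgM.
  apply: cvg_within_filter; exact: mode_weight_continuous (K_gt0 KN).
exact: (integral_loss_cvg A_compact L_bound L_continuous (nu1 j) KN).
Qed.

End risk_measurability.

Lemma average_le (R : realType) (I : eqType) (r : seq I) (f : I -> \bar R) (S : \bar R) :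
  r != [::] -> (forall i, i \in r -> (0 <= f i <= S)%E) ->
  (((size r)%:R^-1)%:E * \sum_(i <- r) f i <= S)%E.
Proof.
case: r => // i0 r _ fS; set p := size _.
have p0 : (p%:R : R) != 0 by rewrite pnatr_eq0.
have S0 : (0 <= S)%E.
  by have /andP[h1 h2] := fS i0 (mem_head _ _); exact: le_trans h2.
move: S S0 fS => [s||] //; last by move=> _ _; rewrite leey.
move=> s0 fS; apply: (@le_trans _ _ ((p%:R^-1)%:E * \sum_(i <- i0 :: r) s%:E)%E).
  apply: lee_wpmul2l; first by rewrite lee_fin.
  by rewrite !big_seq; apply: lee_sum => i /fS/andP[].
by rewrite sumEFin big_const_seq count_predT iter_addr_0 -EFinM lee_fin -/p -[s *+ p]mulr_natl mulKf.
Qed.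

(** * The minimax and Bayes identities *)

Section minimax.
Context {R : realType} {A : pmetricType R} {H Hn : hilbertType R} {d : nat}.
Local Notation n := d.+2.
Local Notation C := R[i].
Variables (ket : nat -> H) (tens : ('I_n -> H) -> Hn).
Hypotheses (ket_on : orthonormal_seq ket) (ket_tot : total_seq ket).
Hypothesis tensP : is_tensor_power tens.
Variables (K : set R) (L : R -> A -> R) (M : R).
Hypotheses (K_gt0 : forall N, K N -> 0 < N) (K_compact : compact K).
Hypothesis A_compact : compact [set: A].
Hypothesis M_ge0 : 0 <= M.
Hypothesis L_bound : forall N a, K N -> 0 <= L N a <= M.
Hypothesis L_continuous : {within K `*` [set: A], continuous (fun x => L x.1 x.2)}.
Local Notation risk := (quantum_risk ket tens L).

Let mL N : K N -> measurable_fun [set: borelType A] (L N : borelType A -> R).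
Proof. exact: loss_measurable. Qed.

Lemma quantum_risk_ge0 (D : set (borelType A) -> Hn -> Hn) z N : is_povm D -> K N ->
  (0 <= risk z N D)%E.
Proof.
move=> D_povm KN; have [enc enc_bij] := multinom_enumeration d.+1.
have L0 a : 0 <= L N a by have /andP[] := L_bound a KN.
rewrite (quantum_riskE ket_on ket_tot tensP enc_bij D_povm) ?K_gt0//; last exact: mL.
apply: nneseries_ge0 => j _ _; rewrite mule_ge0 ?lee_fin ?mode_weight_ge0 ?K_gt0//.
by apply: integral_ge0 => a _; rewrite lee_fin.
Qed.

Lemma povm_of_rule (delta : R.-pker nat ~> borelType A) :
  exists2 D : set (borelType A) -> Hn -> Hn, is_povm D &
    forall z N, K N -> risk z N D = classical_risk d.+1 L N delta.
Proof.
have [enc enc_bij] := multinom_enumeration d.+1.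
have [D D_povm hD] := noise_povm ket_on ket_tot tensP enc_bij delta.
exists D => // z N KN; apply: (hD L z N M); first exact: K_gt0.
  exact: mL.
by move=> a; exact: L_bound.
Qed.

Lemma rule_of_povm (D : set (borelType A) -> Hn -> Hn) (eps : R) : is_povm D -> 0 < eps ->
  exists2 pts : seq C, pts != [::] & exists delta : R.-pker nat ~> borelType A,
  forall N, K N -> (classical_risk d.+1 L N delta <=
     ((size pts)%:R^-1)%:E * \sum_(z <- pts) risk z N D + eps%:E)%E.
Proof.
move=> D_povm eps0; have [enc enc_bij] := multinom_enumeration d.+1.
have [B0 [_ hB]] := compact_bounded K_compact.
(* [compact_bounded] grants every bound above B0; as N/(N+1) increases with N, it stays below x1 =
   B/(B+1) on K. *)
pose B := `|B0| + 1; have B_gt0 : 0 < B by rewrite (lt_le_trans ltr01)// lerDr.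
have KB N : K N -> N <= B.
  move=> KN; apply: le_trans (ler_norm N) _; apply: (hB B) => //.
  by rewrite (le_lt_trans (ler_norm _))// ltrDl.
have x1_01 : 0 <= B / (B + 1) < 1 by rewrite thermal_ratio_ge0// thermal_ratio_lt1.
have [pts pts0 [delta hdelta]] :=
  classical_risk_le_average ket_on ket_tot tensP enc_bij D_povm M_ge0 x1_01 eps0.
exists pts => //; exists delta => N KN; have N0 := K_gt0 KN.
apply: hdelta => //; [|exact: mL|by move=> a; exact: L_bound].
have B1 : 0 < B + 1 by exact: addr_gt0.
rewrite ler_pdivrMr ?addr_gt0// mulrAC ler_pdivlMr//.
by have := KB N KN; nra.
Qed.

(** On K the rule has the risk of its POVM, whose measurability is already known. *)
Lemma classical_risk_measurable (delta : R.-pker nat ~> borelType A) :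
  measurable_fun K (fun N => classical_risk d.+1 L N delta).
Proof.
have [enc enc_bij] := multinom_enumeration d.+1.
have [D D_povm hD] := povm_of_rule delta.
apply: (eq_measurable_fun (fun N => risk 0 N D)).
  by move=> N; rewrite inE => /hD ->.
exact: (quantum_risk_measurable ket_on ket_tot tensP enc_bij K_gt0 K_compact
  A_compact L_bound L_continuous 0 D_povm).
Qed.

Lemma minimax_risk :
  ereal_inf [set ereal_sup [set risk z N D | z in [set: R[i]] & N in K]
            | D in [set D : set (borelType A) -> Hn -> Hn | is_povm D]] =
  ereal_inf [set ereal_sup [set classical_risk d.+1 L N delta | N in K]
            | delta in [set: R.-pker nat ~> borelType A]].
Proof.
apply/eqP; rewrite eq_le; apply/andP; split; apply: le_ereal_inf_tmp.
- move=> _ [delta _ <-]; have [D D_povm hD] := povm_of_rule delta.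
  apply: ge_ereal_inf; eexists; first by exists D.
  apply: ge_ereal_sup => _ [z _ [N KN <-]]; rewrite hD//.
  by apply: ereal_sup_ubound; exists N.
- move=> _ [D D_povm <-]; apply/lee_addgt0Pr => e e0.
  have [pts pts0 [delta hdelta]] := rule_of_povm D_povm e0.
  apply: ge_ereal_inf; eexists; first by exists delta.
  apply: ge_ereal_sup => _ [N KN <-]; apply: le_trans (hdelta N KN) _.
  apply: leeD => //; apply: average_le => // z _; rewrite quantum_risk_ge0//=.
  by apply: ereal_sup_ubound; exists z => //; exists N.
Qed.

Lemma bayes_risk (Pi : probability R R) : Pi K = 1%E ->
  ereal_inf [set ereal_sup [set (\int[Pi]_(N in K) risk z N D)%E | z in [set: R[i]]]
            | D in [set D : set (borelType A) -> Hn -> Hn | is_povm D]] =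
  ereal_inf [set (\int[Pi]_(N in K) classical_risk d.+1 L N delta)%E
            | delta in [set: R.-pker nat ~> borelType A]].
Proof.
move=> PiK; have mK := compact_measurable_set K_compact.
have [enc enc_bij] := multinom_enumeration d.+1.
apply/eqP; rewrite eq_le; apply/andP; split; apply: le_ereal_inf_tmp.
- move=> _ [delta _ <-]; have [D D_povm hD] := povm_of_rule delta.
  apply: ge_ereal_inf; eexists; first by exists D.
  apply: ge_ereal_sup => _ [z _ <-]; rewrite le_eqVlt; apply/orP; left; apply/eqP.
  by apply: eq_integral => N; rewrite inE; exact: hD.
(* A single rule and grid serve all N in K, so the inequality integrates against Pi; only then is
   the average over the grid bounded by the supremum over z. *)
- move=> _ [D D_povm <-]; apply/lee_addgt0Pr => e e0.
  have [pts pts0 [delta hdelta]] := rule_of_povm D_povm e0.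
  apply: ge_ereal_inf; eexists; first by exists delta.
  have R0 z N : K N -> (0 <= risk z N D)%E by move=> KN; exact: quantum_risk_ge0.
  have mR z : measurable_fun K (fun N => risk z N D).
    exact: (quantum_risk_measurable ket_on ket_tot tensP enc_bij K_gt0 K_compact
      A_compact L_bound L_continuous z D_povm).
  have avg0 N : K N -> (0 <= ((size pts)%:R^-1)%:E * \sum_(z <- pts) risk z N D)%E.
    by move=> KN; rewrite mule_ge0 ?lee_fin// sume_ge0// => z _; exact: R0.
  have mS : measurable_fun K (fun N => \sum_(z <- pts) risk z N D)%E.
    exact: emeasurable_sum.
  have mavg : measurable_fun K (fun N => ((size pts)%:R^-1)%:E * \sum_(z <- pts) risk z N D)%E.
    exact: measurable_funeM.
  apply: (@le_trans _ _ (\int[Pi]_(N in K)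
      (((size pts)%:R^-1)%:E * \sum_(z <- pts) risk z N D + e%:E))%E).
    apply: ge0_le_integral => //.
    + move=> N KN; have [D' D'_povm hD'] := povm_of_rule delta.
      by rewrite -(hD' 0)//; exact: quantum_risk_ge0.
    + exact: classical_risk_measurable.
    + exact: emeasurable_funD.
  rewrite ge0_integralD//; last by move=> N _; rewrite lee_fin ltW.
  rewrite integral_cst// [X in (_ * X)%E]PiK mule1; apply: leeD => //.
  rewrite ge0_integralZl//; last by move=> N KN; apply: sume_ge0 => z _; exact: R0.
  rewrite ge0_integral_sum//.
  apply: average_le => // z _; rewrite integral_ge0//=; last by move=> N; exact: R0.
  by apply: ereal_sup_ubound; exists z.
Qed.

End minimax.

Theorem corollary6p5 (R : realType) (H : hilbertType R) (ket : nat -> H)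
  (ket_basis : orthonormal_basis ket)
  (n : nat) (n_ge2 : (2 <= n)%N)
  (Hn : hilbertType R) (tens : ('I_n -> H) -> Hn)
  (tens_power : is_tensor_power tens)
  (K : set R) (K_gt0 : K `<=` [set N | 0 < N]) (K_compact : compact K)
  (A : pmetricType R) (A_compact : compact [set: A])
  (L : R -> A -> R)
  (L_ge0 : forall N a, K N -> 0 <= L N a)
  (L_bounded : exists M, forall N a, K N -> L N a <= M)
  (L_continuous : {within K `*` [set: A], continuous (fun x => L x.1 x.2)}) :
  ereal_inf [set ereal_sup [set quantum_risk ket tens L z N D
                           | z in [set: R[i]] & N in K]
            | D in [set D : set (borelType A) -> Hn -> Hn | is_povm D]] =
  ereal_inf [set ereal_sup [set classical_risk n.-1 L N delta | N in K]
            | delta in [set: R.-pker nat ~> borelType A]]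
  /\
  forall Pi : probability R R, Pi K = 1%E ->
    ereal_inf [set ereal_sup [set (\int[Pi]_(N in K)
                                     quantum_risk ket tens L z N D)%E
                             | z in [set: R[i]]]
              | D in [set D : set (borelType A) -> Hn -> Hn | is_povm D]] =
    ereal_inf [set (\int[Pi]_(N in K) classical_risk n.-1 L N delta)%E
              | delta in [set: R.-pker nat ~> borelType A]].
Proof.
have [ket_on ket_tot] := (orthonormal_basisP _).1 ket_basis.
move: n_ge2 tens tens_power; case: n => [|[|d]]// _ {}tens tensP.
(* The given bound may be negative when K is empty. *)
have [M0 L_le] := L_bounded; pose M := Num.max M0 0.
have M_ge0 : 0 <= M by rewrite le_max lexx orbT.
have L_bound N a : K N -> 0 <= L N a <= M by move=> KN; rewrite L_ge0// le_max L_le.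
split=> [|Pi PiK].
  exact: (minimax_risk ket_on ket_tot tensP K_gt0 K_compact M_ge0 L_bound L_continuous).
exact: (bayes_risk ket_on ket_tot tensP K_gt0 K_compact A_compact M_ge0 L_bound L_continuous PiK).
Qed.
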